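(* Suppose that, for $i\in\{0,1,\dots,N-1\}$, $\mathbf m_h^{i+1}\in\mathbb V_h$ solves the ideal midpoint scheme, i.e. $\mathbf m_h^0=I_h\mathbf m^0$ and for all $\boldsymbol\phi_h\in\mathbb V_h$ $$\langle d_t\mathbf m_h^{i+1},\boldsymbol\phi_h\rangle_h-\alpha\langle\overline{\mathbf m}_h^{i+\frac12}\times d_t\mathbf m_h^{i+1},\boldsymbol\phi_h\rangle_h+\gamma\langle\overline{\mathbf m}_h^{i+\frac12}\times\mathcal H_{h,\lambda}\overline{\mathbf m}_h^{i+\frac12},\boldsymbol\phi_h\rangle_h=0 .$$ Then for any $i\in\{0,1,\dots,N-1\}$, $$|\mathbf m_h^{i+1}(z)|=|\mathbf m_h^i(z)|\qquad\forall z\in\mathcal N_h;$$ equivalently, $\mathbf m_h^i\in\mathcal M_h$ for all $i$ if $\mathbf m_h^0\in\mathcal M_h$. Moreover, $$\frac{\gamma}{2\alpha}\left[\mathfrak a_{h,\lambda}(\mathbf m_h^{i+1},\mathbf m_h^{i+1})-\mathfrak a_{h,\lambda}(\mathbf m_h^i,\mathbf m_h^i)\right]+k\|d_t\mathbf m_h^{i+1}\|_h^2=0 .$$ Consequently, $$\max_{0\le j\le N}\left(\|\mathbf m_h^j\|_{\mathbb L^\infty}^2+\|\mathbf m_h^j\|_{\mathbb H^1}^2\right)+k\sum_{i=0}^{N-1}\|d_t\mathbf m_h^{i+1}\|_h^2\le C,$$ where the constant $C$ may depend on $\|\mathbf m^0\|_{\mathbb H^1}$, but is independent of $N$, $h$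 and $k$.
   Context: Domain and spaces: $d\in\{1,2,3\}$; $\Omega\subset\mathbb R^d$ is an open bounded convex polytopal domain; $\mathbb L^p=L^p(\Omega;\mathbb R^3)$, $\mathbb W^{s,p}=W^{s,p}(\Omega;\mathbb R^3)$, $\mathbb H^s=\mathbb W^{s,2}$; $\langle\cdot,\cdot\rangle$ is the $L^2(\Omega)$ inner product of vector- or matrix-valued functions. The curl of an $\mathbb R^3$-valued function is the usual one for $d=3$, $\nabla\times\mathbf v=(\partial_2v_3,-\partial_1v_3,\partial_1v_2-\partial_2v_1)$ for $d=2$, and $\nabla\times\mathbf v=(0,-\partial_1v_3,\partial_1v_2)$ for $d=1$. $T,\alpha,\gamma,\kappa_{\mathrm e}>0$ and $\kappa_{\mathrm d}\in\mathbb R$ are constants. Initial datum: $\mathbf m^0:\overline\Omega\to\mathbb R^3$ satisfies $|\mathbf m^0|=1$ pointwise and, by the standing regularity assumption on the exact solution with this initial value, $\mathbf m^0\in\mathbb H^4\cap\mathbb W^{3,p}$ for some fixed $p>\max\{d,2\}$ with $d(\frac12-\frac1p)\le1$. Finite elements: $\{\mathcal T_h\}_{h>0}$ is a shape-regular, quasi-uniform family of triangulations of $\Omega$ with maximal mesh size $h$ and vertex set $\mathcal N_h$; $\mathbb V_h$ is the space of continuous $\mathbb R^3$-valued functions that are affine on each $K\in\mathcal T_h$; $I_h:C^0(\overline\Omega;\mathbb R^3)\to\mathbb V_h$ is nodal interpolation; $\varphi_z$ ($z\in\mathcal N_h$) are the scalar nodal $P_1$ basis functions and $\beta_z=\int_\Omega\varphi_z\,dx$.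 The mass-lumped product of continuous fields is $\langle\mathbf u,\mathbf v\rangle_h=\sum_{z\in\mathcal N_h}\beta_z\,\mathbf u(z)\cdot\mathbf v(z)$, with $\|\mathbf v\|_h^2=\langle\mathbf v,\mathbf v\rangle_h$. $\mathcal M_h=\{\boldsymbol\phi_h\in\mathbb V_h:|\boldsymbol\phi_h(z)|=1\ \forall z\in\mathcal N_h\}$. Bilinear forms: $\mathfrak a(\mathbf v,\boldsymbol\chi)=\kappa_{\mathrm e}\langle\nabla\mathbf v,\nabla\boldsymbol\chi\rangle+\kappa_{\mathrm d}\langle\mathbf v,\nabla\times\boldsymbol\chi\rangle+\kappa_{\mathrm d}\langle\nabla\times\mathbf v,\boldsymbol\chi\rangle$; $\mathfrak a_{h,\lambda}(\mathbf v_h,\boldsymbol\chi_h)=\mathfrak a(\mathbf v_h,\boldsymbol\chi_h)+\lambda\langle\mathbf v_h,\boldsymbol\chi_h\rangle_h$, where $\lambda>0$ is a fixed constant (independent of $h$) chosen large enough that $\mathfrak a_{h,\lambda}(\mathbf v_h,\mathbf v_h)\ge c_\lambda\|\mathbf v_h\|_{\mathbb H^1}^2$ for all $\mathbf v_h\in\mathbb V_h$ with $c_\lambda>0$ independent of $h$. $\mathcal H_{h,\lambda}:\mathbb V_h\to\mathbb V_h$ is defined by $\langle\mathcal H_{h,\lambda}\mathbf v_h,\boldsymbol\chi_h\rangle_h=-\mathfrak a_{h,\lambda}(\mathbf v_h,\boldsymbol\chi_h)$ for all $\boldsymbol\chi_h\in\mathbb V_h$. Time grid: $N\in\mathbb N$,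 $k=T/N$; $d_t\mathbf v^{i+1}=(\mathbf v^{i+1}-\mathbf v^i)/k$ and $\overline{\mathbf v}^{i+\frac12}=\frac12(\mathbf v^{i+1}+\mathbf v^i)$. *)

(* Defs.v *)
From HB Require Import structures.
From mathcomp Require Import all_boot all_order all_algebra.
From mathcomp Require Import all_classical all_reals all_analysis.

Set Implicit Arguments.
Unset Strict Implicit.
Unset Printing Implicit Defensive.

Import Order.TTheory GRing.Theory Num.Theory.
Import numFieldNormedType.Exports.

Local Open Scope classical_set_scope.
Local Open Scope ring_scope.

Section Lebesgue.
Context {R : realType}.
Local Notation mR := (measurableTypeR R).

Definition tcons n (x : mR * n.-tuple mR) : n.+1.-tuple mR :=
  [the n.+1.-tuple mR of x.1 :: x.2].

Lemma measurable_tcons n : measurable_fun [set: mR * n.-tuple mR] (@tcons n).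
Proof. exact: measurable_cons. Qed.

Section step.
Variables (n : nat) (mu : {sigma_finite_measure set (n.-tuple mR) -> \bar R}).

Definition leb_step : set (n.+1.-tuple mR) -> \bar R :=
  pushforward (@lebesgue_measure R \x mu)%E (@tcons n).

Let leb_step0 : leb_step set0 = 0%E.
Proof. by rewrite /leb_step /pushforward preimage_set0 measure0. Qed.

Let leb_step_ge0 A : (0 <= leb_step A)%E.
Proof. by apply: integral_ge0 => x _; exact: measure_ge0. Qed.

Let leb_step_sigma_additive : semi_sigma_additive leb_step.
Proof.
move=> F mF tF mUF; rewrite /leb_step /pushforward preimage_bigcup.
apply: measure_semi_sigma_additive.
- by move=> i; rewrite -[X in measurable X]setTI; exact: measurable_tcons.
- apply/trivIsetP => /= i j _ _ ij; rewrite -preimage_setI.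
  by move/trivIsetP : tF => /(_ _ _ _ _ ij) ->//; rewrite preimage_set0.
- rewrite -preimage_bigcup -[X in measurable X]setTI.
  exact: measurable_tcons.
Qed.

HB.instance Definition _ := isMeasure.Build _ _ _ leb_step
  leb_step0 leb_step_ge0 leb_step_sigma_additive.

Let leb_step_sigma_finite : sigma_finite setT leb_step.
Proof.
have /sigma_finiteP[F' [TF' ndF F'oo]] := sigma_finiteT (@lebesgue_measure R).
have /sigma_finiteP[G' [TG' ndG G'oo]] := sigma_finiteT mu.
exists (fun i => [set t : n.+1.-tuple mR | F' i (thead t) /\
                                          G' i [tuple of behead t]]).
  apply/seteqP; split => // t _.
  have [i _ Fi] : (\bigcup_i F' i) (thead t) by rewrite -TF'.
  have [j _ Gj] : (\bigcup_i G' i) [tuple of behead t] by rewrite -TG'.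
  exists (maxn i j) => //; split.
  - by move: Fi; apply/subsetPset/ndF/leq_maxl.
  - by move: Gj; apply/subsetPset/ndG/leq_maxr.
move=> i; have [mF Fi] := F'oo i; have [mG Gi] := G'oo i; split.
  apply: measurableI.
    rewrite -[X in measurable X]setTI.
    exact: (measurable_tnth (ord0 : 'I_n.+1)).
  rewrite -[X in measurable X]setTI.
  exact: measurable_behead.
rewrite /leb_step /pushforward.
rewrite (_ : _ @^-1` _ = F' i `*` G' i).
  by rewrite product_measure1E// lte_mul_pinfty// ge0_fin_numE.
have tK x (t : n.-tuple mR) : [tuple of behead (tcons (x, t))] = t :> n.-tuple mR.
  exact: val_inj.
have hE x (t : n.-tuple mR) : thead (tcons (x, t)) = x by [].
by apply/seteqP; split => -[x t] /=; rewrite tK hE.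
Qed.

HB.instance Definition _ := Measure_isSigmaFinite.Build _ _ _ leb_step
  leb_step_sigma_finite.

End step.

Fixpoint leb n : {sigma_finite_measure set (n.-tuple mR) -> \bar R} :=
  match n with
  | 0 => [the {sigma_finite_measure set (0.-tuple mR) -> \bar R} of
            dirac [tuple]]
  | n'.+1 => [the {sigma_finite_measure set (n'.+1.-tuple mR) -> \bar R} of
            leb_step (leb n')]
  end.

End Lebesgue.

Section EuclideanSpace.
Context {R : realType}.

(* The library norm of ['rV[R]_n] is the sup norm; it is used below only
   through the topology and the bounded sets it induces. *)
Definition dot n (u v : 'rV[R]_n) : R := \sum_(i < n) u 0 i * v 0 i.

Definition enorm n (u : 'rV[R]_n) : R := Num.sqrt (dot u u).

Definition row3 (a b c : R) : 'rV[R]_3 := \row_(i < 3) [:: a; b; c]`_i.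

Definition cross (u v : 'rV[R]_3) : 'rV[R]_3 :=
  row3 (u 0 1 * v 0 2 - u 0 2 * v 0 1)
       (u 0 2 * v 0 0 - u 0 0 * v 0 2)
       (u 0 0 * v 0 1 - u 0 1 * v 0 0).

Definition comp n d (c : 'I_n) (v : 'rV[R]_d -> 'rV[R]_n) : 'rV[R]_d -> R :=
  fun x => v x 0 c.

Definition diameter d (A : set 'rV[R]_d) : R :=
  sup [set r | exists x y, [/\ A x, A y & r = enorm (x - y)]].

(* diameter of the largest ball contained in [A] *)
Definition inball_diameter d (A : set 'rV[R]_d) : R :=
  sup [set r | 0 <= r /\
    exists x, forall y, enorm (y - x) < r / 2 -> A y].

Definition polytopal d (Om : set 'rV[R]_d) : Prop :=
  exists (n : nat) (a : 'I_n -> 'rV[R]_d) (b : 'I_n -> R),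
    Om = [set x | forall i, dot (a i) x < b i].

End EuclideanSpace.

Section Sobolev.
Context {R : realType} {d : nat}.
Implicit Types (Om K : set 'rV[R]_d) (u g phi : 'rV[R]_d -> R).
Implicit Types (v : 'rV[R]_d -> 'rV[R]_3) (a : seq 'I_d) (j : 'I_d).
Local Notation dtuple := (d.-tuple (measurableTypeR R)).

(* Matrices carry no sigma-algebra in the library, so Lebesgue integration is
   done on tuples, through this identification. *)
Definition rvec (t : dtuple) : 'rV[R]_d := \row_(i < d) tnth t i.

Definition vint Om u : R :=
  \int[leb d]_(t in rvec @^-1` Om) u (rvec t).

Definition pderiv j u : 'rV[R]_d -> R := fun x => 'D_(delta_mx 0 j) u x.

(* A list of directions plays the role of a multi-index of order [size a]. *)
Definition mderiv a u : 'rV[R]_d -> R := foldr pderiv u a.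

Definition smooth u : Prop :=
  forall a, continuous (mderiv a u) /\
    forall j x, derivable (mderiv a u) x (delta_mx 0 j).

Definition test_function Om phi : Prop :=
  [/\ smooth phi, compact (closure [set x | phi x != 0])
    & closure [set x | phi x != 0] `<=` Om].

Definition loc_integrable Om u : Prop :=
  forall K, compact K -> K `<=` Om ->
    (leb d).-integrable (rvec @^-1` K) (EFin \o (u \o rvec)).

Definition is_weak_deriv Om a u g : Prop :=
  [/\ loc_integrable Om u, loc_integrable Om g
    & forall phi, test_function Om phi ->
        vint Om (fun x => u x * mderiv a phi x) =
        (-1) ^+ size a * vint Om (fun x => g x * phi x)].

Definition Lpnorm Om (p : \bar R) u : \bar R :=
  'N[leb d]_p [EFin \o ((u \o rvec) \_ (rvec @^-1` Om))]%E.

Definition in_Lp Om (p : \bar R) u : Prop :=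
  measurable_fun (rvec @^-1` Om) (u \o rvec) /\ (Lpnorm Om p u < +oo)%E.

Definition in_W Om (s : nat) (p : \bar R) v : Prop :=
  forall (c : 'I_3) a, (size a <= s)%N ->
    exists g, is_weak_deriv Om a (comp c v) g /\ in_Lp Om p g.

(* a chosen representative; 0 if there is no weak derivative *)
Definition wpd Om j u : 'rV[R]_d -> R :=
  xget (fun=> 0) [set g | is_weak_deriv Om [:: j] u g].

(* derivatives in the directions [n >= d] vanish, which yields the curl in
   dimensions 1 and 2 from the three-dimensional formula *)
Definition wpdn Om (n : nat) u : 'rV[R]_d -> R :=
  if insub n is Some j then wpd Om j u else fun=> 0.

Definition curl Om v : 'rV[R]_d -> 'rV[R]_3 := fun x =>
  row3 (wpdn Om 1%N (comp 2 v) x - wpdn Om 2%N (comp 1 v) x)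
       (wpdn Om 2%N (comp 0 v) x - wpdn Om 0%N (comp 2 v) x)
       (wpdn Om 0%N (comp 1 v) x - wpdn Om 1%N (comp 0 v) x).

Definition L2 Om (v w : 'rV[R]_d -> 'rV[R]_3) : R :=
  vint Om (fun x => dot (v x) (w x)).

Definition L2grad Om (v w : 'rV[R]_d -> 'rV[R]_3) : R :=
  vint Om (fun x => \sum_(c < 3) \sum_(j < d)
    wpd Om j (comp c v) x * wpd Om j (comp c w) x).

Definition H1norm Om v : R := Num.sqrt (L2 Om v v + L2grad Om v v).

Definition Linfnorm Om v : R :=
  fine (Lpnorm Om +oo%E (fun x => enorm (v x))).

Definition aform Om (ke kd : R) (v w : 'rV[R]_d -> 'rV[R]_3) : R :=
  ke * L2grad Om v w + kd * L2 Om v (curl Om w) + kd * L2 Om (curl Om v) w.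

End Sobolev.

Section FiniteElements.
Context {R : realType} {d : nat}.
Implicit Types (Om : set 'rV[R]_d).

Record mesh := Mesh {
  nvert : nat;
  vert : 'I_nvert -> 'rV[R]_d;
  elts : {set {set 'I_nvert}} }.
Implicit Types (T : mesh).

Definition simplex T (A : {set 'I_(nvert T)}) : set 'rV[R]_d :=
  [set x | exists w : 'I_(nvert T) -> R,
    [/\ forall i, 0 <= w i, forall i, i \notin A -> w i = 0,
        \sum_i w i = 1 & x = \sum_i w i *: vert i]].

Definition affinely_independent T (A : {set 'I_(nvert T)}) : Prop :=
  forall w : 'I_(nvert T) -> R, (forall i, i \notin A -> w i = 0) ->
    \sum_i w i = 0 -> \sum_i w i *: vert i = 0 -> forall i, w i = 0.

Record triangulation Om T : Prop := Triangulation {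
  vert_inj : injective (@vert T);
  vert_used : forall z, exists2 K, K \in elts T & z \in K;
  elts_card : forall K, K \in elts T -> #|K| = d.+1;
  elts_nondegenerate : forall K, K \in elts T -> affinely_independent K;
  elts_cover : closure Om = \bigcup_(K in [set` elts T]) simplex K;
  elts_conforming : forall K L, K \in elts T -> L \in elts T ->
    simplex K `&` simplex L = simplex (K :&: L) }.

Definition mesh_size T : R :=
  \big[Num.max/0]_(K in elts T) diameter (simplex K).

Definition shape_regular (H : set R) (Th : R -> mesh) : Prop :=
  exists sigma : R, forall h, H h -> forall K, K \in elts (Th h) ->
    diameter (simplex K) <= sigma * inball_diameter (simplex K).

Definition quasi_uniform (H : set R) (Th : R -> mesh) : Prop :=
  exists2 q : R, 0 < q & forall h, H h -> forall K, K \in elts (Th h) ->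
    q * mesh_size (Th h) <= diameter (simplex K).

Definition affine_on (W : lmodType R) (A : set 'rV[R]_d)
    (v : 'rV[R]_d -> W) : Prop :=
  forall x y (t : R), A x -> A y -> 0 <= t <= 1 ->
    v (t *: x + (1 - t) *: y) = t *: v x + (1 - t) *: v y.

(* A function on the closure of [Om] is represented by its extension by 0, so
   that equality of functions is equality on the closure. *)
Definition P1 Om T (W : normedModType R) (v : 'rV[R]_d -> W) : Prop :=
  [/\ {within closure Om, continuous v},
      forall K, K \in elts T -> affine_on (simplex K) v
    & forall x, ~ closure Om x -> v x = 0].

Definition Vh Om T (v : 'rV[R]_d -> 'rV[R]_3) : Prop := P1 Om T v.

Definition hat Om T (z : 'I_(nvert T)) : 'rV[R]_d -> R :=
  xget (fun=> 0) [set phi : 'rV[R]_d -> R |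
    P1 Om T (phi : 'rV[R]_d -> R^o) /\
    forall z', phi (vert z') = (z' == z)%:R].

Definition beta Om T (z : 'I_(nvert T)) : R := vint Om (hat Om z).

Definition interp Om T (v : 'rV[R]_d -> 'rV[R]_3) : 'rV[R]_d -> 'rV[R]_3 :=
  fun x => \sum_(z < nvert T) hat Om z x *: v (vert z).

Definition lumped Om T (v w : 'rV[R]_d -> 'rV[R]_3) : R :=
  \sum_(z < nvert T) beta Om z * dot (v (vert z)) (w (vert z)).

Definition hnorm Om T (v : 'rV[R]_d -> 'rV[R]_3) : R :=
  Num.sqrt (lumped Om T v v).

Definition Mh Om T (v : 'rV[R]_d -> 'rV[R]_3) : Prop :=
  Vh Om T v /\ forall z : 'I_(nvert T), enorm (v (vert z)) = 1.

Definition ahform Om T (ke kd la : R) (v w : 'rV[R]_d -> 'rV[R]_3) : R :=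
  aform Om ke kd v w + la * lumped Om T v w.

Definition Hop Om T (ke kd la : R) (v : 'rV[R]_d -> 'rV[R]_3) :
    'rV[R]_d -> 'rV[R]_3 :=
  xget (fun=> 0) [set w | Vh Om T w /\
    forall chi, Vh Om T chi -> lumped Om T w chi = - ahform Om T ke kd la v chi].

Implicit Types (m : nat -> 'rV[R]_d -> 'rV[R]_3).

(* [dt k m i] is d_t m^{i+1}, [mid m i] is the average of m^i and m^{i+1} *)
Definition dt (k : R) m (i : nat) : 'rV[R]_d -> 'rV[R]_3 :=
  fun x => k^-1 *: (m i.+1 x - m i x).

Definition mid m (i : nat) : 'rV[R]_d -> 'rV[R]_3 :=
  fun x => 2^-1 *: (m i.+1 x + m i x).

Definition crossf (v w : 'rV[R]_d -> 'rV[R]_3) : 'rV[R]_d -> 'rV[R]_3 :=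
  fun x => cross (v x) (w x).

Definition midpoint_scheme Om T (ke kd la al ga k : R) (N : nat)
    (m0 : 'rV[R]_d -> 'rV[R]_3) m : Prop :=
  [/\ m 0%N = interp Om T m0,
      forall i, (i < N)%N -> Vh Om T (m i.+1)
    & forall i, (i < N)%N -> forall phi, Vh Om T phi ->
        lumped Om T (dt k m i) phi
        - al * lumped Om T (crossf (mid m i) (dt k m i)) phi
        + ga * lumped Om T
            (crossf (mid m i) (Hop Om T ke kd la (mid m i))) phi = 0].

End FiniteElements.
Arguments mesh : clear implicits.

(* Main.v *)
Require Import Defs.
From HB Require Import structures.
From mathcomp Require Import all_boot all_order all_algebra.
From mathcomp Require Import all_classical all_reals all_analysis.
From mathcomp Require Import measurable_realfun ess_sup_inf ring lra.

(** Tested against [hat z *: M z], with [M] the midpoint value at the vertex [z], the scheme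
    loses both cross products and leaves [d_t m . M = 0], i.e. [|m^{i+1}(z)| = |m^i(z)|].  Tested
    against [d_t m] and against the discrete effective field [H M], it gives two identities
    that share a triple product; eliminating it relates [|d_t m|_h^2] to [a (M, d_t m)], which
    telescopes by bilinearity and symmetry of [a].

    The uniform bound then only needs the energy of [I_h m^0] to be bounded independently of [h].
    This is proved element by element.  Since [p > d], Morrey's inequality bounds the oscillation of
    [m^0] between the vertices of an element [K] of inradius comparable to [r] by
    [C r (1 + E_K)^(1/p)], where [E_K] is the average of [|grad m^0|^p] over [K], hence the gradient
    of the affine interpolant by [C (1 + E_K)^(1/p)].  Its square is at most [C (1 + E_K)] because
    [p >= 2], and summing over the disjoint interiors of the elements bounds the gradient of [I_h m^0]
    in [L^2] by [|Om|] and the integral of [|grad m^0|^p] over [Om].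

    As [wpd] is only a chosen representative, weak derivatives of finite element functions have to be
    computed (as limits of difference quotients) and shown to be unique almost everywhere. *)

Set Implicit Arguments.
Unset Strict Implicit.
Unset Printing Implicit Defensive.

Import Order.TTheory GRing.Theory Num.Theory.
Import numFieldNormedType.Exports.

Local Open Scope classical_set_scope.
Local Open Scope ring_scope.

(** * Lebesgue measure of boxes and of open sets *)

Section LebesgueTuples.
Context {R : realType}.
Local Notation mR := (measurableTypeR R).

(** Morrey's inequality is proved directly for weak derivatives, without approximation by smooth
    functions. The averages of [v] against a bump are followed while a homothety of ratio [1 / t]
    contracts the bump onto a vertex [x]. Their [t]-derivative is an integral of the weak gradient
    against a compactly supported smooth flux, so it makes sense for weak derivatives; it decays
    like [t ^ (d / p - 2)], which is integrable up to infinity because [p > d]. At [t = 1] the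
    average does not depend on [x], and this links the vertices of one element. A vertex may lie on
    the boundary of [Om], but only convex combinations giving interior points a positive weight are
    formed, and these stay inside the element. Shape regularity enters through a box of half-width
    [r] inside each element, the coordinate widths of the element being at most [L * r]. Element
    faces are never shown to be null sets: closed elements are summed from above, and disjointness
    is asked of interiors only. *)

Definition box n (a b : 'I_n -> R) : set (n.-tuple mR) :=
  [set t | forall i, a i < tnth t i < b i].

Lemma measurable_tuple_coord n (i : 'I_n) (A : set mR) : measurable A ->
  measurable [set t : n.-tuple mR | A (tnth t i)].
Proof.
by move=> mA; rewrite -[X in measurable X]setTI; exact: (measurable_tnth i).
Qed.

Lemma measurable_box n (a b : 'I_n -> R) : measurable (box a b).
Proof.
have -> : box a b = \bigcap_(i in [set: 'I_n]) [set t | `]a i, b i[%classic (tnth t i)].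
  apply/seteqP; split => t /= H i => [_|]; first by rewrite /= in_itv /=; exact: H.
  by have := H i I; rewrite /= in_itv.
by apply: fin_bigcap_measurable => // i _; apply: measurable_tuple_coord.
Qed.

Lemma leb_box n (a b : 'I_n -> R) : (forall i, a i <= b i) ->
  leb n (box a b) = (\prod_i (b i - a i))%:E.
Proof.
elim: n a b => [|n IH] a b ab.
  rewrite big_ord0 /= diracE mem_set //= => -[] //.
rewrite big_ord_recl /= /leb_step /pushforward.
have -> : @tcons R n @^-1` box a b =
    `]a ord0, b ord0[%classic `*` box (a \o lift ord0) (b \o lift ord0).
  apply/seteqP; split => -[x t] /=.
    move=> H; split; first by rewrite in_itv /=; exact: (H ord0).
    by move=> i; have := H (lift ord0 i); rewrite tnthS.
  rewrite in_itv /= => -[xab H] i.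
  by have [j ->|-> //] := unliftP ord0 i; rewrite tnthS; exact: H.
rewrite product_measure1E //; last exact: measurable_box.
rewrite IH //; last by move=> i; exact: ab.
have -> : (lebesgue_measure_lebesgue_measure__canonical__measure_function_Measure R
     `]a ord0, b ord0[%classic = (b ord0 - a ord0)%:E)%E.
  rewrite [LHS]lebesgue_measure_itv /= lte_fin EFinB.
  have := ab ord0; rewrite le_eqVlt => /orP[/eqP ->|->] //.
  by rewrite ltxx subee.
by rewrite -EFinM.
Qed.

Lemma lebesgue_translate (s : R) (A : set mR) : measurable A ->
  lebesgue_measure ((fun x : mR => x + s : mR) @^-1` A) = lebesgue_measure A.
Proof.
have ms : measurable_fun setT (fun x : mR => x + s : mR) by exact: measurable_funD.
move=> mA.
pose mu := measure_function_pushforward__canonical__measure_function_Measure lebesgue_measure ms.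
apply/esym.
have := @lebesgue_measure_unique R mu.
apply => // _ [[u v] _ <-] /=.
rewrite /pushforward.
have -> : (fun x : mR => x + s : mR) @^-1` `]u, v] = `]u - s, v - s]%classic.
  by apply/seteqP; split => x /=; rewrite !in_itv /= ltrBlDr lerBrDr.
rewrite !lebesgue_measure_itv /= !lte_fin ltrD2r.
by case: ifP => // _; rewrite -!EFinD; congr (_%:E); ring.
Qed.

Definition tshift n (i : 'I_n) (s : R) (t : n.-tuple mR) : n.-tuple mR :=
  [tuple tnth t j + (j == i)%:R * s | j < n].

Lemma measurable_tshift n (i : 'I_n) s : measurable_fun setT (tshift i s).
Proof.
apply/measurable_fun_tnthP => j /=.
rewrite (_ : _ \o _ = fun t : n.-tuple mR => tnth t j + (j == i)%:R * s); last first.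
  by apply/funext => t /=; rewrite tnth_mktuple.
by apply: measurable_funD => //; exact: measurable_tnth.
Qed.

Lemma tshift_tcons0 n (s x : mR) (t : n.-tuple mR) :
  tshift ord0 s (tcons (x, t)) = tcons (x + s, t).
Proof.
apply: eq_from_tnth => k; rewrite tnth_mktuple.
have [l ->|->] := unliftP ord0 k; rewrite ?tnthS ?tnth0 /= ?mul1r //.
by rewrite mul0r addr0.
Qed.

Lemma tshift_tconsS n (i : 'I_n) (s x : mR) (t : n.-tuple mR) :
  tshift (lift ord0 i) s (tcons (x, t)) = tcons (x, tshift i s t).
Proof.
apply: eq_from_tnth => k; rewrite tnth_mktuple.
have [l ->|->] := unliftP ord0 k; rewrite ?tnthS ?tnth0 /= ?tnth_mktuple //.
by rewrite mul0r addr0.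
Qed.

(** Source of the discrete integration by parts used for weak derivatives. A shift of a later
    coordinate acts on the sections of the product measure, where induction applies; a shift of the
    first one is absorbed by the one-dimensional outer integral. *)
Lemma leb_translate n (i : 'I_n) s A : measurable A ->
  leb n (tshift i s @^-1` A) = leb n A.
Proof.
elim: n i A => [[]//|n IH] i A mA.
rewrite /= /leb_step /pushforward /product_measure1.
have mA' : measurable (@tcons R n @^-1` A).
  by rewrite -[X in measurable X]setTI; exact: measurable_tcons.
have [j ->|->] := unliftP ord0 i.
  apply: eq_integral => x _ /=.
  rewrite -[RHS](IH j); first last.
    exact: measurable_xsection.
  congr (leb n _); apply/seteqP; split => t; rewrite /xsection /= !inE /=;
  by rewrite tshift_tconsS.
pose h := leb n \o xsection (@tcons R n @^-1` A).
have mh : measurable_fun setT h by exact: measurable_fun_xsection.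
have ms : measurable_fun setT (fun x : mR => x + s : mR) by exact: measurable_funD.
transitivity (\int[lebesgue_measure]_x (h \o (fun x : mR => (x + s)%R : mR)) x)%E.
  apply: eq_integral => x _ /=; congr (leb n _).
  apply/seteqP; split => t; rewrite /xsection /= !inE /=;
  by rewrite tshift_tcons0.
rewrite -[LHS](@ge0_integral_pushforward _ _ _ _ _ _ ms lebesgue_measure setT) //.
apply: eq_measure_integral => B mB _; exact: lebesgue_translate.
Qed.

Lemma rvecE n (t : n.-tuple mR) i : rvec t 0 i = tnth t i.
Proof. by rewrite mxE. Qed.

Lemma coord_le_norm n (x : 'rV[R]_n) i : `|x 0 i| <= `|x|.
Proof.
rewrite [leRHS]/Num.norm /= mx_normrE.
by apply: (le_bigmax_cond _ (fun ij => `|x ij.1 ij.2|) (j := (0, i))).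
Qed.

Lemma norm_lt_coord n (x : 'rV[R]_n) e : 0 < e ->
  (forall i, `|x 0 i| < e) -> `|x| < e.
Proof.
move=> e0 H; rewrite [ltLHS]/Num.norm /= mx_normrE.
by apply/bigmax_ltP; split => // -[i j] _ /=; rewrite ord1.
Qed.

Lemma norm_le_coord n (x : 'rV[R]_n) e : 0 <= e ->
  (forall i, `|x 0 i| <= e) -> `|x| <= e.
Proof.
move=> e0 H; rewrite [leLHS]/Num.norm /= mx_normrE.
by apply/bigmax_leP; split => // -[i j] _ /=; rewrite ord1.
Qed.

Definition obox n (a b : 'I_n -> R) : set 'rV[R]_n :=
  [set x | forall i, a i < x 0 i < b i].

Definition cbox n (a b : 'I_n -> R) : set 'rV[R]_n :=
  [set x | forall i, a i <= x 0 i <= b i].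

Lemma preimage_obox n (a b : 'I_n -> R) : rvec @^-1` obox a b = box a b.
Proof.
by apply/seteqP; split => t /= H i; have := H i; rewrite rvecE.
Qed.

Lemma obox_cbox n (a b : 'I_n -> R) : obox a b `<=` cbox a b.
Proof. by move=> x xab i; have /andP[/ltW -> /ltW ->] := xab i. Qed.

(** Enumerates the boxes with rational corners. A code whose closed box is not contained in [A] gets
    the bounds 1 and 0, which describe an empty box because [n > 0]. Closed boxes inside [A] are
    demanded since they are compact and can carry the support of a test function. *)
Lemma open_box_cover n (A : set 'rV[R]_n) : (0 < n)%N -> open A ->
  exists a b : nat -> 'I_n -> R,
    (forall k, cbox (a k) (b k) `<=` A) /\
    (forall x, A x -> exists k, obox (a k) (b k) x).
Proof.
move=> n0 oA.
pose ab k := if @unpickle {ffun 'I_n -> rat * rat} k is Some f then f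
             else [ffun => (1, 0)].
pose lo k i : R := if `[< cbox (fun i => ratr (ab k i).1) (fun i => ratr (ab k i).2) `<=` A >]
  then ratr (ab k i).1 else 1.
pose hi k i : R := if `[< cbox (fun i => ratr (ab k i).1) (fun i => ratr (ab k i).2) `<=` A >]
  then ratr (ab k i).2 else 0.
exists lo, hi; split => [k x|x Ax].
  rewrite /lo /hi /cbox /=; case: asboolP => [H|_ H]; first exact: H.
  have := H (Ordinal n0) => /andP[/le_trans /[apply]].
  by rewrite ler10.
have /nbhs_ballP[e /= e0 xeA] := open_nbhs_nbhs (conj oA Ax).
have H i : exists q : rat * rat, (x 0 i - e < ratr q.1 < x 0 i) && (x 0 i < ratr q.2 < x 0 i + e).
  have /rat_in_itvoo[q /itvP q1] : x 0 i - e < x 0 i by rewrite ltrBlDr ltrDl.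
  have /rat_in_itvoo[r /itvP r1] : x 0 i < x 0 i + e by rewrite ltrDl.
  by exists (q, r); rewrite /= !q1 !r1.
have [f Hf] := choice H.
exists (pickle [ffun i => f i]).
have sA : cbox (fun i => ratr (f i).1) (fun i => ratr (f i).2) `<=` A.
  move=> y yf; apply: xeA; rewrite -ball_normE /ball_ /=.
  apply: norm_lt_coord => // i; rewrite !mxE.
  have /andP[y1 y2] := yf i; have /andP[/andP[q1 q2] /andP[r1 r2]] := Hf i.
  by rewrite ltr_norml; lra.
move=> i; rewrite /lo /hi /ab pickleK.
case: asboolP => [_|[]]; last by apply: subset_trans sA => y + j => /(_ j); rewrite ffunE.
by rewrite ffunE; have /andP[/andP[q1 q2] /andP[r1 r2]] := Hf i; rewrite q2 r1.
Qed.

Lemma measurable_open n (A : set 'rV[R]_n) : (0 < n)%N -> open A ->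
  measurable (rvec @^-1` A).
Proof.
move=> n0 oA; have [a [b [sub cov]]] := open_box_cover n0 oA.
have -> : rvec @^-1` A = \bigcup_k box (a k) (b k).
  apply/seteqP; split => t /=.
    by move=> /cov[k xk]; exists k => //; rewrite -preimage_obox.
  move=> [k _]; rewrite -preimage_obox => /obox_cbox; exact: sub.
by apply: bigcup_measurable => k _; exact: measurable_box.
Qed.

Lemma measurable_closed n (A : set 'rV[R]_n) : (0 < n)%N -> closed A ->
  measurable (rvec @^-1` A).
Proof.
move=> n0 cA; rewrite -[A]setCK preimage_setC; apply: measurableC.
exact: (@measurable_open _ (~` A) n0 (closed_openC cA)).
Qed.

Lemma measurable_continuous n (A : set 'rV[R]_n) (u : 'rV[R]_n -> R) : (0 < n)%N ->
  measurable (rvec @^-1` A) -> {within A, continuous u} ->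
  measurable_fun (rvec @^-1` A) (u \o rvec).
Proof.
move=> n0 mA /continuousP cu; apply: (measurability _ (RGenOpens.measurableE R)).
move=> _ [_ [x [y ->] <-]].
have oI : open `]x, y[%classic by exact: interval_open.
have /open_subspaceP[V oV VA] := cu _ oI.
have VP z : A z -> V z = `]x, y[%classic (u z).
  move=> Az; have := congr1 (fun S => S z) VA; rewrite /setI /mkset /=.
  by rewrite propeqE => -[h1 h2]; rewrite propeqE; split => h;
    [have [] := h1 (conj h Az)|have [] := h2 (conj h Az)].
have -> : rvec @^-1` A `&` (u \o rvec) @^-1` `]x, y[ = rvec @^-1` V `&` rvec @^-1` A.
  apply/predeqP => t; split => -[h1 h2]; split => //.
    by rewrite /preimage /= VP.
  by move: h1; rewrite /preimage /mkset VP.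
by apply: measurableI => //; exact: measurable_open.
Qed.

Lemma leb_bounded n (A : set 'rV[R]_n) : bounded_set A ->
  measurable (rvec @^-1` A) -> (leb n (rvec @^-1` A) < +oo)%E.
Proof.
move=> [M [_ bA]] mA.
have {}bA x : A x -> `|x| <= `|M| + 1.
  by apply: bA; rewrite (le_lt_trans (ler_norm M))// ltrDl.
pose m := `|M| + 2.
have m0 : 0 <= m by rewrite addr_ge0.
apply: (@le_lt_trans _ _ (leb n (box (fun=> - m) (fun=> m)))).
  apply: le_measure; rewrite ?inE //; first exact: measurable_box.
  move=> t /bA tM i; have := coord_le_norm (rvec t) i; rewrite rvecE => ti.
  by rewrite -ltr_norml (le_lt_trans ti)// (le_lt_trans tM)// /m ltrD2l ltr1n.
by rewrite leb_box ?ltry // => i; lra.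
Qed.

End LebesgueTuples.

(** * A class of smooth functions *)

Section Flat.
Context {R : realType}.

(** The classical flat function [exp (- 1 / y)], multiplied by a pole of order [n] so that the
    family is closed under differentiation up to linear combinations. *)
Definition flat (n : nat) (y : R) : R :=
  if 0 < y then y^-1 ^+ n * expR (- y^-1) else 0.

Lemma flat_ge0 n y : 0 <= flat n y.
Proof.
rewrite /flat; case: ifP => // y0.
by rewrite mulr_ge0 ?expR_ge0 // exprn_ge0 // invr_ge0 ltW.
Qed.

Lemma flat0_le1 y : flat 0 y <= 1.
Proof.
rewrite /flat; case: ifP => // y0; rewrite expr0 mul1r expR_le1 oppr_le0.
by rewrite invr_ge0 ltW.
Qed.

(** The term of order [n + 1] in the exponential series of [1 / y] beats the pole of order [n] with
    one power of [y] to spare; this gives the derivative at 0. *)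
Lemma flat_le n y : 0 < y -> flat n y <= (n.+1)`!%:R * y.
Proof.
move=> y0; rewrite /flat y0 expRN.
have yi0 : 0 < y^-1 by rewrite invr_gt0.
have := expR_ge1Dxn n (ltW yi0); set E := expR _ => H.
have E0 : 0 < E by exact: expR_gt0.
have f0 : 0 < (n.+1)`!%:R :> R by rewrite ltr0n fact_gt0.
rewrite ler_pdivrMr //.
have : y^-1 ^+ n.+1 / (n.+1)`!%:R <= E by apply: le_trans H; rewrite lerDr.
rewrite ler_pdivrMr // exprS => H2.
rewrite -(ler_pM2l yi0) (le_trans H2) //.
have -> : y^-1 * ((n.+1)`!%:R * y * E) = E * (n.+1)`!%:R * (y^-1 * y) by ring.
by rewrite mulVf ?gt_eqF // mulr1.
Qed.

Lemma flatS n y : 0 < y -> flat n.+1 y = y^-1 * flat n y.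
Proof. by rewrite /flat => ->; rewrite exprS mulrA. Qed.

Lemma is_derive_flat n (y : R) :
  is_derive y 1 (flat n) (flat n.+2 y - n%:R * flat n.+1 y).
Proof.
have [y0|y0|->] := ltgtP y 0.
- have -> : flat n.+2 y - n%:R * flat n.+1 y = 0.
    by rewrite /flat ltNge (ltW y0) /= mulr0 subr0.
  apply: (@near_eq_is_derive _ _ _ (cst 0)).
    by near=> z; rewrite /flat ltNge ltW //; near: z; exact: lt_nbhsl.
- have y1 : y != 0 by rewrite gt_eqF.
  have dV : is_derive y 1 (fun z : R => z^-1) (- y ^- 2).
    have := @is_deriveV _ id y 1 1 y1 (is_derive_id _ _).
    by rewrite /= /GRing.scale /= mulr1.
  have dX := @is_deriveX _ _ _ n y 1 _ dV.
  have dE := @is_derive1_comp _ (@expR R) (fun z : R => - z^-1) y _ _ (is_derive_expR _) (is_deriveN dV).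
  apply: (@near_eq_is_derive _ _ _ ((fun z => z^-1) ^+ n * (expR \o (fun z : R => - z^-1)))).
    near=> z; rewrite /flat ifT //; last by near: z; exact: lt_nbhsr.
    by rewrite !fctE.
  apply: is_derive_eq; rewrite /flat y0 /GRing.scale /= !fctE.
  case: n {dX} => [|n]; first by rewrite !mul0r !mulr0 addr0 subr0 expr0; field.
  by rewrite !exprS /=; field.
have f0 m : flat m 0 = 0 by rewrite /flat ltxx.
rewrite !f0 mulr0 subr0.
(* From the right the difference quotient at 0 is [flat n.+1 h], which [flat_le] bounds by a
   multiple of [h]; from the left it is 0. *)
have cv : (fun h : R => h^-1 *: ((flat n \o shift 0) (h *: 1) - flat n 0)) @ 0^' --> (0 : R).
  apply/cvgr0Pnorm_le => e e0.
  have F0 : 0 < (n.+2)`!%:R :> R by rewrite ltr0n fact_gt0.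
  near=> h; rewrite f0 subr0 /= addr0 /GRing.scale /= mulr1.
  have [h0|h0] := ltP 0 h; last by rewrite /flat ltNge h0 mulr0 normr0 ltW.
  rewrite -flatS // ger0_norm ?flat_ge0 // (le_trans (flat_le _ h0)) //.
  rewrite mulrC -ler_pdivlMr // (le_trans (ler_norm _)) //.
  by near: h; apply: dnbhs0_le; rewrite divr_gt0.
by apply: DeriveDef; [apply/cvg_ex; exists 0|exact/cvg_lim].
Unshelve. all: by end_near. Qed.

End Flat.

Section Smooth.
Context {R : realType} {d : nat}.
Implicit Types f g : 'rV[R]_d -> R.

(* Contains the bump functions and is closed under partial derivatives, so that
   smoothness follows from differentiability of its members. *)
Inductive elementary : ('rV[R]_d -> R) -> Prop :=
| elementary_flat n i a b : elementary (fun x => flat n (a * x 0 i + b))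
| elementary_coord i : elementary (fun x => x 0 i)
| elementary_cst c : elementary (fun=> c)
| elementary_add f g : elementary f -> elementary g -> elementary (f + g)
| elementary_mul f g : elementary f -> elementary g -> elementary (f * g).

Lemma elementary_differentiable f x : elementary f -> differentiable f x.
Proof.
elim=> {f} [n i a b|i|c|f g _ df _ dg|f g _ df _ dg].
- apply: (@differentiable_comp _ _ _ _ (fun x : 'rV[R]_d => a * x 0 i + b) (flat n)).
    apply: differentiableD; last exact: differentiable_cst.
    by apply: (@differentiableM _ _ (cst a)); [exact: differentiable_cst|exact: differentiable_coord].
  by apply/derivable1_diffP; have [] := is_derive_flat n (a * x 0 i + b).
- exact: differentiable_coord.
- exact: differentiable_cst.
- exact: differentiableD.
- exact: differentiableM.
Qed.

Lemma is_derive_coord (i j : 'I_d) (x : 'rV[R]_d) :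
  is_derive x (delta_mx 0 j) (fun x : 'rV[R]_d => x 0 i) (i == j)%:R.
Proof.
have df := @differentiable_coord R 1 d x 0 i.
apply: DeriveDef; first exact: diff_derivable.
have lin : linear (fun x : 'rV[R]_d => x 0 i : R) by move=> c u v; rewrite !mxE.
pose M := GRing.isLinear.Build _ _ _ _ _ lin.
pose L : {linear 'rV[R]_d -> R} := HB.pack (fun x : 'rV[R]_d => x 0 i : R) M.
rewrite deriveE // (@diff_lin _ _ _ L); last exact: coord_continuous.
by rewrite /= mxE eqxx.
Qed.

Lemma is_derive_comp1 (h : R -> R) f x v (a b : R) : differentiable f x ->
  is_derive (f x) 1 h a -> is_derive x v f b -> is_derive x v (h \o f) (a * b).
Proof.
move=> df [dh <-] [fv <-].
have dh' : differentiable h (f x) by exact/derivable1_diffP.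
have dhf : differentiable (h \o f) x by exact: differentiable_comp.
apply: DeriveDef; first exact: diff_derivable.
rewrite ['D_v (h \o f) x]deriveE // diff_comp //= (diff1E dh') ['D_v f x]deriveE // derive1E.
by rewrite /GRing.scale /= mulrC.
Qed.

Lemma elementary_derive f (j : 'I_d) : elementary f ->
  exists2 f', elementary f' & forall x, is_derive x (delta_mx 0 j) f (f' x).
Proof.
elim=> {f} [n i a b|i|c|f g ef [f' ef' df] eg [g' eg' dg]|f g ef [f' ef' df] eg [g' eg' dg]].
- exists ((fun x => flat n.+2 (a * x 0 i + b)) * (fun=> a * (i == j)%:R) +
          (fun x => flat n.+1 (a * x 0 i + b)) * (fun=> - n%:R * (a * (i == j)%:R))).
    by apply: elementary_add; apply: elementary_mul; try exact: elementary_flat;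
      exact: elementary_cst.
  move=> x; pose l := (cst a * (fun x : 'rV[R]_d => x 0 i) + cst b : 'rV[R]_d -> R).
  have dl : is_derive x (delta_mx 0 j) l (a * (i == j)%:R).
    have di := is_derive_coord i j x.
    by apply: is_derive_eq; rewrite /GRing.scale /= mulr0 !addr0.
  have dfl : differentiable l x.
    by apply: differentiableD; last exact: differentiable_cst;
       apply: differentiableM; [exact: differentiable_cst|exact: differentiable_coord].
  apply: (@is_derive_eq _ _ _ (flat n \o l) _ _ _ _ (is_derive_comp1 dfl (is_derive_flat n (l x)) dl)).
  by rewrite !fctE /l /= !fctE; ring.
- exists (fun=> (i == j)%:R); first exact: elementary_cst.
  exact: is_derive_coord.
- exists (fun=> 0); first exact: elementary_cst.
  by move=> x; exact: is_derive_cst.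
- exists (f' + g'); first exact: elementary_add.
  by move=> x; exact: is_deriveD.
- exists (f * g' + g * f'); first by apply: elementary_add; exact: elementary_mul.
  by move=> x; exact: is_deriveM.
Qed.

Lemma elementary_mderiv f a : elementary f -> elementary (mderiv a f).
Proof.
move=> ef; elim: a => //= j a /(elementary_derive j)[f' ef' df].
rewrite /pderiv; suff -> : (fun x => 'D_(delta_mx 0 j) (mderiv a f) x) = f' by [].
by apply/funext => x; rewrite (@derive_val _ _ _ _ _ _ _ (df x)).
Qed.

Lemma elementary_smooth f : elementary f -> smooth f.
Proof.
move=> ef a; have := elementary_mderiv a ef; split.
  by move=> x; apply: differentiable_continuous; exact: elementary_differentiable.
by move=> j x; apply: diff_derivable; exact: elementary_differentiable.
Qed.

End Smooth.

(** * Integration over sets of row vectors *)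

Section Integration.
Context {R : realType} {d : nat}.
Implicit Types (A B : set 'rV[R]_d) (u v w : 'rV[R]_d -> R).
Local Notation mu := (@leb R d).

Definition vmeas A := measurable (rvec @^-1` A : set (d.-tuple (measurableTypeR R))).

Definition vmfun A u :=
  measurable_fun (rvec @^-1` A : set (d.-tuple (measurableTypeR R))) (u \o rvec).

Definition vintg A u := mu.-integrable (rvec @^-1` A) (EFin \o (u \o rvec)).

Definition vae A (P : 'rV[R]_d -> Prop) := {ae mu, forall t, A (rvec t) -> P (rvec t)}.

Lemma vmeasI A B : vmeas A -> vmeas B -> vmeas (A `&` B).
Proof. exact: measurableI. Qed.

Lemma vmfunS A B u : vmeas B -> A `<=` B -> vmfun B u -> vmfun A u.
Proof. by move=> mB AB; apply: measurable_funS => // t; exact: AB. Qed.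

Lemma vmfun_cst A (c : R) : vmfun A (fun=> c).
Proof. exact: measurable_cst. Qed.

Lemma vmfunD A u v : vmfun A u -> vmfun A v -> vmfun A (fun x => u x + v x).
Proof. exact: measurable_funD. Qed.

Lemma vmfunM A u v : vmfun A u -> vmfun A v -> vmfun A (fun x => u x * v x).
Proof. exact: measurable_funM. Qed.

Lemma vintg_vmfun A u : vintg A u -> vmfun A u.
Proof. by move/measurable_int/measurable_EFinP. Qed.

Lemma vintgS A B u : vmeas A -> vmeas B -> A `<=` B -> vintg B u -> vintg A u.
Proof. by move=> mA mB AB; apply: integrableS => // t; exact: AB. Qed.

Lemma vintg_dom A u v : vmeas A -> vmfun A u -> vintg A v ->
  (forall x, A x -> `|u x| <= v x) -> vintg A u.
Proof.
move=> mA mu' iv uv; apply: le_integrable iv => //.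
  exact/measurable_EFinP.
by move=> t At /=; rewrite lee_fin (le_trans (uv _ At)) // ler_norm.
Qed.

Lemma vintg_cst A (c : R) : vmeas A -> (mu (rvec @^-1` A) < +oo)%E -> vintg A (fun=> c).
Proof.
move=> mA fA; apply: measurable_bounded_integrable => //.
  exact: measurable_cst.
exact: bounded_cst.
Qed.

Lemma vintg_bounded A u (M : R) : vmeas A -> (mu (rvec @^-1` A) < +oo)%E ->
  vmfun A u -> (forall x, A x -> `|u x| <= M) -> vintg A u.
Proof. by move=> mA fA mu' uM; apply: vintg_dom (vintg_cst M mA fA) uM. Qed.

Lemma vintgD A u v : vmeas A -> vintg A u -> vintg A v -> vintg A (fun x => u x + v x).
Proof. by move=> mA iu iv; exact: (integrableD mA iu iv). Qed.

Lemma vintgB A u v : vmeas A -> vintg A u -> vintg A v -> vintg A (fun x => u x - v x).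
Proof. by move=> mA iu iv; exact: (integrableB mA iu iv). Qed.

Lemma vintgZ A c u : vmeas A -> vintg A u -> vintg A (fun x => c * u x).
Proof. by move=> mA iu; exact: (integrableZl mA c iu). Qed.

Lemma vintg_norm A u : vintg A u -> vintg A (fun x => `|u x|).
Proof. exact: integrable_norm. Qed.

Lemma vintg_eq A u v : vmeas A -> (forall x, A x -> u x = v x) -> vintg A u -> vintg A v.
Proof.
by move=> mA uv; apply: eq_integrable => // t; rewrite inE => At /=; rewrite uv.
Qed.

Lemma vintg_sum I (r : seq I) (P : pred I) A (F : I -> 'rV[R]_d -> R) : vmeas A ->
  (forall i, vintg A (F i)) -> vintg A (fun x => \sum_(i <- r | P i) F i x).
Proof.
move=> mA iF; elim: r => [|i r IH].
  apply: (@vintg_eq _ (fun x => 0 * 0)) => // [x _|]; first by rewrite big_nil mul0r.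
  by rewrite mul0r; exact: integrable0.
have := IH; case Pi : (P i) => iFr.
  apply: vintg_eq (vintgD mA (iF i) iFr) => // x _; by rewrite big_cons Pi.
by apply: vintg_eq iFr => // x _; rewrite big_cons Pi.
Qed.

Lemma vintg_mul_bounded A u h (M : R) : vmeas A -> vintg A u -> vmfun A h ->
  (forall x, A x -> `|h x| <= M) -> vintg A (fun x => u x * h x).
Proof.
move=> mA iu mh hM.
apply: (vintg_dom mA _ (vintgZ M mA (vintg_norm iu))).
  by apply: vmfunM => //; exact: vintg_vmfun.
by move=> x Ax; rewrite normrM mulrC ler_wpM2r ?hM.
Qed.

Lemma vint_eq A u v : (forall x, A x -> u x = v x) -> vint A u = vint A v.
Proof. by move=> uv; apply: eq_Rintegral => t; rewrite inE => At; exact: uv. Qed.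

Lemma vintD A u v : vmeas A -> vintg A u -> vintg A v ->
  vint A (fun x => u x + v x) = vint A u + vint A v.
Proof. by move=> mA iu iv; exact: (RintegralD mA iu iv). Qed.

Lemma vintB A u v : vmeas A -> vintg A u -> vintg A v ->
  vint A (fun x => u x - v x) = vint A u - vint A v.
Proof. by move=> mA iu iv; exact: (RintegralB mA iu iv). Qed.

Lemma vintZ A c u : vmeas A -> vintg A u ->
  vint A (fun x => c * u x) = c * vint A u.
Proof. by move=> mA iu; exact: (RintegralZl c mA iu). Qed.

Lemma vint_ge0 A u : (forall x, A x -> 0 <= u x) -> 0 <= vint A u.
Proof. by move=> u0; apply: Rintegral_ge0 => t; exact: u0. Qed.

Lemma vint_le A u v : vmeas A -> vintg A u -> vintg A v ->
  (forall x, A x -> u x <= v x) -> vint A u <= vint A v.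
Proof. by move=> mA iu iv uv; apply: le_Rintegral => // t; exact: uv. Qed.

Lemma vint_norm_le A u : vmeas A -> vintg A u -> `|vint A u| <= vint A (fun x => `|u x|).
Proof. by move=> mA iu; exact: (le_normr_Rintegral mA iu). Qed.

Lemma vint0 A : vint A (fun=> 0) = 0.
Proof. by rewrite /vint /Rintegral integral0. Qed.

Lemma vint_sum I (r : seq I) (P : pred I) A (F : I -> 'rV[R]_d -> R) : vmeas A ->
  (forall i, vintg A (F i)) ->
  vint A (fun x => \sum_(i <- r | P i) F i x) = \sum_(i <- r | P i) vint A (F i).
Proof.
move=> mA iF; elim: r => [|i r IH].
  by rewrite big_nil -[RHS](vint0 A); apply: vint_eq => x _; rewrite big_nil.
rewrite big_cons; case Pi : (P i).
  rewrite -IH -vintD //; last exact: vintg_sum.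
  by apply: vint_eq => x _; rewrite big_cons Pi.
by rewrite -IH; apply: vint_eq => x _; rewrite big_cons Pi.
Qed.

Lemma vint_sub A B u : A `<=` B -> (forall x, B x -> ~ A x -> u x = 0) ->
  vint B u = vint A u.
Proof.
move=> AB u0; rewrite /vint Rintegral_mkcond [in RHS]Rintegral_mkcond.
apply: eq_Rintegral => t _; rewrite /patch.
case: ifPn; case: ifPn => //; rewrite /preimage /mkset !(inE, notin_setE) /=.
- by move=> nA tB; rewrite u0.
- by move=> /AB At nB.
Qed.

Lemma vintg_sub A B u : vmeas A -> vmeas B -> A `<=` B ->
  (forall x, B x -> ~ A x -> u x = 0) -> vintg A u -> vintg B u.
Proof.
move=> mA mB AB u0 iA.
apply/integrable_mkcond => //; move/(integrable_mkcond _ mA) : iA; congr (mu.-integrable _ _).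
apply/funext => t; rewrite /patch.
case: ifPn; case: ifPn => //; rewrite /preimage /mkset !(inE, notin_setE) /=.
- by move=> nB /AB.
- by move=> tB nA; rewrite u0.
Qed.

Lemma vint_le_sub A B u : vmeas A -> vmeas B -> A `<=` B -> vintg B u ->
  (forall x, B x -> 0 <= u x) -> vint A u <= vint B u.
Proof.
move=> mA mB AB iB u0.
rewrite /vint /Rintegral fine_le //.
- by apply: integrable_fin_num => //; exact: (vintgS mA mB AB iB).
- exact: integrable_fin_num.
- apply: ge0_subset_integral => //.
  + exact: measurable_int iB.
  + by move=> t Bt; rewrite lee_fin u0.
  + by move=> t; exact: AB.
Qed.

Lemma vint_cst A (c : R) : vmeas A -> (mu (rvec @^-1` A) < +oo)%E ->
  vint A (fun=> c) = c * fine (mu (rvec @^-1` A)).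
Proof. by move=> mA fA; rewrite /vint Rintegral_cst. Qed.

Lemma vint_aeq A u v : vmeas A -> vmfun A u -> vmfun A v ->
  vae A (fun x => u x = v x) -> vint A u = vint A v.
Proof.
move=> mA mu' mv uv; rewrite /vint /Rintegral; congr fine.
apply: ae_eq_integral => //; [exact/measurable_EFinP|exact/measurable_EFinP|].
by move: uv; rewrite /vae; apply: filterS => t H At /=; rewrite H.
Qed.

Lemma vint_dct A (f : nat -> 'rV[R]_d -> R) u G : vmeas A ->
  (forall n, vmfun A (f n)) -> vmfun A u -> vintg A G ->
  (forall x, A x -> f ^~ x @ \oo --> u x) ->
  (forall n x, A x -> `|f n x| <= G x) ->
  vint A (f n) @[n --> \oo] --> vint A u.
Proof.
move=> mA mf mu' iG fu fG.
have [] := @dominated_convergence _ _ _ mu _ mA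
    (fun n => EFin \o (f n \o rvec)) (EFin \o (u \o rvec)) (EFin \o (G \o rvec)).
- by move=> n; apply/measurable_EFinP; exact: mf.
- by apply/measurable_EFinP.
- apply: aeW => t At; apply: cvg_EFin; [exact: nearW|exact: fu].
- by [].
- by apply: aeW => t n At; rewrite lee_fin; exact: fG.
move=> iu _ cv; rewrite /vint /Rintegral.
by apply: fine_cvg; rewrite fineK //; exact: integrable_fin_num.
Qed.

End Integration.

(** * Weak derivatives *)

Section FundamentalLemma.
Context {R : realType} {d : nat}.
Hypothesis d_gt0 : (0 < d)%N.
Implicit Types (Om : set 'rV[R]_d) (u g phi : 'rV[R]_d -> R).
Local Notation mu := (@leb R d).
Local Notation dtuple := (d.-tuple (measurableTypeR R)).

Lemma obox_open (a b : 'I_d -> R) : open (obox a b).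
Proof.
rewrite openE => x xab; exists (fun=> fun j => `]a j, b j[%classic).
  move=> i j; rewrite ord1; apply: open_nbhs_nbhs; split; first exact: interval_open.
  by rewrite /= in_itv /=; exact: xab.
by move=> y H j; have := H 0 j; rewrite /= in_itv.
Qed.

Lemma cbox_closed (a b : 'I_d -> R) : closed (cbox a b).
Proof.
have -> : cbox a b = \bigcap_(i in [set: 'I_d]) [set x : 'rV[R]_d | `[a i, b i]%classic (x 0 i)].
  apply/seteqP; split => x /= H i => [_|]; first by rewrite /= in_itv /=; exact: H.
  by have := H i I; rewrite /= in_itv.
apply: closed_bigI => i _.
have := @coord_continuous R 1 d 0 i => /continuous_closedP; apply; exact: interval_closed.
Qed.

Lemma cbox_bounded (a b : 'I_d -> R) : bounded_set (cbox a b).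
Proof.
exists (\sum_i (`|a i| + `|b i|)); split; first exact: num_real.
move=> M HM x xab; apply: norm_le_coord.
  by rewrite (le_trans _ (ltW HM)) // sumr_ge0 // => i _; rewrite addr_ge0.
move=> i; apply: (le_trans _ (ltW HM)).
apply: (@le_trans _ _ (`|a i| + `|b i|)); last first.
  by rewrite (bigD1 i) //= lerDl sumr_ge0 // => j _; rewrite addr_ge0.
have /andP[h1 h2] := xab i.
have := ler_norm (- a i); have := ler_norm (b i); have := normr_ge0 (a i).
by have := normr_ge0 (b i); rewrite normrN ler_norml; lra.
Qed.

Lemma cbox_compact (a b : 'I_d -> R) : compact (cbox a b).
Proof. by apply: bounded_closed_compact; [exact: cbox_bounded|exact: cbox_closed]. Qed.

Lemma vmeas_open Om : open Om -> vmeas Om.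
Proof. exact: measurable_open. Qed.

Lemma vmeas_closed Om : closed Om -> vmeas Om.
Proof. exact: measurable_closed. Qed.

Lemma vmfun_continuous Om u : vmeas Om -> {within Om, continuous u} -> vmfun Om u.
Proof. exact: measurable_continuous. Qed.

Lemma test_function_box Om phi (a b : 'I_d -> R) : elementary phi ->
  (forall x, phi x != 0 -> cbox a b x) -> cbox a b `<=` Om -> test_function Om phi.
Proof.
move=> ephi supp ab.
have cl : closure [set x | phi x != 0] `<=` cbox a b.
  have := @closure_subset _ [set x | phi x != 0] (cbox a b) supp.
  by rewrite -((closure_id _).1 (@cbox_closed a b)).
split; first exact: elementary_smooth.
  apply: (@subclosed_compact _ _ (cbox a b)) => //; first exact: closed_closure.
  exact: cbox_compact.
exact: subset_trans cl ab.
Qed.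

(** Smooth minorants of the indicator of the open box: at distance [s] inside a face the factor is
    [exp (- 1 / (n s))], which tends to 1 as [n] grows. With [n = 1] this is also the profile
    averaged against in Morrey's inequality. *)
Definition bump (n : nat) (a b : 'I_d -> R) : 'rV[R]_d -> R :=
  fun x => \prod_i (flat 0 (n%:R * x 0 i + - (n%:R * a i)) * flat 0 (- n%:R * x 0 i + n%:R * b i)).

Lemma elementary_prod I (r : seq I) (F : I -> 'rV[R]_d -> R) :
  (forall i, elementary (F i)) -> elementary (fun x => \prod_(i <- r) F i x).
Proof.
move=> eF; elim: r => [|i r IH].
  rewrite (_ : (fun x => _) = fun=> 1); first exact: elementary_cst.
  by apply/funext => x; rewrite big_nil.
rewrite (_ : (fun x => _) = F i * (fun x => \prod_(j <- r) F j x)).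
  exact: elementary_mul.
by apply/funext => x; rewrite big_cons.
Qed.

Lemma elementary_bump n a b : elementary (bump n a b).
Proof.
apply: elementary_prod => i.
apply: (@elementary_mul _ _ (fun x : 'rV[R]_d => flat 0 (n%:R * x 0 i + - (n%:R * a i)))
  (fun x : 'rV[R]_d => flat 0 (- n%:R * x 0 i + n%:R * b i))); exact: elementary_flat.
Qed.

Lemma bump_supp n a b x : bump n a b x != 0 -> cbox a b x.
Proof.
rewrite /bump => /prodf_neq0 H i.
have := H i isT; rewrite mulf_eq0 negb_or => /andP[].
rewrite /flat; case: ifPn => h1; last by rewrite eqxx.
case: ifPn => h2 _; last by rewrite eqxx.
move=> _; move: h1 h2; case: n {H} => [|n]; first by rewrite !mul0r subrr ltxx.
rewrite -mulrBr pmulr_rgt0 // subr_gt0 => /ltW ->.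
by rewrite mulNr addrC -mulrBr pmulr_rgt0 // subr_gt0 => /ltW ->.
Qed.

Lemma bump_ge0 n a b x : 0 <= bump n a b x.
Proof. by apply: prodr_ge0 => i _; rewrite mulr_ge0 ?flat_ge0. Qed.

Lemma bump_le1 n a b x : bump n a b x <= 1.
Proof.
rewrite /bump; apply: prodr_ile1 => i _.
by rewrite mulr_ge0 ?flat_ge0 //= mulr_ile1 ?flat_ge0 ?flat0_le1.
Qed.

Lemma flat0_cvg (y : R) : flat 0 (n.+1%:R * y) @[n --> \oo] --> ((0 < y)%R%:R : R).
Proof.
have [y0|y0] := ltP 0 y; last first.
  apply: cvg_near_cst; apply: nearW => n.
  by rewrite /flat ltNge mulr_ge0_le0.
have -> : (fun n => flat 0 (n.+1%:R * y)) = fun n => expR (- (n.+1%:R^-1 * y^-1)).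
  by apply/funext => n; rewrite /flat pmulr_rgt0 // y0 expr0 mul1r invfM.
have -> : (true%:R : R) = expR (- (0 * y^-1)) by rewrite mul0r oppr0 expR0.
apply: cvg_comp; last exact: continuous_expR.
by apply: cvgN; apply: cvgMr_tmp; exact: cvg_harmonic.
Qed.

Lemma cvg_prod I (r : seq I) (F : I -> nat -> R) (l : I -> R) :
  (forall i, F i @ \oo --> l i) ->
  (fun n => \prod_(i <- r) F i n) @ \oo --> \prod_(i <- r) l i.
Proof.
move=> cF; elim: r => [|i r IH].
  by rewrite big_nil; under eq_fun do rewrite big_nil; exact: cvg_cst.
by rewrite big_cons; under eq_fun do rewrite big_cons; exact: cvgM.
Qed.

Lemma vmfun_indic A B : vmeas B -> vmfun A (\1_B : 'rV[R]_d -> R).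
Proof.
move=> mB; rewrite /vmfun.
have -> : (\1_B : 'rV[R]_d -> R) \o rvec = \1_(rvec @^-1` B) by apply/funext => t; rewrite /= !indicE.
exact: measurable_indic.
Qed.

Lemma bump_cvg a b x :
  bump n.+1 a b x @[n --> \oo] --> (`[< obox a b x >]%:R : R).
Proof.
have -> : (`[< obox a b x >]%:R : R) =
    \prod_i ((0 < x 0 i - a i)%R%:R * (0 < b i - x 0 i)%R%:R).
  case: asboolP => xab.
    rewrite big1 // => i _; have /andP[h1 h2] := xab i.
    by rewrite !subr_gt0 h1 h2 mulr1.
  apply/esym/eqP/prodf_eq0.
  have /existsNP[i Hi] := xab; exists i => //.
  by rewrite !subr_gt0 -natrM; move: Hi; case: (a i < _); case: (_ < b i).
apply: cvg_prod => i; apply: cvgM.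
  by under eq_fun do rewrite -mulrBr; exact: flat0_cvg.
by under eq_fun do rewrite mulNr addrC -mulrBr; exact: flat0_cvg.
Qed.

(** The bumps of the box are admissible test functions and converge to its indicator; dominated
    convergence with dominating function [|g|] passes to the limit. *)
Lemma box_integral_eq0 Om g (a b : 'I_d -> R) : open Om -> loc_integrable Om g ->
  (forall phi, test_function Om phi -> vint Om (fun x => g x * phi x) = 0) ->
  cbox a b `<=` Om -> vint (obox a b) g = 0.
Proof.
move=> oOm ig H ab.
have mc : vmeas (cbox a b) by apply: vmeas_closed; exact: cbox_closed.
have mo : vmeas (obox a b) by apply: vmeas_open; exact: obox_open.
have ic : vintg (cbox a b) g by apply: ig => //; exact: cbox_compact.
pose f n x := g x * bump n.+1 a b x.
have mb n : vmfun (cbox a b) (bump n a b).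
  apply: vmfun_continuous => //; apply: continuous_subspaceT => x.
  by apply: differentiable_continuous; apply: elementary_differentiable; exact: elementary_bump.
have f0 n : vint (cbox a b) (f n) = 0.
  rewrite -(@vint_sub _ _ (cbox a b) Om) //.
    by apply: H; apply: test_function_box ab; [exact: elementary_bump|exact: bump_supp].
  move=> x _ nx; rewrite /f; apply/eqP; rewrite mulf_eq0; apply/orP; right.
  by apply: contrapT => /negP /bump_supp.
have cv : vint (cbox a b) (f n) @[n --> \oo] --> vint (cbox a b) (fun x => g x * `[< obox a b x >]%:R).
  apply: (@vint_dct _ _ _ _ _ (fun x => `|g x|)) => //.
  - by move=> n; apply: vmfunM => //; exact: vintg_vmfun.
  - apply: vmfunM; first exact: vintg_vmfun.
    have -> : (fun x => `[< obox a b x >]%:R) = \1_(obox a b) :> (_ -> R).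
      by apply/funext => x; rewrite indicE; congr (nat_of_bool _)%:R; apply/asboolP/idP; rewrite inE.
    exact: vmfun_indic.
  - exact: vintg_norm.
  - by move=> x _; apply: cvgMr; exact: bump_cvg.
  - move=> n x _; rewrite normrM ler_piMr // ger0_norm ?bump_ge0 //; exact: bump_le1.
have := cv; rewrite (_ : (fun n => _) = fun=> 0); last exact/funext.
move=> /(cvg_unique (@norm_hausdorff _ _) (cvg_cst _)); rewrite (@vint_sub _ _ (obox a b)) //; last 2 first.
- exact: obox_cbox.
- by move=> x _ nx; case: asboolP => //; rewrite mulr0.
move=> H0; rewrite H0; apply: vint_eq => x xab; case: asboolP => //; by rewrite mulr1.
Qed.

(** Supplies the generating class for the Dynkin argument below: the preimage of an open interval
    under a coordinate is open, hence a countable union of boxes. *)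
Lemma measurable_tuple_box :
  @measurable _ dtuple = <<s [set S : set dtuple | exists a b, S = box a b] >>.
Proof.
set G := [set S : set dtuple | _].
apply/seteqP; split; last first.
  apply: smallest_sub; first exact: sigma_algebra_measurable.
  by move=> S [a [b ->]]; exact: measurable_box.
rewrite {1}/measurable /=; apply: smallest_sub; first exact: smallest_sigma_algebra.
move=> S; rewrite -bigcup_seq => -[i _ [B mB <-]]; rewrite setTI.
suff : @measurable _ (measurableTypeR R) `<=` image_set_system setT (fun t : dtuple => tnth t i) <<s G >>.
  by move=> /(_ _ mB); rewrite /image_set_system /= setTI.
rewrite RGenOpens.measurableE; apply: smallest_sub.
  by apply: sigma_algebra_image; exact: smallest_sigma_algebra.
move=> _ [x [y ->]]; rewrite /image_set_system /= setTI.
have oI : open [set z : 'rV[R]_d | x < z 0 i < y].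
  have -> : [set z : 'rV[R]_d | x < z 0 i < y] = (fun z : 'rV[R]_d => z 0 i) @^-1` `]x, y[.
    by apply/seteqP; split => z /=; rewrite in_itv.
  have := @coord_continuous R 1 d 0 i => /continuousP; apply; exact: interval_open.
have [a [b [sub cov]]] := open_box_cover d_gt0 oI.
have -> : (fun t : dtuple => tnth t i) @^-1` `]x, y[ = \bigcup_k box (a k) (b k).
  apply/seteqP; split => t /=.
    rewrite in_itv /= -rvecE => /cov[k]; exists k => //.
    by rewrite -preimage_obox.
  by move=> [k _]; rewrite -preimage_obox => /obox_cbox/sub /=; rewrite rvecE in_itv.
apply: sigma_algebra_bigcup => k; apply: sub_sigma_algebra.
by exists (a k), (b k).
Qed.

(** The measurable sets [S] over whose trace on the box [g] integrates to 0 form a Dynkin class. It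
    contains every box, since two boxes meet in a box, and boxes are stable under intersection, so
    it contains all measurable sets; hence [g] is 0 almost everywhere. *)
Lemma box_ae_eq0 Om g (a b : 'I_d -> R) : open Om -> loc_integrable Om g ->
  (forall phi, test_function Om phi -> vint Om (fun x => g x * phi x) = 0) ->
  cbox a b `<=` Om -> vae (obox a b) (fun x => g x = 0).
Proof.
move=> oOm ig H ab.
have mc : vmeas (cbox a b) by apply: vmeas_closed; exact: cbox_closed.
have mo : vmeas (obox a b) by apply: vmeas_open; exact: obox_open.
have ic : vintg (cbox a b) g by apply: ig => //; exact: cbox_compact.
have io : vintg (obox a b) g by apply: vintgS ic => //; exact: obox_cbox.
pose D := rvec @^-1` obox a b : set dtuple.
pose f := EFin \o (g \o rvec) : dtuple -> \bar R.
have if_ (S : set dtuple) : measurable S -> mu.-integrable (D `&` S) f.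
  by move=> mS; apply: integrableS io => //; exact: measurableI.
pose P (S : set dtuple) := (\int[mu]_(t in D `&` S) f t = 0)%E.
have PG a' b' : P (box a' b').
  pose lo i := Num.max (a i) (a' i); pose hi i := Num.min (b i) (b' i).
  have E : D `&` box a' b' = rvec @^-1` obox lo hi.
    rewrite /D -preimage_obox -preimage_setI; congr (_ @^-1` _).
    apply/seteqP; split => x /=.
      move=> [h1 h2] i; have /andP[h3 h4] := h1 i; have /andP[h5 h6] := h2 i.
      by rewrite /lo /hi gt_max h3 h5 lt_min h4 h6.
    move=> h; split => i; have := h i; rewrite /lo /hi gt_max lt_min;
    by move=> /andP[/andP[h1 h2] /andP[h3 h4]]; rewrite ?h1 ?h2 ?h3 ?h4.
  have sub : cbox lo hi `<=` Om.
    apply: subset_trans ab => x h i; have := h i; rewrite /lo /hi ge_max le_min.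
    by move=> /andP[/andP[-> _] /andP[-> _]].
  have := box_integral_eq0 oOm ig H sub; rewrite /P E /vint /Rintegral => V0.
  have iE : mu.-integrable (rvec @^-1` obox lo hi) f.
    by rewrite -E; apply: if_; exact: measurable_box.
  rewrite -[LHS]fineK; first by rewrite V0.
  apply: integrable_fin_num => //; apply: vmeas_open; exact: obox_open.
have PT : P setT.
  have := PG a b; rewrite /P setIT; congr (integral _ _ _ = _).
  by rewrite /D preimage_obox setIid.
have PS S : measurable S -> P S.
  rewrite measurable_tuple_box; apply: (dynkin_induction measurable_tuple_box) => //.
  - move=> _ _ [a1 [b1 ->]] [a2 [b2 ->]].
    exists (fun i => Num.max (a1 i) (a2 i)), (fun i => Num.min (b1 i) (b2 i)).
    apply/seteqP; split => t /=.
      move=> [h1 h2] i; have /andP[h3 h4] := h1 i; have /andP[h5 h6] := h2 i.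
      by rewrite gt_max h3 h5 lt_min h4 h6.
    move=> h; split => i; have := h i; rewrite gt_max lt_min;
    by move=> /andP[/andP[h1 h2] /andP[h3 h4]]; rewrite ?h1 ?h2 ?h3 ?h4.
  - by move=> _ [a1 [b1 ->]].
  - move=> U mU; rewrite /P => PU; move: PT; rewrite /P.
    have dU : [disjoint D `&` U & D `&` ~` U] by apply/disj_set2P; rewrite setIACA setICr setI0.
    rewrite (_ : D `&` setT = (D `&` U) `|` (D `&` ~` U)); last by rewrite -setIUr setUv.
    rewrite integral_setU //=.
    + by rewrite PU add0e.
    + exact: measurableI.
    + by apply: measurableI => //; exact: measurableC.
    + by rewrite -setIUr setUv; exact: measurable_int (if_ _ measurableT).
  - move=> F mF tF PF; rewrite /P setI_bigcupr integral_bigcup //.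
    + by rewrite eseries0 // => k _ _; exact: PF.
    + exact: trivIset_setIl.
    + by move=> k; exact: measurableI.
    + by rewrite -setI_bigcupr; apply: if_; exact: bigcup_measurable.
have := @integral_ae_eq _ _ _ mu D mo (cst 0%E) f io (measurable_cst _).
rewrite /vae => K; apply: filterS (K _) => [t /= + Dt|E ED mE].
  by move=> /(_ Dt) [].
rewrite integral0; have := PS _ mE; rewrite /P.
by rewrite (_ : D `&` E = E) //; exact/setIidPr.
Qed.

Lemma test_functions_separate Om g : open Om -> loc_integrable Om g ->
  (forall phi, test_function Om phi -> vint Om (fun x => g x * phi x) = 0) ->
  vae Om (fun x => g x = 0).
Proof.
move=> oOm ig H; have [a [b [sub cov]]] := open_box_cover d_gt0 oOm.
have : {ae mu, forall t, forall k, obox (a k) (b k) (rvec t) -> g (rvec t) = 0}.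
  by apply: ae_foralln => k; exact: box_ae_eq0 ig H (sub k).
by rewrite /vae; apply: filterS => t K /cov[k]; exact: K.
Qed.

End FundamentalLemma.

(** * Test functions, uniqueness of weak derivatives, translation of integrals *)

Section TestFunctions.
Context {R : realType} {d : nat}.
Hypothesis d_gt0 : (0 < d)%N.
Implicit Types (Om : set 'rV[R]_d) (u v g phi psi : 'rV[R]_d -> R) (j : 'I_d).
Local Notation mu := (@leb R d).

Definition supp phi := closure [set x | phi x != 0].

Lemma notin_supp phi x : ~ supp phi x -> phi x = 0.
Proof.
move=> nx; apply/eqP; apply: contrapT => /negP H; apply: nx.
exact: subset_closure.
Qed.

Lemma mderiv_notin_supp phi a x : ~ supp phi x -> mderiv a phi x = 0.
Proof.
elim: a x => [|j a IH] x nx; first exact: notin_supp.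
rewrite /= /pderiv (@near_eq_derive _ _ _ _ (cst 0)) ?derive_cst //.
have : nbhs x (~` supp phi).
  by apply: open_nbhs_nbhs; split => //; exact/closed_openC/closed_closure.
by apply: filterS => y; exact: IH.
Qed.

Lemma compact_supported_bounded (S : set 'rV[R]_d) psi : compact S -> continuous psi ->
  (forall x, ~ S x -> psi x = 0) -> exists2 M, 0 <= M & forall x, `|psi x| <= M.
Proof.
move=> cS cpsi psi0.
have : compact (psi @` S).
  by apply: continuous_compact => //; exact: continuous_subspaceT.
move=> /compact_bounded[M [_ HM]].
exists (`|M| + 1); first by rewrite addr_ge0.
move=> x; have [Sx|nSx] := pselect (S x); last by rewrite psi0 // normr0 addr_ge0.
apply: (HM _ _ (psi x)); last by exists x.
by rewrite (le_lt_trans (ler_norm _)) // ltrDl.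
Qed.

Lemma test_function_bounded Om phi a : test_function Om phi ->
  exists2 M, 0 <= M & forall x, `|mderiv a phi x| <= M.
Proof.
move=> [sphi cS _]; apply: (compact_supported_bounded cS); first exact: (sphi a).1.
by move=> x; exact: mderiv_notin_supp.
Qed.

Lemma vintg_test Om g phi a : open Om -> loc_integrable Om g -> test_function Om phi ->
  vintg Om (fun x => g x * mderiv a phi x).
Proof.
move=> oOm ig tphi; have [sphi cS SOm] := tphi.
have [M M0 HM] := test_function_bounded a tphi.
have mS : vmeas (supp phi) by apply: vmeas_closed => //; exact: closed_closure.
apply: (@vintg_sub _ _ (supp phi)) => //; first exact: vmeas_open.
  by move=> x _ nx; rewrite mderiv_notin_supp // mulr0.
apply: (@vintg_mul_bounded _ _ _ _ _ M) => //; first exact: ig.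
apply: vmfun_continuous => //; apply: continuous_subspaceT; exact: (sphi a).1.
Qed.

Lemma loc_integrableD Om u v (c : R) : loc_integrable Om u -> loc_integrable Om v ->
  loc_integrable Om (fun x => u x + c * v x).
Proof.
move=> iu iv K cK KOm.
have mK : vmeas K by apply: vmeas_closed => //; apply: compact_closed cK; exact: norm_hausdorff.
by apply: vintgD => //; [exact: iu|apply: vintgZ => //; exact: iv].
Qed.

Lemma weak_derivD Om a u v g h (c : R) : open Om -> is_weak_deriv Om a u g ->
  is_weak_deriv Om a v h ->
  is_weak_deriv Om a (fun x => u x + c * v x) (fun x => g x + c * h x).
Proof.
move=> oOm [iu ig ug] [iv ih vh].
split; [exact: loc_integrableD|exact: loc_integrableD|move=> phi tphi].
have mOm := vmeas_open d_gt0 oOm.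
have ip w b : loc_integrable Om w -> vintg Om (fun x => w x * mderiv b phi x).
  by move=> iw; exact: vintg_test.
transitivity (vint Om (fun x => u x * mderiv a phi x + c * (v x * mderiv a phi x))).
  by apply: vint_eq => x _; ring.
rewrite vintD //; [|exact: ip|by apply: vintgZ => //; exact: ip].
rewrite vintZ //; last exact: ip.
rewrite ug // vh // mulrCA -mulrDr; congr (_ * _).
rewrite -vintZ //; last exact: (ip _ [::]).
rewrite -vintD //; [|exact: (ip _ [::])|by apply: vintgZ => //; exact: (ip _ [::])].
by apply: vint_eq => x _; ring.
Qed.

Lemma weak_deriv_unique Om a u g h : open Om -> is_weak_deriv Om a u g ->
  is_weak_deriv Om a u h -> vae Om (fun x => g x = h x).
Proof.
move=> oOm [iu ig ug] [_ ih uh].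
have := @test_functions_separate _ _ d_gt0 Om (fun x => g x + (-1) * h x) oOm.
move=> /(_ (loc_integrableD _ ig ih)).
have mOm := vmeas_open d_gt0 oOm.
rewrite /vae => H; suff : {ae mu, forall t, Om (rvec t) -> g (rvec t) + -1 * h (rvec t) = 0}.
  by apply: filterS => t /[apply] /eqP; rewrite mulN1r subr_eq0 => /eqP.
apply: H => phi tphi.
have ip w : loc_integrable Om w -> vintg Om (fun x => w x * phi x).
  by move=> iw; exact: (vintg_test [::]).
transitivity (vint Om (fun x => g x * phi x - h x * phi x)).
  by apply: vint_eq => x _; ring.
rewrite vintB //; [|exact: ip|exact: ip].
have := ug _ tphi; rewrite uh // => /(@mulfI _ ((-1) ^+ size a) _); rewrite signr_eq0 => /(_ isT) ->.
by rewrite subrr.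
Qed.

Lemma vmfun_cvg A (f : nat -> 'rV[R]_d -> R) u : (forall n, vmfun A (f n)) ->
  (forall x, A x -> f ^~ x @ \oo --> u x) -> vmfun A u.
Proof.
move=> mf fu; apply: (@measurable_fun_cvg _ _ _ _ (fun n => f n \o rvec)) => //.
by move=> t At; exact: fu.
Qed.

Lemma rvec_tshift j (s : R) (t : d.-tuple (measurableTypeR R)) :
  rvec (tshift j s t) = rvec t + s *: delta_mx 0 j.
Proof.
apply/rowP => i; rewrite !mxE tnth_mktuple eqxx /=.
by rewrite mulrC eq_sym.
Qed.

Lemma vintg_translate j s u : vintg setT u -> vintg setT (fun x => u (x + s *: delta_mx 0 j)).
Proof.
move=> iu; apply/integrableP.
have [mu' fu] := integrableP _ _ _ iu.
have mt := measurable_tshift j s.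
have E : EFin \o ((fun x => u (x + s *: delta_mx 0 j)) \o rvec) =
         (EFin \o (u \o rvec)) \o tshift j s :> (d.-tuple (measurableTypeR R) -> _).
  by apply/funext => t /=; rewrite rvec_tshift.
rewrite preimage_setT E; split; first by apply: measurableT_comp.
have := @ge0_integral_pushforward _ _ _ _ R _ mt mu setT (fun t => `|(EFin \o (u \o rvec)) t|%E)
  measurableT.
rewrite preimage_setT => <- //; last by apply: measurableT_comp.
rewrite (eq_measure_integral mu) //.
by move=> B mB _; exact: leb_translate.
Qed.

Lemma vint_translate j s u : vintg setT u ->
  vint setT (fun x => u (x + s *: delta_mx 0 j)) = vint setT u.
Proof.
move=> iu; have ius := vintg_translate j s iu.
have mt := measurable_tshift j s.
have mu' := vintg_vmfun iu.
have := @integral_pushforward _ _ _ _ R _ mt mu setT (EFin \o (u \o rvec)).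
rewrite preimage_setT => H.
rewrite /vint /Rintegral; congr fine.
transitivity (\int[pushforward mu (tshift j s)]_t (EFin \o (u \o rvec)) t)%E; last first.
  by apply: eq_measure_integral => B mB _; exact: leb_translate.
rewrite H //.
- by apply: eq_integral => t _ /=; rewrite rvec_tshift.
- exact/measurable_EFinP.
- move: ius; rewrite /vintg; congr (mu.-integrable _ _).
  by apply/funext => t /=; rewrite rvec_tshift.
Qed.

End TestFunctions.

(** * Weak derivatives as limits of difference quotients *)

Section DifferenceQuotients.
Context {R : realType} {d : nat}.
Hypothesis d_gt0 : (0 < d)%N.
Implicit Types (Om : set 'rV[R]_d) (u v g phi psi : 'rV[R]_d -> R) (j : 'I_d).
Local Notation mu := (@leb R d).
Local Notation e j := (delta_mx 0 j : 'rV[R]_d).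

Lemma vmeasT : @vmeas R d setT.
Proof. exact: measurableT. Qed.

Lemma is_derive_line phi (x v : 'rV[R]_d) (h : R) : derivable phi (x + h *: v) v ->
  is_derive h 1 (fun s => phi (x + s *: v)) ('D_v phi (x + h *: v)).
Proof.
have E : (fun k : R => k^-1 *: (((fun s => phi (x + s *: v)) \o shift h) (k *: 1) - phi (x + h *: v)))
   = (fun k => k^-1 *: ((phi \o shift (x + h *: v)) (k *: v) - phi (x + h *: v))).
  apply/funext => k /=; congr (_ *: (phi _ - _)).
  by rewrite scalerDl /GRing.scale /= mulr1 addrCA.
by move=> dphi; apply: DeriveDef; rewrite /derivable /derive /= E.
Qed.

Lemma test_function_lipschitz Om phi j : test_function Om phi ->
  exists2 L, 0 <= L & forall x t, 0 < t -> `|phi (x + t *: e j) - phi x| <= L * t.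
Proof.
move=> tphi; have [L L0 HL] := test_function_bounded [:: j] tphi.
have [sphi _ _] := tphi.
exists L => // x t t0.
have D (s : R) : is_derive s 1 (fun s => phi (x + s *: e j)) (pderiv j phi (x + s *: e j)).
  by apply: is_derive_line; exact: (sphi [::]).2.
have [|c _] := @MVT R (fun s => phi (x + s *: e j)) (fun s => pderiv j phi (x + s *: e j)) 0 t t0.
  apply: continuous_subspaceT => s; apply: differentiable_continuous.
  by apply/derivable1_diffP; have [] := D s.
rewrite scale0r addr0 subr0 => ->.
by rewrite normrM (gtr0_norm t0) ler_wpM2r ?(ltW t0) //; exact: HL.
Qed.

Local Notation del n := ((n.+1%:R)^-1 : R).

Lemma cvg_step j (x : 'rV[R]_d) : (fun n => x + del n *: e j) @ \oo --> x.
Proof.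
rewrite -[X in _ --> X]addr0 -(scale0r (e j)).
by apply: cvgD; [exact: cvg_cst|apply: cvgZr_tmp; exact: cvg_harmonic].
Qed.

Lemma near_step j (A : set 'rV[R]_d) x : open A -> A x ->
  \forall n \near \oo, A (x + del n *: e j).
Proof. by move=> oA Ax; exact: (cvg_step j (open_nbhs_nbhs (conj oA Ax))). Qed.

Lemma cvg_difference_quotient phi j x : derivable phi x (e j) ->
  (fun n => n.+1%:R * (phi (x + del n *: e j) - phi x)) @ \oo --> pderiv j phi x.
Proof.
move=> dphi.
have := @is_derive_line phi x (e j) 0; rewrite scale0r addr0 => /(_ dphi)[].
rewrite /derivable /= => cv0 E; rewrite /pderiv -E.
have : (fun k : R => k^-1 *: (phi (x + (k *: 1 + 0) *: e j) - phi (x + 0 *: e j))) @ 0^' -->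
   'D_1 (fun s : R => phi (x + s *: e j)) 0 by exact: cv0.
move=> /cvgr_dnbhsP /(_ (fun n => del n)) H.
have <- : (fun n => (del n)^-1 *: (phi (x + (del n *: 1 + 0) *: e j) - phi (x + 0 *: e j))) =
    (fun n => n.+1%:R * (phi (x + del n *: e j) - phi x)).
  by apply/funext => n; rewrite invrK scale0r !addr0 /GRing.scale /= mulr1.
by apply: H; split; [move=> n; rewrite invr_neq0|exact: cvg_harmonic].
Qed.

Lemma scaled_difference_le n (a b : R) : `|a| <= b * del n -> `|n.+1%:R * a| <= b.
Proof. by move=> ab; rewrite normrM ger0_norm // mulrC -ler_pdivlMr. Qed.

Section weak.
Variables (Om : set 'rV[R]_d) (u g : 'rV[R]_d -> R) (j : 'I_d) (M L : R).
Hypotheses (oOm : open Om) (bOm : bounded_set Om) (mu' : vmfun Om u).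
Hypothesis uM : forall x, Om x -> `|u x| <= M.
Hypothesis uL : forall x t, Om x -> 0 < t -> Om (x + t *: e j) -> `|u (x + t *: e j) - u x| <= L * t.
Hypothesis ug : forall x, Om x ->
  (fun n => n.+1%:R * (u (x + del n *: e j) - u x)) @ \oo --> g x.

Let mOm : vmeas Om := vmeas_open d_gt0 oOm.
Let fOm : (mu (rvec @^-1` Om) < +oo)%E := leb_bounded bOm mOm.

Lemma vintg_setT_patch w : vintg Om w -> vintg setT (w \_ Om).
Proof.
move=> iw; apply: (@vintg_sub _ _ Om) => //; first exact: vmeasT.
  by move=> x _ nx; rewrite /patch memNset.
by apply: vintg_eq iw => // x Ox; rewrite /patch mem_set.
Qed.

Lemma vintg_difference w n : vintg setT w ->
  vintg setT (fun x => n.+1%:R * (w (x + del n *: e j) - w x)).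
Proof.
by move=> iw; apply: (vintgZ _ vmeasT); apply: (vintgB vmeasT) => //; exact: vintg_translate.
Qed.

Lemma vint_difference w n : vintg setT w ->
  vint setT (fun x => n.+1%:R * (w (x + del n *: e j) - w x)) = 0.
Proof.
move=> iw; have iwt := vintg_translate j (del n) iw.
rewrite (vintZ _ vmeasT); last exact: (vintgB vmeasT).
by rewrite (vintB vmeasT) // vint_translate // subrr mulr0.
Qed.

Lemma difference_quotient_vmfun : vmfun Om g.
Proof.
have iu : vintg setT (u \_ Om) by apply: vintg_setT_patch; exact: vintg_bounded uM.
apply: (@vmfun_cvg _ _ _ (fun n x => n.+1%:R * ((u \_ Om) (x + del n *: e j) - (u \_ Om) x))).
  move=> n; apply: (@vmfunS _ _ _ setT) => //; first exact: vmeasT.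
  by apply: vintg_vmfun; exact: vintg_difference.
move=> x Ox; apply: cvg_trans (ug Ox).
apply: near_eq_cvg; near=> n; rewrite /patch !mem_set //.
by near: n; exact: near_step.
Unshelve. all: by end_near. Qed.

Lemma difference_quotient_le x : Om x -> `|g x| <= L.
Proof.
move=> Ox; have cn : `|n.+1%:R * (u (x + del n *: e j) - u x)| @[n --> \oo] --> `|g x|.
  by apply: cvg_norm; exact: ug.
apply: (cvgr_to_le cn); near=> n.
have t0 : 0 < del n by rewrite invr_gt0.
apply: scaled_difference_le; apply: uL => //; near: n; exact: near_step.
Unshelve. all: by end_near. Qed.

(* Discrete integration by parts: the difference quotients of [u * phi], extended by zero,
   have integral zero by translation invariance. *)
Lemma difference_quotient_weak_deriv : is_weak_deriv Om [:: j] u g.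
Proof.
have ibd w K : vmfun Om w -> (forall x, Om x -> `|w x| <= K) -> loc_integrable Om w.
  move=> mw wK S cS SOm.
  have mS : vmeas S by apply: vmeas_closed => //; apply: compact_closed cS; exact: norm_hausdorff.
  by apply: (vintgS mS mOm SOm); exact: vintg_bounded wK.
have lu : loc_integrable Om u by exact: ibd uM.
have lg : loc_integrable Om g by apply: ibd difference_quotient_le; exact: difference_quotient_vmfun.
split => // phi tphi.
have [sphi cS SOm] := tphi.
have [K K0 HK] := test_function_bounded [::] tphi.
have [L' L'0 HL'] := test_function_lipschitz j tphi.
pose U := (fun x => u x * phi x) \_ Om.
have iU : vintg setT U by apply: vintg_setT_patch; exact: (vintg_test d_gt0 [::] oOm lu tphi).
pose F n x := n.+1%:R * (U (x + del n *: e j) - U x).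
pose h x := g x * phi x + u x * pderiv j phi x.
have ih : vintg Om h.
  apply: vintgD => //; first exact: (vintg_test d_gt0 [::] oOm lg tphi).
  exact: (vintg_test d_gt0 [:: j] oOm lu tphi).
have FW x : F ^~ x @ \oo --> (h \_ Om) x.
  have [Ox|nOx] := pselect (Om x).
    have -> : (h \_ Om) x = g x * phi x + u x * pderiv j phi x by rewrite /patch mem_set.
    have cphi : (fun n => phi (x + del n *: e j)) @ \oo --> phi x.
      by apply: cvg_comp; [exact: cvg_step|exact: (sphi [::]).1].
    have dphi := cvg_difference_quotient ((sphi [::]).2 j x).
    have cD : (fun n => n.+1%:R * (u (x + del n *: e j) - u x) * phi (x + del n *: e j) +
        u x * (n.+1%:R * (phi (x + del n *: e j) - phi x))) @ \oo -->
        g x * phi x + u x * pderiv j phi x.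
      by apply: cvgD; apply: cvgM => //; [exact: ug|exact: cvg_cst].
    apply: cvg_trans cD; apply: near_eq_cvg; near=> n.
    rewrite /F /U /patch !mem_set //=; first by ring.
    by near: n; exact: near_step.
  have -> : (h \_ Om) x = 0 by rewrite /patch memNset.
  (* Translates of [x] may enter [Om], but the closed support of [phi] avoids a neighbourhood of
     [x], so [F n x] is eventually 0. *)
  apply: cvg_near_cst.
  have nS : (~` supp phi) x by move=> /SOm.
  have oS : open (~` supp phi) by exact/closed_openC/closed_closure.
  have := near_step j oS nS; apply: filterS => n nSn.
  rewrite /F /U /patch [x \in Om]memNset // subr0.
  by case: ifP => _; [rewrite (notin_supp nSn) !mulr0|exact: mulr0].
have [m [_ Hm]] := bOm.
have {}Hm x : Om x -> `|x| <= `|m| + 1.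
  by apply: Hm; rewrite (le_lt_trans (ler_norm _)) // ltrDl.
(* [Om] lies in the cube of half-width [|m| + 1]; the additional 1 absorbs a translation by at most
   1, so every [F n] vanishes off [B]. *)
pose B := cbox (fun=> - (`|m| + 2)) (fun=> `|m| + 2) : set 'rV[R]_d.
have mB : vmeas B by apply: vmeas_closed => //; exact: cbox_closed.
have fB : (mu (rvec @^-1` B) < +oo)%E by apply: leb_bounded => //; exact: cbox_bounded.
pose C := `|L| * K + `|M| * L'.
have C0 : 0 <= C by rewrite addr_ge0 // mulr_ge0.
have iG : vintg setT ((fun=> C) \_ B).
  apply: (@vintg_sub _ _ B) => //; first exact: vmeasT.
    by move=> x _ nx; rewrite /patch memNset.
  by apply: (@vintg_eq _ _ _ (fun=> C)) (vintg_cst C mB fB) => // x Bx; rewrite /patch mem_set.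
have bF n x : `|F n x| <= ((fun=> C) \_ B) x.
  have t0 : 0 < del n by rewrite invr_gt0.
  have C0B : 0 <= ((fun=> C) \_ B) x by rewrite /patch; case: ifP.
  have xB : `|x| <= `|m| + 2 -> ((fun=> C) \_ B) x = C.
    move=> xm; rewrite /patch mem_set // => i.
    by rewrite -ler_norml (le_trans (coord_le_norm _ _)).
  have u1 y : Om y -> `|u y| <= `|M| by move=> /uM /le_trans; apply; exact: ler_norm.
  move: C0B xB; move: (((fun=> C) \_ B) x) => cB C0B xB; have pE : (point : R) = 0 by [].
  (* Four cases, according to whether [x] and its translate lie in [Om]. If only one does, [phi]
     vanishes at the other, and the Lipschitz bound of [phi] alone controls the quotient. *)
  rewrite /F /U /patch ?pE; case: ifPn; case: ifPn; rewrite ?pE !(inE, notin_setE) => hx hy.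
  - rewrite xB; last by rewrite (le_trans (Hm _ hx)) // lerD2l ler1n.
    apply: scaled_difference_le.
    have -> : u (x + del n *: e j) * phi (x + del n *: e j) - u x * phi x =
      (u (x + del n *: e j) - u x) * phi (x + del n *: e j) +
      u x * (phi (x + del n *: e j) - phi x) by ring.
    rewrite (le_trans (ler_normD _ _)) // !normrM /C mulrDl; apply: lerD.
      rewrite mulrAC; apply: ler_pM => //.
      by apply: (le_trans (uL hx t0 hy)); rewrite ler_wpM2r ?ler_norm // ltW.
    by rewrite -mulrA ler_pM // ?u1 // HL'.
  - rewrite xB; last first.
      rewrite -[x](addrK (del n *: e j)) (le_trans (ler_normB _ _)) //.
      rewrite (natrD _ 1 1) addrA; apply: lerD; first exact: Hm.
      apply: norm_le_coord => // i; rewrite !mxE eqxx /=.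
      by case: eqP => _; rewrite ?mulr1 ?mulr0 ?normr0 // (gtr0_norm t0) invf_le1 // ler1n.
    rewrite subr0; apply: scaled_difference_le.
    have p0 : phi x = 0 by apply: notin_supp => /SOm.
    rewrite -[phi _]subr0 -p0 normrM /C mulrDl -[leLHS]add0r; apply: lerD.
      by rewrite !mulr_ge0 // ltW.
    by rewrite -mulrA ler_pM // ?u1 // HL'.
  - rewrite xB; last by rewrite (le_trans (Hm _ hx)) // lerD2l ler1n.
    rewrite sub0r; apply: scaled_difference_le.
    have p0 : phi (x + del n *: e j) = 0 by apply: notin_supp => /SOm.
    rewrite -mulrN -sub0r -p0 normrM /C mulrDl -[leLHS]add0r; apply: lerD.
      by rewrite !mulr_ge0 // ltW.
    by rewrite -mulrA ler_pM // ?u1 // HL'.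
  - by rewrite subr0 mulr0 normr0.
have := vint_dct vmeasT (fun n => vintg_vmfun (vintg_difference n iU)) _ iG (fun x _ => FW x) (fun n x _ => bF n x).
have mW : vmfun setT (h \_ Om) by apply: vintg_vmfun; exact: vintg_setT_patch.
move=> /(_ mW).
rewrite (_ : (fun n => _) = fun=> 0); last by apply/funext => n; exact: vint_difference.
move=> /(cvg_unique (@norm_hausdorff _ _) (cvg_cst _)).
rewrite (@vint_sub _ _ Om) //; last by move=> x _ nx; rewrite /patch memNset.
rewrite (@vint_eq _ _ _ _ h); last by move=> x Ox; rewrite /patch mem_set.
rewrite vintD //; [|exact: (vintg_test d_gt0 [::] oOm lg tphi)|exact: (vintg_test d_gt0 [:: j] oOm lu tphi)].
move/esym/eqP; rewrite addrC addr_eq0 => /eqP; rewrite /= mulN1r; exact.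
Unshelve. all: by end_near. Qed.

End weak.
End DifferenceQuotients.

Lemma elementary_sum (R : realType) d I (r : seq I) (F : I -> 'rV[R]_d -> R) :
  (forall i, elementary (F i)) -> elementary (fun x => \sum_(i <- r) F i x).
Proof.
move=> eF; elim: r => [|i r IH].
  by under eq_fun do rewrite big_nil; exact: elementary_cst.
by under eq_fun do rewrite big_cons; exact: (elementary_add (eF i) IH).
Qed.

Lemma elementary_continuous (R : realType) d (f : 'rV[R]_d -> R) : elementary f -> continuous f.
Proof.
by move=> ef x; apply: differentiable_continuous; exact: elementary_differentiable.
Qed.

Lemma elementary_scale (R : realType) d (f : 'rV[R]_d -> R) (c : R) : elementary f ->
  elementary (fun x => f x * c).
Proof. by move=> ef; exact: (elementary_mul ef (@elementary_cst _ _ c)). Qed.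

Lemma elementary_affine (R : realType) d (c : R) (B : 'I_d -> R) :
  elementary (fun x : 'rV[R]_d => c + \sum_k x 0 k * B k).
Proof.
apply: (@elementary_add _ _ (fun=> c)); first exact: elementary_cst.
apply: (@elementary_sum _ _ _ _ (fun k (x : 'rV[R]_d) => x 0 k * B k)) => k.
by apply: elementary_scale; exact: elementary_coord.
Qed.

Lemma closed_elementary_eq (R : realType) d (f g : 'rV[R]_d -> R) :
  elementary f -> elementary g -> closed [set x | f x = g x].
Proof.
move=> ef eg.
have /continuous_closedP /(_ _ (@closed_eq _ 0)) : continuous (f + (fun x => g x * -1)).
  by apply: elementary_continuous; apply: elementary_add => //; exact: elementary_scale.
congr closed; apply/seteqP; split => x; rewrite /= fctE mulrN1.
  by move/eqP; rewrite subr_eq0 => /eqP.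
by move=> ->; rewrite subrr.
Qed.

(** * Finite element functions *)

Section Barycentric.
Context {R : realType} {d : nat} (Om : set 'rV[R]_d) (T : mesh R d).
Hypothesis HT : triangulation Om T.
Local Notation n := (nvert T).
Implicit Types (K L : {set 'I_n}) (x y : 'rV[R]_d) (w : 'I_n -> R).

Definition barycentric K x w :=
  [/\ forall i, 0 <= w i, forall i, i \notin K -> w i = 0,
      \sum_i w i = 1 & x = \sum_i w i *: vert i].

Lemma barycentric_simplex K x w : barycentric K x w -> simplex K x.
Proof. by exists w. Qed.

Lemma weights_unique K w w' : K \in elts T ->
  (forall i, i \notin K -> w i = 0) -> (forall i, i \notin K -> w' i = 0) ->
  \sum_i w i = \sum_i w' i ->
  \sum_i w i *: vert i = \sum_i w' i *: (vert i : 'rV[R]_d) -> w = w'.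
Proof.
move=> KT wK w'K sw sv; apply/funext => i; apply/eqP; rewrite -subr_eq0; apply/eqP.
apply: (elts_nondegenerate HT KT (w := fun i => w i - w' i)).
- by move=> k kK; rewrite wK // w'K // subrr.
- by rewrite sumrB sw subrr.
- under eq_bigr do rewrite scalerBl.
  by rewrite sumrB sv subrr.
Qed.

Lemma barycentric_unique K x w w' : K \in elts T ->
  barycentric K x w -> barycentric K x w' -> w = w'.
Proof.
move=> KT [_ wK w1 xw] [_ w'K w'1 xw']; apply: (weights_unique KT) => //.
  by rewrite w1 w'1.
by rewrite -xw -xw'.
Qed.

(** Conformity puts [x] in the simplex spanned by the common vertices. Weights supported there are
    admissible for both elements, and affine independence makes the weights in each element
    unique. *)
Lemma barycentric_conforming K L x w w' : K \in elts T -> L \in elts T ->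
  barycentric K x w -> barycentric L x w' -> w = w'.
Proof.
move=> KT LT Kw Lw'.
have : (simplex K `&` simplex L) x by split; [exists w|exists w'].
rewrite (elts_conforming HT KT LT) => -[v [v0 vKL v1 xv]].
have Kv : barycentric K x v by split => // i iK; apply: vKL; rewrite inE (negbTE iK).
have Lv : barycentric L x v by split => // i iL; apply: vKL; rewrite inE (negbTE iL) andbF.
by rewrite (barycentric_unique KT Kw Kv) (barycentric_unique LT Lw' Lv).
Qed.

Lemma barycentric_convex K x y w w' (t : R) : 0 <= t <= 1 ->
  barycentric K x w -> barycentric K y w' ->
  barycentric K (t *: x + (1 - t) *: y) (fun i => t * w i + (1 - t) * w' i).
Proof.
move=> /andP[t0 t1] [w0 wK w1 ->] [w'0 w'K w'1 ->]; split.
- by move=> i; rewrite addr_ge0 // mulr_ge0 // subr_ge0.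
- by move=> i iK; rewrite wK // w'K // !mulr0 addr0.
- by rewrite big_split /= -!mulr_sumr w1 w'1; ring.
- rewrite !scaler_sumr -big_split /=; apply: eq_bigr => i _.
  by rewrite [RHS]scalerDl -!scalerA.
Qed.

Lemma barycentric_vert K i : i \in K -> barycentric K (vert i) (fun k => (k == i)%:R).
Proof.
move=> iK; split.
- by [].
- by move=> k kK; case: eqP => // E; rewrite E iK in kK.
- by rewrite (bigD1 i) //= eqxx big1 ?addr0 // => k /negbTE ->.
- rewrite (bigD1 i) //= eqxx scale1r big1 ?addr0 // => k /negbTE ->.
  by rewrite scale0r.
Qed.

(** Affine independence says that the matrix [M] has independent rows: its row for a vertex of [K]
    holds the position and a 1, and the block [D] adds unit rows for the vertices outside [K]. A
    right inverse of [M] then recovers the weights as affine functions of the point. Since no sign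
    of [w] is assumed, these functions make sense on the whole space. *)
Lemma weights_affine K : K \in elts T ->
  exists (c : 'I_n -> R) (B : 'I_d -> 'I_n -> R), forall w,
    (forall i, i \notin K -> w i = 0) -> \sum_i w i = 1 ->
    forall z, w z = c z + \sum_k (\sum_i w i *: vert i) 0 k * B k z.
Proof.
move=> KT.
pose V : 'M[R]_(n, d) := \matrix_(i < n, k < d) (if i \in K then vert i 0 k else 0).
pose O : 'M[R]_(n, 1) := \matrix_(i < n, k < 1) (if i \in K then 1 else 0).
pose D : 'M[R]_(n, n) := \matrix_(i < n, k < n) (if (i == k) && (i \notin K) then 1 else 0).
pose M := row_mx (row_mx V O) D.
have wV (w : 'I_n -> R) : (forall i, i \notin K -> w i = 0) ->
    (\row_i w i) *m V = \sum_i w i *: vert i.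
  move=> wK; apply/rowP => k; rewrite !mxE summxE; apply: eq_bigr => i _.
  by rewrite /V !mxE; case: ifPn => // iK; rewrite wK // !mul0r.
have wO (w : 'I_n -> R) : (forall i, i \notin K -> w i = 0) ->
    (\row_i w i) *m O = (\sum_i w i)%:M.
  move=> wK; apply/rowP => k; rewrite !mxE ord1 eqxx mulr1n; apply: eq_bigr => i _.
  by rewrite /O !mxE; case: ifPn => iK; rewrite ?mulr1 // wK // mulr0.
have wD (w : 'I_n -> R) : forall k, ((\row_i w i) *m D) 0 k = if k \notin K then w k else 0.
  move=> k; rewrite /D !mxE (bigD1 k) //= big1 ?addr0.
    by rewrite !mxE eqxx /=; case: ifP; rewrite ?mulr1 ?mulr0.
  by move=> i /negbTE ik; rewrite !mxE ik mulr0.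
have fM : row_free M.
  apply: inj_row_free => v; rewrite /M mul_mx_row => H.
  pose w i := v 0 i.
  have vw : v = \row_i w i by apply/rowP => i; rewrite mxE.
  have [H1 H2] : v *m row_mx V O = 0 /\ v *m D = 0.
    by move/(congr1 (fun X => (lsubmx X, rsubmx X))): H; rewrite row_mxKl row_mxKr => -[-> ->]; rewrite linear0 raddf0.
  have wK i : i \notin K -> w i = 0.
    by move=> iK; have := wD w i; rewrite -vw H2 mxE iK.
  move: H1; rewrite mul_mx_row => /(congr1 (fun X => (lsubmx X, rsubmx X))).
  rewrite row_mxKl row_mxKr vw wV // wO // => -[H3 H4].
  have {}H3 : \sum_i w i *: vert i = 0 by rewrite H3; apply/rowP => k; rewrite !mxE.
  have {}H4 : \sum_i w i = 0.
    by have := congr1 (fun X : 'M[R]_1 => X 0 0) H4; rewrite !mxE eqxx mulr1n.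
  have w0 := elts_nondegenerate HT KT wK H4 H3.
  by apply/rowP => i; rewrite !mxE w0.
move: (pinvmx M) (mulmxVp fM) => P PM.
exists (fun z => dsubmx (usubmx P) 0 z), (fun k z => usubmx (usubmx P) k z).
move=> w wK w1 z.
have : \row_i w i = row_mx (row_mx (\sum_i w i *: vert i) 1%:M) 0 *m P.
  rewrite -[LHS]mulmx1 -PM mulmxA; congr (_ *m _).
  rewrite /M !mul_mx_row wV // wO // w1; congr (row_mx _ _).
  by apply/rowP => k; rewrite wD !mxE; case: ifP => // /wK.
rewrite -[P]vsubmxK mul_row_col mul0mx addr0 -[usubmx P]vsubmxK mul_row_col mul1mx.
move/rowP => /(_ z); rewrite vsubmxK mxE => ->; rewrite addrC mxE vsubmxK; congr (_ + _).
by rewrite mxE.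
Qed.

Definition bary K x : 'I_n -> R := xget (fun=> 0) [set w | barycentric K x w].

Lemma baryP K x : simplex K x -> barycentric K x (bary K x).
Proof. by move=> [w Kw]; apply: (xgetPex (fun=> 0)); exists w. Qed.

Lemma bary_eq K x w : K \in elts T -> barycentric K x w -> bary K x = w.
Proof. by move=> KT Kw; apply: (barycentric_unique KT (baryP _) Kw); exists w. Qed.

Lemma bary_affine K : K \in elts T ->
  exists (c : 'I_n -> R) (B : 'I_d -> 'I_n -> R), forall x, simplex K x ->
    forall z, bary K x z = c z + \sum_k x 0 k * B k z.
Proof.
move=> KT; have [c [B H]] := weights_affine KT; exists c, B => x /baryP[_ wK w1 xw] z.
by rewrite [LHS]H // -xw.
Qed.

(** The affine extensions of the barycentric coordinates cut the simplex out by weak inequalities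
    and equations; the last group of equations says that the weights do reproduce the point. *)
Lemma simplex_closed K : K \in elts T -> closed (simplex K).
Proof.
move=> KT; have [c [B H]] := weights_affine KT.
pose lam z x := c z + \sum_k x 0 k * B k z.
have -> : simplex K = (\bigcap_i [set x | 0 <= lam i x]) `&`
    ((\bigcap_(i in [set i | i \notin K]) [set x | lam i x = 0]) `&`
    ([set x | \sum_i lam i x = 1] `&`
     \bigcap_k [set x : 'rV[R]_d | \sum_i lam i x * vert i 0 k = x 0 k])).
  apply/seteqP; split => x.
    move=> Kx; have [w0 wK w1 xw] := baryP Kx.
    have E i : lam i x = bary K x i by rewrite [RHS]H // -xw.
    split; first by move=> i _; rewrite /= E.
    split; first by move=> i iK; rewrite /= E wK.
    split; first by rewrite /=; under eq_bigr do rewrite E.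
    by move=> k _ /=; rewrite [in RHS]xw summxE; apply: eq_bigr => i _; rewrite E mxE.
  move=> [h0 [hK [h1 hx]]]; exists (lam ^~ x); split.
  - by move=> i; exact: h0.
  - by move=> i iK; exact: hK.
  - exact: h1.
  - by apply/rowP => k; rewrite -[LHS](hx k I) summxE; apply: eq_bigr => i _; rewrite mxE.
have elam i : elementary (lam i) by exact: elementary_affine.
apply: closedI.
  apply: closed_bigI => i _.
  by have /continuous_closedP /(_ _ (@closed_ge _ 0)) := elementary_continuous (elam i).
apply: closedI.
  by apply: closed_bigI => i _; apply: closed_elementary_eq => //; exact: elementary_cst.
apply: closedI.
  apply: closed_elementary_eq; last exact: elementary_cst.
  exact: elementary_sum.
apply: closed_bigI => k _; apply: closed_elementary_eq; last exact: elementary_coord.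
by apply: elementary_sum => i; exact: elementary_scale.
Qed.

End Barycentric.

Lemma within_continuousD (R : realType) (X : topologicalType) (W : normedModType R) (A : set X)
    (u v : X -> W) (c : R) : {within A, continuous u} -> {within A, continuous v} ->
  {within A, continuous (fun x => u x + c *: v x)}.
Proof.
move=> cu cv x; apply: (@cvgD _ _ _ _ _ u (fun x => c *: v x)); first exact: cu.
exact: (cvgZl_tmp (cv x)).
Qed.

Lemma within_continuousZ (R : realType) (X : topologicalType) (W : normedModType R) (A : set X)
    (f : X -> R) (a : W) : {within A, continuous f} -> {within A, continuous (fun x => f x *: a)}.
Proof.
by move=> cf x; exact: (cvgZr_tmp (cf x)).
Qed.

(** * Nodal basis functions and nodal expansion *)

Section HatFunctions.
Context {R : realType} {d : nat} (Om : set 'rV[R]_d) (T : mesh R d).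
Hypothesis HT : triangulation Om T.
Local Notation n := (nvert T).
Implicit Types (K L : {set 'I_n}) (x y : 'rV[R]_d) (w : 'I_n -> R) (z : 'I_n).
Implicit Types (v : 'rV[R]_d -> 'rV[R]_3).

Lemma simplex_sub_closure K : K \in elts T -> simplex K `<=` closure Om.
Proof. by move=> KT x Kx; rewrite (elts_cover HT); exists K. Qed.

Lemma closure_simplex x : closure Om x -> exists2 K, K \in elts T & simplex K x.
Proof. by rewrite (elts_cover HT) => -[K KT Kx]; exists K. Qed.

Lemma simplex_vert K i : i \in K -> simplex K (vert i).
Proof. by move=> iK; apply: barycentric_simplex; exact: barycentric_vert. Qed.

Lemma closure_vert i : closure Om (@vert _ _ T i).
Proof.
have [K KT iK] := vert_used HT i.
by apply: (simplex_sub_closure KT); exact: simplex_vert.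
Qed.

(** There are finitely many closed elements, so near [x] only those containing [x] matter, and on
    each of them [u] agrees with a continuous function. *)
Lemma continuous_on_cover (W : normedModType R) (u : 'rV[R]_d -> W)
    (l : {set 'I_n} -> 'rV[R]_d -> W) :
  (forall K, K \in elts T -> continuous (l K)) ->
  (forall K x, K \in elts T -> simplex K x -> u x = l K x) ->
  {within closure Om, continuous u}.
Proof.
move=> cl ul; apply/subspace_continuousP => x Ox; apply/cvgrPdist_lt => e e0.
rewrite near_withinE.
have H K : \forall y \near x, K \in elts T -> simplex K y -> `|u x - u y| < e.
  have [KT|nKT] := boolP (K \in elts T); last by near=> y.
  have [Kx|nKx] := pselect (simplex K x).
    have := cl K KT x => /cvgrPdist_lt /(_ e e0); apply: filterS => y + _ Ky.
    by rewrite (ul K x) // (ul K y).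
  have : nbhs x (~` simplex K).
    by apply: open_nbhs_nbhs; split => //; apply: closed_openC; exact: (simplex_closed HT).
  by apply: filterS => y nKy _ Ky.
apply: (@filterS _ (nbhs x) _ _ _ _ (@filter_forall _ _ _ (nbhs x) _ H)) => y Hy /closure_simplex[K KT Ky].
exact: Hy Ky.
Unshelve. all: by end_near. Qed.

(** A concrete nodal basis function, witnessing that the choice in [hat] is not the default one. By
    conformity the element picked is immaterial. *)
Definition hatf (z : 'I_n) x : R :=
  if [pick K | (K \in elts T) && `[< simplex K x >]] is Some K then bary K x z else 0.

Lemma hatfE K x z : K \in elts T -> simplex K x -> hatf z x = bary K x z.
Proof.
move=> KT Kx; rewrite /hatf; case: pickP => [L /andP[LT /asboolP Lx]|/(_ K)].
  by rewrite (barycentric_conforming HT LT KT (baryP Lx) (baryP Kx)).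
by rewrite KT /= => /negbT/asboolPn.
Qed.

Lemma bary_convex K x y (t : R) : K \in elts T -> simplex K x -> simplex K y -> 0 <= t <= 1 ->
  forall z, bary K (t *: x + (1 - t) *: y) z = t * bary K x z + (1 - t) * bary K y z.
Proof.
move=> KT Kx Ky t01 z.
by rewrite (bary_eq HT KT (barycentric_convex t01 (baryP Kx) (baryP Ky))).
Qed.

Lemma simplex_convex K x y (t : R) : simplex K x -> simplex K y -> 0 <= t <= 1 ->
  simplex K (t *: x + (1 - t) *: y).
Proof.
move=> Kx Ky t01; apply: barycentric_simplex.
exact: (barycentric_convex t01 (baryP Kx) (baryP Ky)).
Qed.

Lemma P1_hatf z : P1 Om T (hatf z : 'rV[R]_d -> R^o).
Proof.
split.
- have H K : exists l : 'rV[R]_d -> R^o, K \in elts T ->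
      continuous l /\ forall x, simplex K x -> hatf z x = l x.
    have [KT|nKT] := boolP (K \in elts T); last by exists (fun=> 0).
    have [c [B HB]] := bary_affine HT KT.
    exists (fun x => c z + \sum_k x 0 k * B k z) => _; split.
      by apply: elementary_continuous; exact: elementary_affine.
    by move=> x Kx; rewrite (hatfE _ KT Kx) HB.
  have [l Hl] := choice H.
  by apply: (@continuous_on_cover R^o _ l) => [K KT|K x KT]; have [] := Hl K KT => // _; apply.
- move=> K KT x y t Kx Ky t01.
  rewrite !(hatfE _ KT) //; last exact: simplex_convex.
  exact: bary_convex.
- move=> x nOx; rewrite /hatf; case: pickP => // K /andP[KT /asboolP Kx].
  by case: nOx; exact: simplex_sub_closure Kx.
Qed.

Lemma hatf_vert z z' : hatf z (vert z') = (z' == z)%:R.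
Proof.
have [K KT z'K] := vert_used HT z'.
rewrite (hatfE _ KT); last exact: simplex_vert.
by rewrite (bary_eq HT KT (barycentric_vert z'K)) eq_sym.
Qed.

Lemma hatP z : P1 Om T (hat Om z : 'rV[R]_d -> R^o) /\
  forall z' : 'I_n, hat Om z (vert z') = (z' == z)%:R.
Proof.
apply: (@xgetPex _ (fun=> 0) [set phi : 'rV[R]_d -> R |
    P1 Om T (phi : 'rV[R]_d -> R^o) /\ forall z' : 'I_n, phi (vert z') = (z' == z)%:R]).
by exists (hatf z); split; [exact: P1_hatf|exact: hatf_vert].
Qed.

(** [affine_on] speaks of two points only, so one vertex is split off at a time and the other
    weights are renormalised by [1 - w i]; the induction is on the number of nonzero weights. *)
Lemma affine_on_barycentric (W : lmodType R) K (u : 'rV[R]_d -> W) x w :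
  affine_on (simplex K) u -> barycentric K x w -> u x = \sum_i w i *: u (vert i).
Proof.
move=> au; have [m wm] := ubnP #|[pred i | w i != 0]|.
elim: m x w wm => // m IH x w wm [w0 wK w1 xw].
have [i wi0] : exists i, w i != 0.
  apply: contrapT => /forallNP H.
  have : \sum_i w i = 0 by apply: big1 => i _; have /negP/negbNE/eqP := H i.
  by rewrite w1 => /eqP; rewrite oner_eq0.
have iK : i \in K by apply: contraNT wi0 => /wK ->.
have wi1 : w i <= 1 by rewrite -w1 (bigD1 i) //= lerDl sumr_ge0.
have rest : \sum_(k | k != i) w k = 1 - w i by apply/eqP; rewrite eq_sym subr_eq -w1 (bigD1 i) //= addrC.
have [E|ne] := eqVneq (w i) 1.
  have z k : k != i -> w k = 0.
    move=> ki; have := psumr_eq0P (fun k _ => w0 k) (etrans rest _).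
    by rewrite E subrr => /(_ erefl k ki).
  rewrite xw (bigD1 i) //= [in RHS](bigD1 i) //= !big1 ?addr0.
  - by rewrite E !scale1r.
  - by move=> k ki; rewrite z // scale0r.
  - by move=> k ki; rewrite z // scale0r.
have lt1 : 0 < 1 - w i by rewrite subr_gt0 lt_neqAle ne.
pose w' k := if k == i then 0 else w k / (1 - w i).
have w'K : barycentric K (\sum_k w' k *: vert k) w'.
  split => //.
  - by move=> k; rewrite /w'; case: ifP => // _; rewrite divr_ge0 // ltW.
  - by move=> k kK; rewrite /w' wK // mul0r if_same.
  - rewrite (bigD1 i) //= /w' eqxx add0r.
    rewrite (eq_bigr (fun k => w k / (1 - w i))); last by move=> k /negbTE ->.
    by rewrite -mulr_suml rest divff // gt_eqF.
have E (V : lmodType R) (f : 'I_n -> V) :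
    \sum_k w k *: f k = w i *: f i + (1 - w i) *: \sum_k w' k *: f k.
  rewrite (bigD1 i) //=; congr (_ + _).
  rewrite [in RHS](bigD1 i) //= /w' eqxx scale0r add0r scaler_sumr.
  apply: eq_bigr => k /negbTE ->; rewrite scalerA mulrCA divff ?mulr1 //.
  by rewrite gt_eqF.
rewrite xw (E _ (fun k => vert k : 'rV[R]_d)) (E _ (fun k => u (vert k))) au.
- rewrite (IH (\sum_k w' k *: vert k) w') //.
  rewrite -ltnS; apply: leq_trans wm; rewrite ltnS; apply: proper_card; apply/properP; split.
    apply/fintype.subsetP => k; rewrite !inE /w'; have [->|_] := eqVneq k i; first by rewrite eqxx.
    by apply: contraNneq => ->; rewrite mul0r.
  by exists i => //; rewrite inE /= /w' eqxx negbK.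
- exact: simplex_vert.
- exact: barycentric_simplex w'K.
- by rewrite w0.
Qed.

Lemma P1_barycentric (W : normedModType R) K (u : 'rV[R]_d -> W) x w : P1 Om T u ->
  K \in elts T -> barycentric K x w -> u x = \sum_i w i *: u (vert i).
Proof. by move=> [_ + _] KT; move=> /(_ K KT); exact: affine_on_barycentric. Qed.

Lemma hat_bary K x z : K \in elts T -> simplex K x -> hat Om z x = bary K x z.
Proof.
move=> KT Kx; have [P1z nz] := hatP z.
rewrite (P1_barycentric P1z KT (baryP Kx)) (bigD1 z) //= nz eqxx big1 ?addr0.
  by rewrite /GRing.scale /= mulr1.
by move=> i /negbTE iz; rewrite nz iz scaler0.
Qed.

Lemma hat_out x z : ~ closure Om x -> hat Om z x = 0.
Proof. by have [[_ _ H] _] := hatP z; exact: H. Qed.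

Lemma hat_ge0 x z : 0 <= hat Om z x.
Proof.
have [Ox|nOx] := pselect (closure Om x); last by rewrite hat_out.
have [K KT Kx] := closure_simplex Ox.
by rewrite (hat_bary _ KT Kx); have [] := baryP Kx.
Qed.

Lemma sum_hat x : closure Om x -> \sum_(z < n) hat Om z x = 1.
Proof.
move=> /closure_simplex[K KT Kx].
by under eq_bigr do rewrite (hat_bary _ KT Kx); have [] := baryP Kx.
Qed.

Lemma hat_le1 x z : hat Om z x <= 1.
Proof.
have [Ox|nOx] := pselect (closure Om x); last by rewrite hat_out.
rewrite -(sum_hat Ox) (bigD1 z) //= lerDl sumr_ge0 // => *; exact: hat_ge0.
Qed.

Lemma P1_expand (W : normedModType R) (u : 'rV[R]_d -> W) x : P1 Om T u ->
  u x = \sum_(z < n) hat Om z x *: u (vert z).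
Proof.
move=> Pu; have [Ox|nOx] := pselect (closure Om x); last first.
  have [_ _ ->//] := Pu; rewrite big1 // => z _; by rewrite hat_out // scale0r.
have [K KT Kx] := closure_simplex Ox.
rewrite (P1_barycentric Pu KT (baryP Kx)).
by apply: eq_bigr => z _; rewrite (hat_bary _ KT Kx).
Qed.

Lemma P1_linear (W : normedModType R) (u v : 'rV[R]_d -> W) (c : R) : P1 Om T u -> P1 Om T v ->
  P1 Om T (fun x => u x + c *: v x).
Proof.
move=> [cu au u0] [cv av v0]; split.
- exact: within_continuousD.
- move=> K KT x y t Kx Ky t01; rewrite (au K KT) // (av K KT) //.
  rewrite !scalerDr !scalerA addrACA; congr (_ + _).
  1,2: by rewrite [c * _]mulrC.
- by move=> x nx; rewrite u0 // v0 // scaler0 addr0.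
Qed.

Lemma P1_0 (W : normedModType R) : P1 Om T (fun=> 0 : W).
Proof.
split => //.
- by move=> x; exact: cvg_cst.
- by move=> K _ x y t _ _ _; rewrite !scaler0 addr0.
Qed.

Lemma P1_hat_scale (W : normedModType R) z (a : W) : P1 Om T (fun x => hat Om z x *: a).
Proof.
have [[cz az z0] _] := hatP z; split.
- exact: within_continuousZ.
- move=> K KT x y t Kx Ky t01; rewrite (az K KT) //.
  by rewrite -[LHS]/((t * hat Om z x + (1 - t) * hat Om z y) *: a) scalerDl !scalerA.
- by move=> x nx; rewrite z0 // scale0r.
Qed.

Lemma P1_sum (W : normedModType R) I (r : seq I) (F : I -> 'rV[R]_d -> W) :
  (forall i, P1 Om T (F i)) -> P1 Om T (fun x => \sum_(i <- r) F i x).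
Proof.
move=> PF; elim: r => [|i r IH].
  by under eq_fun do rewrite big_nil; exact: P1_0.
under eq_fun do rewrite big_cons; have := P1_linear 1 (PF i) IH.
by under eq_fun do rewrite scale1r.
Qed.

Lemma P1_interp v : Vh Om T (interp Om T v).
Proof. by apply: P1_sum => z; exact: P1_hat_scale. Qed.

Lemma interp_vert v z : interp Om T v (vert z) = v (vert z).
Proof.
rewrite /interp (bigD1 z) //= (hatP z).2 eqxx scale1r big1 ?addr0 // => i iz.
by rewrite (hatP i).2 eq_sym (negbTE iz) scale0r.
Qed.

Lemma P1_comp v (c : 'I_3) : Vh Om T v -> P1 Om T (Defs.comp c v : 'rV[R]_d -> R^o).
Proof.
move=> [cv av v0]; split.
- move=> x; apply: (@cvg_comp _ _ _ _ (fun M : 'rV[R]_3 => M 0 c) _ _ _ (cv x)).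
  exact: coord_continuous.
- by move=> K KT x y t Kx Ky t01; rewrite /Defs.comp (av K KT) // !mxE.
- by move=> x nx; rewrite /Defs.comp v0 // mxE.
Qed.

End HatFunctions.

(** Follow a set [C i] containing [a] up to the last point [s] of the interval lying in it. Beyond
    [s] this set never recurs, so the induction continues from [s] with one set fewer, however often
    the path enters and leaves [C i] before [s]. *)
Lemma lipschitz_on_cover (R : realType) (I : finType) (C : I -> set R) (f : R -> R) (L b : R)
    (A : {set I}) (a : R) : (forall i, closed (C i)) -> a <= b ->
  (forall t, a <= t <= b -> exists2 i, i \in A & C i t) ->
  (forall i s t, a <= s -> s <= t -> t <= b -> C i s -> C i t -> `|f t - f s| <= L * (t - s)) ->
  `|f b - f a| <= L * (b - a).
Proof.
move=> cC; have [m] := ubnP #|A|; elim: m A a => // m IH A a Am ab cov lip.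
have [i iA Cia] : exists2 i, i \in A & C i a by apply: cov; rewrite lexx.
pose S := C i `&` `[a, b]%classic.
have Sa : S a by split => //=; rewrite in_itv /= lexx.
have supS : has_sup S by split; [exists a|exists b => x [_]; rewrite /= in_itv /= => /andP[]].
have cS : closed S by apply: closedI => //; exact: interval_closed.
pose s := sup S.
have [Cis /andP[as_ sb]] : C i s /\ a <= s <= b.
  have [] : S s by rewrite [S](closure_id S).1 //; have [h1 h2] := supS; exact: closure_sup.
  by rewrite /= in_itv.
have fas : `|f s - f a| <= L * (s - a) by exact: lip Cia Cis.
move: sb; rewrite le_eqVlt => /orP[/eqP <- //|sb].
have cov' t : s < t <= b -> exists2 k, k \in A :\ i & C k t.
  move=> /andP[st tb]; have at_ : a <= t by rewrite (le_trans as_) // ltW.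
  have [k kA Ckt] := cov t (introT andP (conj at_ tb)).
  exists k => //; rewrite !inE kA andbT; apply/eqP => ki.
  have : t <= s by apply: sup_upper_bound => //; split; rewrite /= ?in_itv /= -?ki ?at_ ?tb.
  by rewrite leNgt st.
(* The point [s] itself is covered by the remaining sets: their union is closed and contains points
   arbitrarily close to [s] on its right. *)
have cov'' t : s <= t <= b -> exists2 k, k \in A :\ i & C k t.
  move=> /andP[]; rewrite le_eqVlt => /orP[/eqP <- _|st tb]; last by apply: cov'; rewrite st.
  have cD : closed (\bigcup_(k in [set` A :\ i]) C k) by apply: closed_bigcup.
  have : closure (\bigcup_(k in [set` A :\ i]) C k) s.
    move=> B /nbhs_ballP[e /= e0 sB].
    pose t0 := Num.min b (s + e / 2).
    have st0 : s < t0 by rewrite lt_min sb ltrDl divr_gt0.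
    have [k kA Ckt] : exists2 k, k \in A :\ i & C k t0 by apply: cov'; rewrite st0 ge_min lexx.
    exists t0; split; first by exists k.
    apply: sB; rewrite /ball /= distrC ger0_norm ?subr_ge0 ?(ltW st0) // ltrBlDl.
    by rewrite gt_min; apply/orP; right; rewrite ltrD2l gtr_pMr // invf_lt1 // ltr1n.
  by rewrite -(closure_id _).1 // => -[k kA Ckt]; exists k.
have : `|f b - f s| <= L * (b - s).
  apply: (IH (A :\ i)).
  - by move: Am; rewrite (cardsD1 i) iA.
  - exact: ltW.
  - exact: cov''.
  - move=> k u t su; apply: lip; exact: le_trans su.
have -> : f b - f a = (f b - f s) + (f s - f a) by ring.
by move=> h; rewrite (le_trans (ler_normD _ _)) //; lra.
Qed.

(** * Convexity of the domain and interiors of elements *)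

Section MeshGeometry.
Context {R : realType} {d : nat} (Om : set 'rV[R]_d) (T : mesh R d).
Hypothesis d_gt0 : (0 < d)%N.
Hypothesis HT : triangulation Om T.
Hypotheses (oOm : open Om) (bOm : bounded_set Om) (pOm : polytopal Om) (neOm : Om !=set0).
Local Notation n := (nvert T).
Local Notation e j := (delta_mx 0 j : 'rV[R]_d).
Implicit Types (K L : {set 'I_n}) (x y : 'rV[R]_d) (w : 'I_n -> R) (z : 'I_n).

Lemma dot_comb (a x y : 'rV[R]_d) (s t : R) :
  dot a (s *: x + t *: y) = s * dot a x + t * dot a y.
Proof.
rewrite /dot !mulr_sumr -big_split /=; apply: eq_bigr => i _.
by rewrite !mxE; ring.
Qed.

(** Each defining half-space inequality is weak at [x] and strict at [y], hence strict at every
    combination giving [y] a positive weight. *)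
Lemma half_segment x y (s : R) : closure Om x -> Om y -> 0 < s <= 1 ->
  Om ((1 - s) *: x + s *: y).
Proof.
have [m [a [b OmE]]] := pOm.
move=> clx Oy /andP[s0 s1].
have ax i : dot (a i) x <= b i.
  have cl : closed [set x | dot (a i) x <= b i].
    have ed : elementary (dot (a i)).
      apply: (@elementary_sum _ _ _ _ (fun k (x : 'rV[R]_d) => a i 0 k * x 0 k)) => k.
      exact: (elementary_mul (@elementary_cst _ _ (a i 0 k)) (elementary_coord k)).
    by have /continuous_closedP /(_ _ (@closed_le _ (b i))) := elementary_continuous ed.
  have : closure [set x | dot (a i) x <= b i] x.
    apply: closure_subset clx => u; rewrite OmE /= => /(_ i); exact: ltW.
  by rewrite -(closure_id _).1.
move: Oy; rewrite OmE /= => ay i; rewrite dot_comb.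
have := ax i; have := ay i; set p := dot _ x; set q := dot _ y => h1 h2.
have -> : b i = (1 - s) * b i + s * b i by ring.
by rewrite ler_ltD // ?ler_wpM2l ?subr_ge0 // ltr_pM2l.
Qed.

Lemma obox_line (a b : 'I_d -> R) x (v : 'rV[R]_d) : obox a b x ->
  exists2 t, 0 < t & t <= 1 /\ obox a b (x + t *: v) /\ obox a b (x - t *: v).
Proof.
move=> xab; have /nbhs_ballP[r /= r0 xr] := open_nbhs_nbhs (conj (@obox_open _ _ a b) xab).
pose t := Num.min 1 (r / (2 * (`|v| + 1))).
have v1 : 0 < `|v| + 1 by rewrite ltr_wpDl.
have t0 : 0 < t by rewrite lt_min ltr01 divr_gt0 // mulr_gt0.
exists t => //; split; first by rewrite ge_min lexx.
have tv : `|t *: v| < r.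
  rewrite normrZ gtr0_norm //.
  apply: (@le_lt_trans _ _ (r / (2 * (`|v| + 1)) * (`|v| + 1))).
    apply: ler_pM => //; [exact: ltW|by rewrite ge_min lexx orbT|by rewrite lerDl].
  rewrite invfM mulrA mulfVK ?gt_eqF // ltr_pdivrMr // ltr_pMr // ltr1n //.
by split; apply: xr; rewrite -ball_normE /ball_ /= ?opprD ?addNKr ?opprK ?normrN // opprB addrC subrK.
Qed.

(** Elements cover only the closure of [Om]. Prolonging the segment from a point [x0] of [Om]
    slightly beyond [x] ends in the box, hence in the closure, and [x] lies on it strictly before
    that end. *)
Lemma obox_closure_sub (a b : 'I_d -> R) : obox a b `<=` closure Om -> obox a b `<=` Om.
Proof.
move=> sub x xab; have [x0 Ox0] := neOm.
have [t t0 [_ [/sub cx _]]] := obox_line (x - x0) xab.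
have t1 : 0 < 1 + t by rewrite ltr_wpDr // ltW.
have := half_segment (s := t / (1 + t)) cx Ox0.
rewrite divr_gt0 // ler_pdivrMr // mul1r lerDr ler01 => /(_ isT).
congr Om; apply/rowP => i; rewrite !mxE; field.
by rewrite gt_eqF.
Qed.

(** The interior of the element, encoded by positive barycentric coordinates, so that disjointness,
    measurability and convexity become statements about coordinates. *)
Definition Kint K := [set x | simplex K x /\ forall z, z \in K -> 0 < bary K x z].

(** By conformity both elements give [x] the same weights, and the vertices of positive weight of an
    interior point are exactly those of its element. *)
Lemma Kint_disjoint K L x : K \in elts T -> L \in elts T -> Kint K x -> Kint L x -> K = L.
Proof.
move=> KT LT [Kx pK] [Lx pL].
have E := barycentric_conforming HT KT LT (baryP Kx) (baryP Lx).
apply/setP => z; apply/idP/idP => h.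
  apply: contraLR (pK z h) => zL; rewrite E.
  by have [_ -> //] := baryP Lx; rewrite ltxx.
apply: contraLR (pL z h) => zK; rewrite -E.
by have [_ -> //] := baryP Kx; rewrite ltxx.
Qed.

Lemma vmeas_Kint K : K \in elts T -> vmeas (Kint K).
Proof.
move=> KT; have [c [B HB]] := bary_affine HT KT.
pose lam z x := c z + \sum_k x 0 k * B k z.
have -> : Kint K = simplex K `&` \bigcap_(z in [set` K]) [set x | 0 < lam z x].
  apply/seteqP; split => x.
    by move=> [Kx pK]; split => // z zK /=; rewrite /lam -HB //; exact: pK.
  by move=> [Kx pK]; split => // z zK; rewrite HB //; exact: (pK z zK).
apply: vmeasI; first by apply: vmeas_closed => //; exact: (simplex_closed HT).
rewrite /vmeas preimage_bigcap; apply: fin_bigcap_measurable => // z zK.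
apply: measurable_open => //.
have /continuousP /(_ _ (@open_gt _ 0)) := elementary_continuous (elementary_affine (c z) (B ^~ z)).
exact.
Qed.

(** [x] is the midpoint of two points of the box, one of them displaced towards the vertex [z] by a
    fraction [t]. The coordinate of [z] is at least [t] there and nonnegative at the other point. *)
Lemma obox_Kint K (a b : 'I_d -> R) : K \in elts T -> obox a b `<=` simplex K ->
  obox a b `<=` Kint K.
Proof.
move=> KT sub x xab; have Kx := sub x xab; split => // z zK.
have [t t0 [t1 [/sub Kp /sub Kq]]] := obox_line (vert z - x) xab.
have Ez : bary K (x + t *: (vert z - x)) z = t + (1 - t) * bary K x z.
  have -> : x + t *: (vert z - x) = t *: vert z + (1 - t) *: x.
    by apply/rowP => i; rewrite !mxE; ring.
  rewrite (bary_convex HT) //; last by rewrite ltW.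
    by rewrite (bary_eq HT KT (barycentric_vert zK)) eqxx mulr1.
  exact: simplex_vert.
have Ex : bary K x z = 2^-1 * bary K (x + t *: (vert z - x)) z +
    (1 - 2^-1) * bary K (x - t *: (vert z - x)) z.
  rewrite -(bary_convex HT) //; last by rewrite invr_ge0 ler0n invf_le1 // ler1n.
  by congr (bary K _ z); apply/rowP => i; rewrite !mxE; field.
have [p0 _ _ _] := baryP Kx; have [q0 _ _ _] := baryP Kq.
rewrite Ex Ez; have := p0 z; have := q0 z; nra.
Qed.

(** Keeps boxes that are contracted towards a vertex of [K] inside the interior of [K]. *)
Lemma Kint_segment K x y (s : R) : K \in elts T -> simplex K x -> Kint K y -> 0 < s <= 1 ->
  Kint K ((1 - s) *: x + s *: y).
Proof.
move=> KT Kx [Ky py] /andP[s0 s1]; have E : s = 1 - (1 - s) by ring.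
have s01 : 0 <= 1 - s <= 1 by rewrite subr_ge0 s1 gerBl ltW.
split; first by rewrite {2}E; exact: simplex_convex.
move=> z zK; rewrite {2}E (bary_convex HT) // -E.
have [p0 _ _ _] := baryP Kx; have := p0 z; have := py z zK.
move=> h1 h2; rewrite ltr_wpDl // ?mulr_gt0 // mulr_ge0 //.
by case/andP: s01.
Qed.

End MeshGeometry.

(** * Weak derivatives of finite element functions *)

Section WeakDerivP1.
Context {R : realType} {d : nat} (Om : set 'rV[R]_d) (T : mesh R d).
Hypothesis d_gt0 : (0 < d)%N.
Hypothesis HT : triangulation Om T.
Hypotheses (oOm : open Om) (bOm : bounded_set Om) (pOm : polytopal Om).
Local Notation n := (nvert T).
Local Notation e j := (delta_mx 0 j : 'rV[R]_d).
Local Notation del m := ((m.+1%:R)^-1 : R).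
Implicit Types (K L : {set 'I_n}) (x y : 'rV[R]_d) (z : 'I_n).
Implicit Types (u : 'rV[R]_d -> R^o).

(** [G K j] is the constant partial derivative on [K], read off from the affine barycentric
    coordinates. Stating it through increments covers boundary points of the element as well. *)
Lemma P1_slopes u : P1 Om T u -> exists G : {set 'I_n} -> 'I_d -> R,
  forall K j x (t : R), K \in elts T -> simplex K x -> simplex K (x + t *: e j) ->
    u (x + t *: e j) - u x = t * G K j.
Proof.
move=> Pu.
have H K : exists G : 'I_d -> R, K \in elts T -> forall j x (t : R),
    simplex K x -> simplex K (x + t *: e j) -> u (x + t *: e j) - u x = t * G j.
  have [KT|nKT] := boolP (K \in elts T); last by exists (fun=> 0).
  have [c [B HB]] := bary_affine HT KT.
  exists (fun k => \sum_(z < n) B k z * u (vert z)) => _ j x t Kx Kxt.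
  rewrite (P1_barycentric Pu KT (baryP Kx)) (P1_barycentric Pu KT (baryP Kxt)).
  rewrite -sumrB mulr_sumr; apply: eq_bigr => z _.
  rewrite !HB // -scalerBl /GRing.scale /= mulrA; congr (_ * _).
  rewrite opprD addrACA subrr add0r -sumrB (bigD1 j) //= big1 ?addr0.
    by rewrite !mxE !eqxx mulr1; ring.
  by move=> k /negbTE kj; rewrite !mxE kj andbF mulr0 addr0 subrr.
have [G HG] := choice H.
by exists G => K j x t KT; exact: HG.
Qed.

Lemma P1_bounded u : P1 Om T u -> exists2 M, 0 <= M & forall x, `|u x| <= M.
Proof.
move=> Pu; exists (\sum_(z < n) `|u (vert z)|); first exact: sumr_ge0.
move=> x; rewrite (P1_expand HT x Pu); apply: le_trans (ler_norm_sum _ _ _) _.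
apply: ler_sum => z _; rewrite /GRing.scale /= normrM ger0_norm ?(hat_ge0 HT) //.
by rewrite ler_piMl // (hat_le1 HT).
Qed.

Lemma P1_vmfun u : P1 Om T u -> vmfun Om u.
Proof.
move=> [cu _ _]; apply: (@vmfunS _ _ _ (closure Om)).
- by apply: vmeas_closed => //; exact: closed_closure.
- exact: subset_closure.
- by apply: vmfun_continuous => //; apply: vmeas_closed => //; exact: closed_closure.
Qed.

Lemma line_continuous x (v : 'rV[R]_d) : continuous (fun s : R => x + s *: v).
Proof.
move=> s; apply: (@cvgD _ _ _ _ _ (fun=> x) (fun s : R => s *: v)); first exact: cvg_cst.
by apply: (@cvgZr_tmp _ _ _ (nbhs s) _ id s v); exact: cvg_id.
Qed.

Variables (u : 'rV[R]_d -> R^o) (G : {set 'I_n} -> 'I_d -> R).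
Hypothesis Pu : P1 Om T u.
Hypothesis HG : forall K j x (t : R), K \in elts T -> simplex K x -> simplex K (x + t *: e j) ->
    u (x + t *: e j) - u x = t * G K j.

(** By convexity the segment stays in [Om], where finitely many closed elements cover it. The sum of
    all slopes is a crude constant, but only its finiteness matters. *)
Lemma P1_lipschitz j x (t : R) : Om x -> 0 < t -> Om (x + t *: e j) ->
  `|u (x + t *: e j) - u x| <= (\sum_(K in elts T) `|G K j|) * t.
Proof.
move=> Ox t0 Oxt.
pose C K := if K \in elts T then [set s : R | simplex K (x + s *: e j)] else set0.
have := @lipschitz_on_cover R {set 'I_n} C (fun s => u (x + s *: e j))
  (\sum_(K in elts T) `|G K j|) t (elts T) 0.
rewrite scale0r addr0 subr0; apply.
- move=> K; rewrite /C; case: ifPn => KT; last exact: closed0.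
  have /continuous_closedP cl := @line_continuous x (e j).
  by apply: cl; exact: (simplex_closed HT).
- exact: ltW.
- move=> s /andP[s0 st].
  have : closure Om (x + s *: e j).
    move: s0; rewrite le_eqVlt => /orP[/eqP <-|s0].
      by rewrite scale0r addr0; exact: subset_closure.
    apply: subset_closure; have := @half_segment R d Om pOm x (x + t *: e j) (s / t).
    rewrite divr_gt0 //= ler_pdivrMr // mul1r => /(_ (subset_closure Ox) Oxt st).
    congr Om; apply/rowP => i; rewrite !mxE; field; by rewrite gt_eqF.
  by move=> /(closure_simplex HT)[K KT Ks]; exists K => //; rewrite /C KT.
- move=> K s s' s0 ss' st; rewrite /C; case: ifPn => // KT Ks Ks'.
  have E : x + s' *: e j = (x + s *: e j) + (s' - s) *: e j.
    by apply/rowP => i; rewrite !mxE; ring.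
  have Ks'' : simplex K ((x + s *: e j) + (s' - s) *: e j) by rewrite -E.
  rewrite E (HG KT Ks Ks'') normrM ger0_norm ?subr_ge0 // mulrC.
  rewrite ler_wpM2r ?subr_ge0 // (bigD1 K) //= lerDl sumr_ge0 //.
Qed.

(* Some element contains [x + e_j / (m + 1)] for infinitely many [m], hence for all [m] by
   convexity; the one-sided derivative therefore exists at every point. *)
Lemma P1_onesided j x : Om x -> exists2 K, K \in elts T & simplex K x /\
  (fun m => m.+1%:R * (u (x + del m *: e j) - u x)) @ \oo --> G K j.
Proof.
move=> Ox.
have [K KT Kinf] : exists2 K, K \in elts T &
    forall N, exists2 m, (N <= m)%N & simplex K (x + del m *: e j).
  apply: contrapT => /forall2NP H.
  have H' K : exists N, K \in elts T -> forall m, (N <= m)%N -> ~ simplex K (x + del m *: e j).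
    have [nKT|/existsNP[N HN]] := H K; first by exists 0%N => /nKT.
    by exists N => _ m Nm Km; apply: HN; exists m.
  have [N HN] := choice H'.
  have [N0 _ HN0] := near_step j oOm Ox.
  pose m := maxn N0 (\max_K N K).
  have /(subset_closure)/(closure_simplex HT)[K KT Km] : Om (x + del m *: e j).
    by apply: HN0; exact: leq_maxl.
  apply: (HN K KT m _ Km); apply: leq_trans (leq_maxr _ _).
  exact: (leq_bigmax K).
have Kx : simplex K x.
  have cK := simplex_closed HT KT.
  rewrite ((closure_id _).1 cK) => B Bx.
  have [N _ HN] := cvg_step j Bx; have [m Nm Km] := Kinf N.
  by exists (x + del m *: e j); split => //; exact: HN.
exists K => //; split => //.
have [m0 _ Km0] := Kinf 0%N.
apply: cvg_near_cst; exists m0 => // m /= m0m.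
have m1 : 0 < m.+1%:R :> R by [].
have m2 : 0 < m0.+1%:R :> R by [].
have Km : simplex K (x + del m *: e j).
  have -> : x + del m *: e j = (m0.+1%:R / m.+1%:R) *: (x + del m0 *: e j) +
     (1 - m0.+1%:R / m.+1%:R) *: x.
    by apply/rowP => i; rewrite !mxE; field; rewrite !gt_eqF.
  apply: simplex_convex => //; rewrite divr_ge0 //= ler_pdivrMr // mul1r ler_nat ltnS //.
by rewrite (HG KT Kx Km) mulrA divff ?mul1r // gt_eqF.
Qed.

(** On a face shared by several elements, [g] takes the slope of an element entered in direction
    [e_j]. Some element containing [x] is recorded for every point, so no face has to be discarded
    as a null set. *)
Lemma P1_weak_deriv j : exists g, [/\ is_weak_deriv Om [:: j] u g, vmfun Om g
  & forall x, Om x -> exists2 K, K \in elts T & simplex K x /\ g x = G K j].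
Proof.
have H x : exists K, Om x -> K \in elts T /\ simplex K x /\
    (fun m => m.+1%:R * (u (x + del m *: e j) - u x)) @ \oo --> G K j.
  have [Ox|nOx] := pselect (Om x); last by exists finset.set0.
  by have [K KT [Kx cK]] := P1_onesided j Ox; exists K.
have [k Hk] := choice H; exists (fun x => G (k x) j).
have [M _ HM] := P1_bounded Pu.
have cG x : Om x -> (fun m => m.+1%:R * (u (x + del m *: e j) - u x)) @ \oo --> G (k x) j.
  by move=> Ox; have [_ []] := Hk x Ox.
split.
- apply: (@difference_quotient_weak_deriv _ _ d_gt0 Om u _ j M _ oOm bOm (P1_vmfun Pu)) => //.
  by move=> x t; exact: P1_lipschitz.
- exact: (@difference_quotient_vmfun _ _ d_gt0 Om u _ j M oOm bOm (P1_vmfun Pu)).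
- by move=> x Ox; have [KT [Kx _]] := Hk x Ox; exists (k x).
Qed.

(** The segment of length [r / 2] from [c] in direction [e_j] stays in the box, and [u] varies along
    it by at most [2 * M]. *)
Lemma slope_bound K j (c : 'rV[R]_d) (r kappa M : R) : K \in elts T -> 0 < r ->
  obox (fun i => c 0 i - r) (fun i => c 0 i + r) `<=` simplex K ->
  (forall x, simplex K x -> `|u x - kappa| <= M) -> `|G K j| <= 4 * M / r.
Proof.
move=> KT r0 sub uM.
have Kc : simplex K c by apply: sub => i; rewrite ltrBlDr ltrDl r0.
have Kc' : simplex K (c + (r / 2) *: e j).
  apply: sub => i; rewrite !mxE eqxx /=.
  case: eqP => _; rewrite ?mulr1 ?mulr0 ?addr0; last by rewrite ltrBlDr ltrDl r0.
  by apply/andP; split; lra.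
have := HG KT Kc Kc'; have := uM _ Kc; have := uM _ Kc'.
rewrite ler_pdivlMr // => h1 h2 E.
have : `|r / 2 * G K j| <= 2 * M.
  rewrite -E; have -> : u (c + (r / 2) *: e j) - u c = (u (c + (r / 2) *: e j) - kappa) - (u c - kappa).
    by rewrite opprB addrA subrK.
  by rewrite (le_trans (ler_normB _ _)) //; lra.
rewrite normrM ger0_norm ?divr_ge0 ?(ltW r0) //; lra.
Qed.

End WeakDerivP1.

(** * Inner boxes from shape regularity *)

Section ShapeRegularity.
Context {R : realType} {d : nat}.
Implicit Types (x y : 'rV[R]_d).

Lemma coord_le_enorm x i : `|x 0 i| <= enorm x.
Proof.
rewrite -sqrtr_sqr /enorm ler_wsqrtr // /dot (bigD1 i) //= expr2 lerDl.
by apply: sumr_ge0 => k _; rewrite -expr2 sqr_ge0.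
Qed.

(** The Euclidean norm is at most [sqrt d] times the sup norm, and [sqrt 3 < 2]. *)
Lemma enorm_lt x (r : R) : (d <= 3)%N -> (forall i, `|x 0 i| <= r) -> 0 < r -> enorm x < 2 * r.
Proof.
move=> d3 xr r0; rewrite /enorm.
have -> : 2 * r = Num.sqrt ((2 * r) ^+ 2) by rewrite sqrtr_sqr ger0_norm // mulr_ge0 // ltW.
rewrite ltr_sqrt; last by rewrite exprn_gt0 // mulr_gt0.
apply: (@le_lt_trans _ _ (\sum_(i < d) r ^+ 2)).
  by apply: ler_sum => i _; rewrite -expr2 -[_ ^+ 2]ger0_norm ?sqr_ge0 // normrX lerXn2r ?nnegrE // ltW.
have dr : d%:R <= 3 :> R by rewrite ler_nat.
by rewrite sumr_const card_ord -mulr_natr; have := exprn_gt0 2 r0; nra.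
Qed.

(** Boxes replace balls because their volume is explicit. A ball of diameter [r], more than half of
    the inball diameter, lies in the element and contains the box of half-width [r / 8], whose
    points are at Euclidean distance less than [r / 4] from the center. The element has diameter at
    most [2 * |sigma| * r], which is [16 * |sigma|] half-widths; the 1 keeps the constant
    positive. *)
Lemma shape_regular_box (Om : set 'rV[R]_d) (T : mesh R d) (sigma : R) K : (1 <= d <= 3)%N ->
  bounded_set Om -> triangulation Om T -> K \in elts T ->
  diameter (simplex K) <= sigma * inball_diameter (simplex K) ->
  exists c : 'rV[R]_d, exists2 r, 0 < r & obox (fun i => c 0 i - r) (fun i => c 0 i + r) `<=` simplex K /\
    forall x y, simplex K x -> simplex K y -> forall i, `|x 0 i - y 0 i| <= (16 * `|sigma| + 1) * r.
Proof.
move=> /andP[d1 d3] [M [_ bM]] HT KT sr.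
have bK x : simplex K x -> `|x| <= `|M| + 1.
  move=> /(simplex_sub_closure HT KT) clx.
  have : closure (cbox (fun=> - (`|M| + 1)) (fun=> `|M| + 1)) x.
    apply: closure_subset clx => y Oy i; rewrite -ler_norml.
    apply: le_trans (coord_le_norm _ _) _; apply: bM Oy.
    by rewrite (le_lt_trans (ler_norm _)) // ltrDl.
  rewrite -((closure_id _).1 (@cbox_closed _ _ _ _)) => cx.
  by apply: norm_le_coord => [|i]; rewrite ?addr_ge0 // ler_norml.
pose D := [set r | exists x y, [/\ simplex K x, simplex K y & r = enorm (x - y)]].
have diamP x y : simplex K x -> simplex K y -> enorm (x - y) <= diameter (simplex K).
  move=> Kx Ky; apply: sup_upper_bound; last by exists x, y.
  split; first by exists (enorm (x - y)), x, y.
  exists (2 * (2 * (`|M| + 1))) => _ [p [q [Kp Kq ->]]]; apply: ltW; apply: enorm_lt => //.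
    move=> i; apply: le_trans (coord_le_norm _ _) _.
    by apply: le_trans (ler_normB _ _) _; have := bK p Kp; have := bK q Kq; lra.
have diam_gt0 : 0 < diameter (simplex K).
  have /card_gt1P[z [z' [zK z'K zz']]] : (1 < #|K|)%N by rewrite (elts_card HT KT).
  apply: lt_le_trans (diamP _ _ (simplex_vert zK) (simplex_vert z'K)).
  rewrite lt_neqAle sqrtr_ge0 andbT eq_sym; apply: contra_neqN zz' => E.
  apply: (vert_inj HT); apply/rowP => i; apply/eqP; rewrite -subr_eq0 -normr_le0.
  by have := coord_le_enorm (vert z - vert z') i; rewrite (eqP E) !mxE.
pose S := [set r | 0 <= r /\ exists x, forall y, enorm (y - x) < r / 2 -> simplex K y].
have S0 : S 0.
  by split => //; exists 0 => y; rewrite mul0r ltNge sqrtr_ge0.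
(* [sup] returns 0 on a set without supremum. The element has at least two vertices, so its diameter
   is positive and shape regularity excludes the value 0; in particular [S] is bounded. *)
have inP : 0 < inball_diameter (simplex K).
  have : inball_diameter (simplex K) != 0.
    by apply: contraTneq (lt_le_trans diam_gt0 sr) => ->; rewrite mulr0 ltxx.
  rewrite lt_def => -> /=; have [supS|nS] := pselect (has_sup S).
    exact: sup_upper_bound.
  by rewrite /inball_diameter sup_out.
have supS : has_sup S.
  by apply: contrapT => nS; move: inP; rewrite /inball_diameter sup_out // ltxx.
have [r [r0 [c Hc]] rS] := sup_adherent (divr_gt0 inP (ltr0n _ 2)) supS.
have rin : inball_diameter (simplex K) < 2 * r.
  by move: rS; rewrite -/(inball_diameter (simplex K)); lra.
have rgt0 : 0 < r by move: inP; lra.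
exists c, (r / 8); first by rewrite divr_gt0.
split.
  move=> y yc; apply: Hc; apply: (@lt_le_trans _ _ (2 * (r / 8))); last by lra.
  apply: enorm_lt => //; last by rewrite divr_gt0.
  by move=> i; have := yc i; rewrite !mxE => /andP[h1 h2]; rewrite ler_norml; apply/andP; split; lra.
move=> x y Kx Ky i.
have := coord_le_enorm (x - y) i; rewrite !mxE => h.
apply: le_trans h _; apply: le_trans (diamP _ _ Kx Ky) _; apply: le_trans sr _.
apply: (@le_trans _ _ (`|sigma| * (2 * r))).
  apply: (@le_trans _ _ (`|sigma| * inball_diameter (simplex K))).
    by rewrite ler_wpM2r ?ler_norm // ltW.
  by rewrite ler_wpM2l // ltW.
by lra.
Qed.

End ShapeRegularity.

(** * Essentially bounded functions and chosen weak derivatives *)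

Section NiceFunctions.
Context {R : realType} {d : nat} (Om : set 'rV[R]_d).
Hypothesis d_gt0 : (0 < d)%N.
Hypotheses (oOm : open Om) (bOm : bounded_set Om).
Implicit Types (u v g : 'rV[R]_d -> R).

Let mOm : vmeas Om := vmeas_open d_gt0 oOm.
Let fOm : (leb d (rvec @^-1` Om) < +oo)%E := leb_bounded bOm mOm.

Lemma vaeW (P : 'rV[R]_d -> Prop) : (forall x, Om x -> P x) -> vae Om P.
Proof. by move=> HP; apply: aeW => t; exact: HP. Qed.

Lemma vaeS (P Q : 'rV[R]_d -> Prop) : (forall x, Om x -> P x -> Q x) -> vae Om P -> vae Om Q.
Proof. by move=> PQ; rewrite /vae; apply: filterS => t HP Ot; exact: PQ (HP Ot). Qed.

Lemma vaeI (P Q : 'rV[R]_d -> Prop) : vae Om P -> vae Om Q -> vae Om (fun x => P x /\ Q x).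
Proof. by rewrite /vae => HP HQ; apply: filterS2 HP HQ => t HP HQ Ot; split; [exact: HP|exact: HQ]. Qed.

(** A class stable under sums and products, contained in the integrable functions because [Om] is
    bounded. Boundedness is asked almost everywhere only, which is all that a chosen representative
    [wpd] of a finite element function inherits. *)
Definition ess_bounded u := vmfun Om u /\ exists M, vae Om (fun x => `|u x| <= M).

Lemma ess_bounded_vintg u : ess_bounded u -> vintg Om u.
Proof.
move=> [mu' [M uM]].
apply/integrableP; split; first exact/measurable_EFinP.
apply: (@le_lt_trans _ _ (\int[leb d]_(t in rvec @^-1` Om) (`|M|%:E))%E).
  apply: ae_ge0_le_integral => //.
  - by apply: measurableT_comp => //; exact/measurable_EFinP.
  - by move: uM; rewrite /vae; apply: filterS => t H Ot /=; rewrite lee_fin (le_trans (H Ot)) // ler_norm.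
by rewrite integral_cst // lte_mul_pinfty.
Qed.

Lemma ess_boundedD u v : ess_bounded u -> ess_bounded v -> ess_bounded (fun x => u x + v x).
Proof.
move=> [mu' [M uM]] [mv [N vN]]; split; first exact: vmfunD.
exists (M + N); apply: vaeS (vaeI uM vN) => x _ [h1 h2].
by rewrite (le_trans (ler_normD _ _)) // lerD.
Qed.

Lemma ess_boundedM u v : ess_bounded u -> ess_bounded v -> ess_bounded (fun x => u x * v x).
Proof.
move=> [mu' [M uM]] [mv [N vN]]; split; first exact: vmfunM.
exists (M * N); apply: vaeS (vaeI uM vN) => x _ [h1 h2].
by rewrite normrM ler_pM.
Qed.

Lemma ess_bounded_cst c : ess_bounded (fun=> c).
Proof. by split; [exact: vmfun_cst|exists `|c|; exact: vaeW]. Qed.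

Lemma ess_boundedZ c u : ess_bounded u -> ess_bounded (fun x => c * u x).
Proof. exact: ess_boundedM (ess_bounded_cst c). Qed.

(** [Om] is a countable union of compact boxes, and measurability can be tested on each of them. *)
Lemma loc_integrable_vmfun u : loc_integrable Om u -> vmfun Om u.
Proof.
move=> iu; have [a [b [sub cov]]] := open_box_cover d_gt0 oOm.
have E : rvec @^-1` Om = \bigcup_k (rvec @^-1` (cbox (a k) (b k))) :> set (d.-tuple (measurableTypeR R)).
  apply/seteqP; split => t /=; first by move=> /cov[k /obox_cbox tk]; exists k.
  by move=> [k _]; exact: sub.
have mc k : vmeas (cbox (a k) (b k)) by apply: vmeas_closed => //; exact: cbox_closed.
rewrite /vmfun E; apply/measurable_fun_bigcup => // k.
exact: (vintg_vmfun (iu _ (@cbox_compact _ _ _ _) (sub k))).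
Qed.

Lemma wpdP j u g : is_weak_deriv Om [:: j] u g -> is_weak_deriv Om [:: j] u (wpd Om j u).
Proof. by move=> wg; apply: (@xgetPex _ (fun=> 0) [set g | is_weak_deriv Om [:: j] u g]); exists g. Qed.

Lemma wpd_vmfun j u g : is_weak_deriv Om [:: j] u g -> vmfun Om (wpd Om j u).
Proof. by move=> /wpdP[_ ig _]; exact: loc_integrable_vmfun. Qed.

Lemma wpd_ae j u g : is_weak_deriv Om [:: j] u g -> vae Om (fun x => wpd Om j u x = g x).
Proof. by move=> wg; exact: (weak_deriv_unique d_gt0 oOm (wpdP wg) wg). Qed.

Lemma wpd_linear j u v g h c : is_weak_deriv Om [:: j] u g -> is_weak_deriv Om [:: j] v h ->
  vae Om (fun x => wpd Om j (fun x => u x + c * v x) x = wpd Om j u x + c * wpd Om j v x).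
Proof.
by move=> wg wh; apply: wpd_ae; apply: weak_derivD => //; [exact: (wpdP wg)|exact: (wpdP wh)].
Qed.

End NiceFunctions.

(** * The bilinear forms and the midpoint scheme *)

Section Forms.
Context {R : realType} {d : nat} (Om : set 'rV[R]_d) (T : mesh R d).
Hypothesis d_gt0 : (0 < d)%N.
Hypothesis HT : triangulation Om T.
Hypotheses (oOm : open Om) (bOm : bounded_set Om) (pOm : polytopal Om).
Local Notation field := ('rV[R]_d -> 'rV[R]_3).
Implicit Types (u v w : field) (D : field -> 'rV[R]_d -> R).

Let mOm : vmeas Om := vmeas_open d_gt0 oOm.

(* Linearity can only hold almost everywhere, because [wpd] selects arbitrary representatives. *)
Definition nodal_linear D :=
  (forall v, Vh Om T v -> ess_bounded Om (D v)) /\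
  forall v w (c : R), Vh Om T v -> Vh Om T w ->
    vae Om (fun x => D (fun y => v y + c *: w y) x = D v x + c * D w x).

Definition linear_on_Vh (B : field -> R) := forall v w (c : R), Vh Om T v -> Vh Om T w ->
  B (fun y => v y + c *: w y) = B v + c * B w.

Lemma nodal_linear_ext D D' : (forall v x, D v x = D' v x) -> nodal_linear D -> nodal_linear D'.
Proof. by move=> DD'; have -> : D = D' by apply/funext => v; apply/funext => x. Qed.

Lemma nodal_linear0 : nodal_linear (fun _ _ => 0).
Proof.
split=> [v _|v w c _ _]; first exact: ess_bounded_cst.
by apply: vaeW => x _; rewrite mulr0 addr0.
Qed.

Lemma nodal_linearB D1 D2 : nodal_linear D1 -> nodal_linear D2 ->
  nodal_linear (fun v x => D1 v x - D2 v x).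
Proof.
move=> [b1 l1] [b2 l2]; split=> [v Vv|v w c Vv Vw].
  have -> : (fun x => D1 v x - D2 v x) = (fun x => D1 v x + -1 * D2 v x).
    by apply/funext => x; rewrite mulN1r.
  by apply: ess_boundedD; [exact: b1|apply: ess_boundedZ; exact: b2].
by apply: vaeS (vaeI (l1 v w c Vv Vw) (l2 v w c Vv Vw)) => x _ [-> ->]; ring.
Qed.

Lemma nodal_linear_comp i : nodal_linear (Defs.comp i).
Proof.
split=> [v Vv|v w c Vv Vw]; last by apply: vaeW => x _; rewrite /Defs.comp !mxE.
have Pv := P1_comp i Vv; split; first exact: (P1_vmfun d_gt0 Pv).
by have [M _ HM] := P1_bounded HT Pv; exists M; apply: vaeW => x _.
Qed.

Lemma P1_has_weak_deriv j (u : 'rV[R]_d -> R^o) : P1 Om T u ->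
  exists2 g, is_weak_deriv Om [:: j] u g & ess_bounded Om g.
Proof.
move=> Pu; have [G HG] := P1_slopes HT Pu.
have [g [wg mg gG]] := P1_weak_deriv d_gt0 HT oOm bOm pOm Pu HG j.
exists g => //; split => //; exists (\sum_(K in elts T) `|G K j|); apply: vaeW => x Ox.
have [K KT [_ ->]] := gG x Ox.
by rewrite (bigD1 K) //= lerDl sumr_ge0.
Qed.

Lemma nodal_linear_wpd j i : nodal_linear (fun v => wpd Om j (Defs.comp i v)).
Proof.
split=> [v Vv|v w c Vv Vw].
  have [g wg [_ [M gM]]] := P1_has_weak_deriv j (P1_comp i Vv).
  split; first exact: (wpd_vmfun d_gt0 oOm wg).
  by exists M; apply: vaeS (vaeI (wpd_ae d_gt0 oOm wg) gM) => x _ [->].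
have [g wg _] := P1_has_weak_deriv j (P1_comp i Vv).
have [h wh _] := P1_has_weak_deriv j (P1_comp i Vw).
have := wpd_linear d_gt0 oOm c wg wh.
have -> // : Defs.comp i (fun y => v y + c *: w y) = (fun x => Defs.comp i v x + c * Defs.comp i w x).
by apply/funext => x; rewrite /Defs.comp !mxE.
Qed.

Lemma nodal_linear_wpdn k i : nodal_linear (fun v => wpdn Om k (Defs.comp i v)).
Proof.
rewrite /wpdn; case: insubP => [j _ _|_]; first exact: nodal_linear_wpd.
exact: nodal_linear0.
Qed.

Lemma nodal_linear_curl i : nodal_linear (fun v => Defs.comp i (curl Om v)).
Proof.
case: i => [[|[|[|//]]] Hi].
- apply: nodal_linear_ext (nodal_linearB (nodal_linear_wpdn 1 2) (nodal_linear_wpdn 2 1)).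
  by move=> v x; rewrite /Defs.comp /curl /row3 mxE.
- apply: nodal_linear_ext (nodal_linearB (nodal_linear_wpdn 2 0) (nodal_linear_wpdn 0 2)).
  by move=> v x; rewrite /Defs.comp /curl /row3 mxE.
- apply: nodal_linear_ext (nodal_linearB (nodal_linear_wpdn 0 1) (nodal_linear_wpdn 1 0)).
  by move=> v x; rewrite /Defs.comp /curl /row3 mxE.
Qed.

Lemma vint_mul_linear D1 D2 w : nodal_linear D1 -> nodal_linear D2 -> Vh Om T w ->
  linear_on_Vh (fun v => vint Om (fun x => D1 v x * D2 w x)).
Proof.
move=> [b1 l1] [b2 _] Vw u v c Vu Vv.
have i1 : vintg Om (fun x => D1 u x * D2 w x).
  by apply: ess_bounded_vintg => //; apply: ess_boundedM; [exact: b1|exact: b2].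
have i2 : vintg Om (fun x => D1 v x * D2 w x).
  by apply: ess_bounded_vintg => //; apply: ess_boundedM; [exact: b1|exact: b2].
rewrite -vintZ // -vintD //; last exact: vintgZ.
apply: vint_aeq => //.
- by apply: vmfunM; [exact: (b1 _ (P1_linear c Vu Vv)).1|exact: (b2 _ Vw).1].
- by apply: vintg_vmfun; apply: vintgD => //; exact: vintgZ.
- by apply: vaeS (l1 u v c Vu Vv) => x _ ->; ring.
Qed.

Lemma linear_on_VhD B1 B2 : linear_on_Vh B1 -> linear_on_Vh B2 -> linear_on_Vh (fun v => B1 v + B2 v).
Proof. by move=> l1 l2 v w c Vv Vw; rewrite l1 // l2 //; ring. Qed.

Lemma linear_on_VhZ k B : linear_on_Vh B -> linear_on_Vh (fun v => k * B v).
Proof. by move=> l v w c Vv Vw; rewrite l //; ring. Qed.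

Lemma linear_on_Vh_sum (I : finType) (B : I -> field -> R) : (forall i, linear_on_Vh (B i)) ->
  linear_on_Vh (fun v => \sum_i B i v).
Proof.
by move=> l v w c Vv Vw; rewrite mulr_sumr -big_split /=; apply: eq_bigr => i _; rewrite l.
Qed.

Lemma vint_sum_linear (I : finType) (D1 D2 : I -> field -> 'rV[R]_d -> R) w :
  (forall i, nodal_linear (D1 i)) -> (forall i, nodal_linear (D2 i)) -> Vh Om T w ->
  linear_on_Vh (fun v => vint Om (fun x => \sum_i D1 i v x * D2 i w x)).
Proof.
move=> l1 l2 Vw.
have E v : Vh Om T v -> vint Om (fun x => \sum_i D1 i v x * D2 i w x) =
    \sum_i vint Om (fun x => D1 i v x * D2 i w x).
  move=> Vv; rewrite vint_sum // => i.
  by apply: ess_bounded_vintg => //; apply: ess_boundedM; [exact: (l1 i).1|exact: (l2 i).1].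
move=> u v c Vu Vv; rewrite !E //; last exact: P1_linear.
by apply: (@linear_on_Vh_sum _ (fun i v => vint Om (fun x => D1 i v x * D2 i w x))) => // i;
  exact: vint_mul_linear.
Qed.

Lemma dotC n (u v : 'rV[R]_n) : dot u v = dot v u.
Proof. by apply: eq_bigr => i _; rewrite mulrC. Qed.

Lemma L2C v w : L2 Om v w = L2 Om w v.
Proof. by apply: vint_eq => x _; rewrite dotC. Qed.

Lemma aformC ke kd v w : aform Om ke kd v w = aform Om ke kd w v.
Proof.
have E : L2grad Om v w = L2grad Om w v.
  rewrite /L2grad; apply: vint_eq => x _.
  by apply: eq_bigr => c _; apply: eq_bigr => j _; rewrite mulrC.
by rewrite /aform E (L2C (curl Om v)) (L2C v) addrAC.
Qed.

Lemma aform_linear ke kd w : Vh Om T w -> linear_on_Vh (fun v => aform Om ke kd v w).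
Proof.
move=> Vw; apply: linear_on_VhD; first apply: linear_on_VhD; apply: linear_on_VhZ.
- have := @vint_sum_linear ('I_3 * 'I_d)%type (fun i v => wpd Om i.2 (Defs.comp i.1 v))
    (fun i v => wpd Om i.2 (Defs.comp i.1 v)) w (fun i => nodal_linear_wpd i.2 i.1)
    (fun i => nodal_linear_wpd i.2 i.1) Vw.
  congr linear_on_Vh; apply/funext => v; apply: vint_eq => x _.
  by rewrite pair_big.
- exact: (vint_sum_linear nodal_linear_comp nodal_linear_curl Vw).
- exact: (vint_sum_linear nodal_linear_curl nodal_linear_comp Vw).
Qed.

Lemma dotDl n (u v w : 'rV[R]_n) : dot (u + v) w = dot u w + dot v w.
Proof. by rewrite /dot -big_split; apply: eq_bigr => i _; rewrite mxE mulrDl. Qed.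

Lemma dotZl n (c : R) (u w : 'rV[R]_n) : dot (c *: u) w = c * dot u w.
Proof. by rewrite /dot mulr_sumr; apply: eq_bigr => i _; rewrite mxE mulrA. Qed.

Lemma dot_sqrB n (u v : 'rV[R]_n) : dot (u + v) (u - v) = dot u u - dot v v.
Proof. by rewrite /dot -sumrB; apply: eq_bigr => i _; rewrite !mxE; ring. Qed.

Lemma lumpedC v w : lumped Om T v w = lumped Om T w v.
Proof. by apply: eq_bigr => z _; rewrite dotC. Qed.

Lemma lumpedD u v w : lumped Om T (fun x => u x + v x) w = lumped Om T u w + lumped Om T v w.
Proof. by rewrite /lumped -big_split; apply: eq_bigr => z _ /=; rewrite dotDl mulrDr. Qed.

Lemma lumpedZ (c : R) v w : lumped Om T (fun x => c *: v x) w = c * lumped Om T v w.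
Proof. by rewrite /lumped mulr_sumr; apply: eq_bigr => z _; rewrite dotZl mulrCA. Qed.

Lemma ahformC ke kd la v w : ahform Om T ke kd la v w = ahform Om T ke kd la w v.
Proof. by rewrite /ahform aformC lumpedC. Qed.

Lemma ahform_linear ke kd la w : Vh Om T w -> linear_on_Vh (fun v => ahform Om T ke kd la v w).
Proof.
move=> Vw; apply: linear_on_VhD; first exact: aform_linear.
by apply: linear_on_VhZ => u v c _ _; rewrite lumpedD lumpedZ.
Qed.

Lemma linear_on_Vh0 B : linear_on_Vh B -> B (fun=> 0) = 0.
Proof.
move=> lB; have := lB (fun=> 0) (fun=> 0) 1 (P1_0 _ _ _) (P1_0 _ _ _).
have -> : (fun=> 0 + 1 *: 0) = (fun=> 0) :> field by apply/funext => x; rewrite scaler0 addr0.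
by rewrite mul1r => /eqP; rewrite -subr_eq0 opprD addNKr oppr_eq0 => /eqP.
Qed.

Lemma P1_scale (W : normedModType R) (c : R) (v : 'rV[R]_d -> W) :
  P1 Om T v -> P1 Om T (fun x => c *: v x).
Proof.
move=> Pv; have := P1_linear c (P1_0 _ _ _) Pv.
by under [X in P1 _ _ X -> _]eq_fun do rewrite add0r.
Qed.

Lemma linear_on_Vh_scale B c v : linear_on_Vh B -> Vh Om T v -> B (fun x => c *: v x) = c * B v.
Proof.
move=> lB Vv; have := lB (fun=> 0) v c (P1_0 _ _ _) Vv.
by rewrite linear_on_Vh0 // add0r; under [X in B X]eq_fun do rewrite add0r.
Qed.

Lemma linear_on_Vh_add B v w : linear_on_Vh B -> Vh Om T v -> Vh Om T w ->
  B (fun x => v x + w x) = B v + B w.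
Proof.
move=> lB Vv Vw; have := lB v w 1 Vv Vw.
by under [X in B X]eq_fun do rewrite scale1r; rewrite mul1r.
Qed.

Lemma linear_on_Vh_bigsum B I (r : seq I) (F : I -> field) : linear_on_Vh B ->
  (forall i, Vh Om T (F i)) -> B (fun x => \sum_(i <- r) F i x) = \sum_(i <- r) B (F i).
Proof.
move=> lB VF; elim: r => [|i r IH].
  by under [X in B X]eq_fun do rewrite big_nil; rewrite big_nil linear_on_Vh0.
rewrite big_cons -IH -linear_on_Vh_add //; last exact: P1_sum.
by under [X in B X]eq_fun do rewrite big_cons.
Qed.

Definition nodal_field (z : 'I_(nvert T)) (a : 'rV[R]_3) : field := fun x => hat Om z x *: a.

Lemma Vh_nodal_field z a : Vh Om T (nodal_field z a).
Proof. exact: P1_hat_scale. Qed.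

Lemma linear_on_Vh_nodal B v : linear_on_Vh B -> Vh Om T v ->
  B v = \sum_(z < nvert T) \sum_(c < 3) v (vert z) 0 c * B (nodal_field z (delta_mx 0 c)).
Proof.
move=> lB Vv.
have {1}-> : v = (fun x => \sum_(z < nvert T) nodal_field z (v (vert z)) x).
  by apply/funext => x; rewrite (P1_expand HT x Vv).
rewrite linear_on_Vh_bigsum //; last by move=> z; exact: Vh_nodal_field.
apply: eq_bigr => z _.
have {1}-> : nodal_field z (v (vert z)) =
    (fun x => \sum_(c < 3) v (vert z) 0 c *: nodal_field z (delta_mx 0 c) x).
  apply/funext => x; rewrite /nodal_field [in LHS](row_sum_delta (v (vert z))) scaler_sumr.
  by apply: eq_bigr => c _; rewrite !scalerA mulrC.
rewrite (linear_on_Vh_bigsum _ lB); last first.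
  by move=> c; apply: P1_scale; exact: Vh_nodal_field.
by apply: eq_bigr => c _; rewrite linear_on_Vh_scale //; exact: Vh_nodal_field.
Qed.

Lemma lumped_nodal_field v z a : lumped Om T v (nodal_field z a) = beta Om z * dot (v (vert z)) a.
Proof.
rewrite /lumped (bigD1 z) //= big1 ?addr0 => [|z' zz'].
  by rewrite /nodal_field (hatP HT z).2 eqxx scale1r.
by rewrite /nodal_field (hatP HT z).2 (negbTE zz') scale0r dotC -[0](scale0r 0) dotZl mul0r mulr0.
Qed.

Hypothesis neOm : Om !=set0.
Hypothesis box_in : forall K, K \in elts T -> exists (c : 'rV[R]_d), exists2 r, 0 < r &
  obox (fun i => c 0 i - r) (fun i => c 0 i + r) `<=` simplex K.

(** What permits dividing by the nodal weight when the scheme is tested at one vertex. The basis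
    function is positive at the center [c] of a box in an element containing [z]. A point [y] of the
    half-size box is the midpoint of [c] and of [2 *: y - c], which is still in the element, so the
    basis function is at least half its value at [c] there. *)
Lemma beta_gt0 z : 0 < beta Om (z : 'I_(nvert T)).
Proof.
have [K KT zK] := vert_used HT z.
have [c [r r0 sub]] := box_in KT.
pose B := obox (fun i => c 0 i - r / 2) (fun i => c 0 i + r / 2).
have Bsub : B `<=` obox (fun i => c 0 i - r) (fun i => c 0 i + r).
  by move=> y yB i; have /andP[h1 h2] := yB i; apply/andP; split; lra.
have BOm : B `<=` Om.
  by apply: obox_closure_sub => // y /Bsub/sub; exact: (simplex_sub_closure HT).
have mB : vmeas B by apply: vmeas_open => //; exact: obox_open.
have Kc : Kint K c.
  by apply: (obox_Kint HT KT sub) => i; rewrite ltrBlDr ltrDl r0.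
have mu0 : 0 < hat Om z c by rewrite (hat_bary HT _ KT Kc.1); exact: Kc.2.
have hatB y : B y -> hat Om z c / 2 <= hat Om z y.
  move=> By; pose y' := 2 *: y - c.
  have Ky' : simplex K y'.
    by apply: sub => i; have /andP[h1 h2] := By i; rewrite !mxE; apply/andP; split; lra.
  have E : y = 2^-1 *: c + (1 - 2^-1) *: y'.
    by apply/rowP => i; rewrite !mxE; field.
  rewrite E !(hat_bary HT _ KT) //; last first.
  - exact: Kc.1.
  - apply: simplex_convex => //; first exact: Kc.1.
    by apply/andP; split; lra.
  rewrite (bary_convex HT KT Kc.1 Ky'); last by apply/andP; split; lra.
  by have [h0 _ _ _] := baryP Ky'; have := h0 z; lra.
have ihat : vintg Om (hat Om z).
  apply: (@vintg_bounded _ _ _ _ 1) => //; first exact: leb_bounded.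
    exact: (P1_vmfun d_gt0 (hatP HT z).1).
  by move=> x _; rewrite ger0_norm ?(hat_ge0 HT) // (hat_le1 HT).
have fB : leb d (rvec @^-1` B) = (\prod_(i < d) r)%:E.
  rewrite preimage_obox leb_box; last by move=> i; lra.
  by congr EFin; apply: eq_bigr => i _; field.
apply: (@lt_le_trans _ _ (vint B (fun=> hat Om z c / 2))).
  rewrite vint_cst // fB ?ltry // mulr_gt0 ?divr_gt0 //=.
  exact: prodr_gt0.
apply: (@le_trans _ _ (vint B (hat Om z))).
  apply: vint_le => //; last by apply: vintgS BOm ihat.
  by apply: vintg_cst => //; rewrite fB ltry.
by apply: vint_le_sub => // x _; exact: (hat_ge0 HT).
Qed.

Lemma lumped_ge0 v : 0 <= lumped Om T v v.
Proof.
apply: sumr_ge0 => z _; apply: mulr_ge0; first exact: ltW (beta_gt0 z).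
by apply: sumr_ge0 => i _; rewrite -expr2 sqr_ge0.
Qed.

Lemma hnormE v : hnorm Om T v ^+ 2 = lumped Om T v v.
Proof. by rewrite sqr_sqrtr // lumped_ge0. Qed.

(** Riesz representation for a diagonal inner product: the nodal values are those of the functional
    on the nodal basis, divided by the weights [beta]. Hence the choice in [Hop] is not the default
    one. *)
Lemma HopP ke kd la v : Vh Om T v -> Vh Om T (Hop Om T ke kd la v) /\
  forall chi, Vh Om T chi ->
    lumped Om T (Hop Om T ke kd la v) chi = - ahform Om T ke kd la v chi.
Proof.
move=> Vv; apply: (@xgetPex _ (fun=> 0) [set w : field | Vh Om T w /\
    forall chi, Vh Om T chi -> lumped Om T w chi = - ahform Om T ke kd la v chi]).
pose W z : 'rV[R]_3 := \row_c (- ahform Om T ke kd la v (nodal_field z (delta_mx 0 c)) / beta Om z).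
exists (fun x => \sum_(z < nvert T) nodal_field z (W z) x); split.
  by apply: P1_sum => z; exact: Vh_nodal_field.
move=> chi Vchi; rewrite lumpedC ahformC.
rewrite (linear_on_Vh_nodal (@ahform_linear ke kd la v Vv) Vchi) -sumrN.
apply: eq_bigr => z _.
have -> : \sum_(z' < nvert T) nodal_field z' (W z') (vert z) = W z.
  rewrite (bigD1 z) //= big1 ?addr0 => [|z' zz'].
    by rewrite /nodal_field (hatP HT z).2 eqxx scale1r.
  by rewrite /nodal_field (hatP HT z').2 eq_sym (negbTE zz') scale0r.
rewrite /dot mulr_sumr -sumrN; apply: eq_bigr => c _.
rewrite mxE ahformC; field; by rewrite gt_eqF // beta_gt0.
Qed.

End Forms.

(** * Length preservation and the discrete energy law *)

Section MidpointScheme.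
Context {R : realType} {d : nat} (Om : set 'rV[R]_d) (T : mesh R d).
Hypothesis d_gt0 : (0 < d)%N.
Hypothesis HT : triangulation Om T.
Hypotheses (oOm : open Om) (bOm : bounded_set Om) (pOm : polytopal Om) (neOm : Om !=set0).
Hypothesis box_in : forall K, K \in elts T -> exists (c : 'rV[R]_d), exists2 r, 0 < r &
  obox (fun i => c 0 i - r) (fun i => c 0 i + r) `<=` simplex K.
Variables (ke kd la al ga k : R) (N : nat) (m0 : 'rV[R]_d -> 'rV[R]_3) (m : nat -> 'rV[R]_d -> 'rV[R]_3).
Hypotheses (al_gt0 : 0 < al) (ga_gt0 : 0 < ga) (k_gt0 : 0 < k).
Hypothesis Hm : midpoint_scheme Om T ke kd la al ga k N m0 m.
Local Notation a := (ahform Om T ke kd la).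

Lemma dot3 (u v : 'rV[R]_3) : dot u v = u 0 0 * v 0 0 + u 0 1 * v 0 1 + u 0 2 * v 0 2.
Proof.
rewrite /dot !big_ord_recr big_ord0 /= add0r.
by congr (u 0 _ * v 0 _ + u 0 _ * v 0 _ + u 0 _ * v 0 _); apply: val_inj.
Qed.

Lemma dot_cross_swap (u v w : 'rV[R]_3) : dot (cross u v) w = - dot (cross u w) v.
Proof. by rewrite !dot3 /cross /row3 !mxE /=; ring. Qed.

Lemma dot_cross_self (u v : 'rV[R]_3) : dot (cross u v) u = 0.
Proof. by rewrite !dot3 /cross /row3 !mxE /=; ring. Qed.

Lemma dot_cross_selfr (u v : 'rV[R]_3) : dot (cross u v) v = 0.
Proof. by rewrite !dot3 /cross /row3 !mxE /=; ring. Qed.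

Let hnormE_ := hnormE d_gt0 HT oOm bOm pOm neOm box_in.

Lemma scheme_Vh i : (i <= N)%N -> Vh Om T (m i).
Proof.
by have [m0E Vm _] := Hm; case: i => [_|i /Vm //]; rewrite m0E; exact: P1_interp.
Qed.

Lemma scheme_mid i : (i < N)%N -> Vh Om T (mid m i).
Proof.
move=> iN; have Vi := scheme_Vh (ltnW iN); have Vi' := scheme_Vh iN.
have := P1_scale 2^-1 (P1_linear 1 Vi' Vi).
by congr (P1 _ _ _); apply/funext => x; rewrite scale1r.
Qed.

Lemma scheme_dt i : (i < N)%N -> Vh Om T (dt k m i).
Proof.
move=> iN; have Vi := scheme_Vh (ltnW iN); have Vi' := scheme_Vh iN.
have := P1_scale k^-1 (P1_linear (-1) Vi' Vi).
by congr (P1 _ _ _); apply/funext => x; rewrite scaleN1r.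
Qed.

Lemma scheme_enorm i (z : 'I_(nvert T)) : (i < N)%N -> enorm (m i.+1 (vert z)) = enorm (m i (vert z)) :> R.
Proof.
move=> iN; have [_ _ /(_ i iN _ (Vh_nodal_field HT z (mid m i (vert z))))] := Hm.
rewrite !(lumped_nodal_field HT) /crossf !dot_cross_self !mulr0 subr0 addr0 => /eqP.
rewrite mulf_eq0 gt_eqF ?(beta_gt0 d_gt0 HT) //= /dt /mid dotZl dotC dotZl !mulf_eq0.
rewrite invr_eq0 gt_eqF //= invr_eq0 pnatr_eq0 /= => /eqP E.
rewrite /enorm; congr Num.sqrt; apply/eqP; rewrite -subr_eq0; apply/eqP.
by rewrite -dot_sqrB.
Qed.

Lemma scheme_energy i : (i < N)%N ->
  ga / (2 * al) * (a (m i.+1) (m i.+1) - a (m i) (m i)) + k * hnorm Om T (dt k m i) ^+ 2 = 0.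
Proof.
move=> iN; have Vi := scheme_Vh (ltnW iN); have Vi' := scheme_Vh iN.
have Vmid := scheme_mid iN; have Vdt := scheme_dt iN.
have [VW HW] := HopP d_gt0 HT oOm bOm pOm neOm box_in ke kd la Vmid.
have [_ _ sch] := Hm.
have := sch i iN _ VW; have := sch i iN _ Vdt; have := HW _ Vdt.
set W := Hop _ _ _ _ _ _ in VW HW *; set D := dt k m i in Vdt *; set M := mid m i in Vmid HW *.
have z1 w : lumped Om T (crossf M w) w = 0.
  by apply: big1 => z _; rewrite /crossf dot_cross_selfr mulr0.
have z3 : lumped Om T (crossf M D) W = - lumped Om T (crossf M W) D.
  by rewrite /lumped -sumrN; apply: eq_bigr => z _; rewrite /crossf dot_cross_swap mulrN.
rewrite !z1 z3 hnormE_ [lumped Om T W D]lumpedC => e1 e2 e3.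
have lin w : Vh Om T w -> linear_on_Vh Om T (fun v => a v w).
  exact: (ahform_linear d_gt0 HT oOm bOm pOm).
have e4 : a M D = (2 * k)^-1 * (a (m i.+1) (m i.+1) - a (m i) (m i)).
  have ED w : Vh Om T w -> a D w = k^-1 * (a (m i.+1) w + -1 * a (m i) w).
    move=> Vw; rewrite -(lin w Vw (m i.+1) (m i) (-1) Vi' Vi).
    rewrite -(linear_on_Vh_scale k^-1 (lin w Vw) (P1_linear (-1) Vi' Vi)).
    by have -> : D = (fun x => k^-1 *: (m i.+1 x + -1 *: m i x)) by apply/funext => x; rewrite scaleN1r.
  have EM : a M D = 2^-1 * (a (m i.+1) D + 1 * a (m i) D).
    rewrite -(lin D Vdt (m i.+1) (m i) 1 Vi' Vi).
    rewrite -(linear_on_Vh_scale 2^-1 (lin D Vdt) (P1_linear 1 Vi' Vi)).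
    by have -> : M = (fun x => 2^-1 *: (m i.+1 x + 1 *: m i x)) by apply/funext => x; rewrite scale1r.
  have aC v w : a v w = a w v by exact: ahformC.
  rewrite EM (aC (m i.+1)) (aC (m i) D) !ED // (aC (m i) (m i.+1)).
  by field; rewrite gt_eqF.
have k0 : k != 0 by rewrite gt_eqF.
have al0 : al != 0 by rewrite gt_eqF.
have ga0 : ga != 0 by rewrite gt_eqF.
(* With [X] for [lumped Om T (crossf M W) D], the three equations read [lumped D W = - a M D],
   [lumped D D = - ga * X] and [lumped D W = - al * X]; hence [a M D = al * X], and [X] is
   eliminated. *)
have e5 : ga * (a (m i.+1) (m i.+1) - a (m i) (m i)) = - (2 * al * k * lumped Om T D D).
  have -> : a (m i.+1) (m i.+1) - a (m i) (m i) = 2 * k * a M D by rewrite e4; field.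
  have -> : a M D = - lumped Om T D W by lra.
  have -> : lumped Om T D W = - al * lumped Om T (crossf M W) D by lra.
  have -> : lumped Om T D D = - ga * lumped Om T (crossf M W) D by lra.
  by ring.
by rewrite mulrAC e5; field.
Qed.

Lemma scheme_energy_le i : (i <= N)%N -> a (m i) (m i) <= a (m 0%N) (m 0%N).
Proof.
elim: i => // i IH iN; apply: le_trans (IH (ltnW iN)).
have := scheme_energy iN; have := sqr_ge0 (hnorm Om T (dt k m i)) => h1 h2.
rewrite -subr_le0 -(pmulr_rle0 _ (_ : 0 < ga / (2 * al))) ?divr_gt0 ?mulr_gt0 //.
have := mulr_ge0 (ltW k_gt0) h1; lra.
Qed.

Lemma scheme_dissipation : k * (\sum_(i < N) hnorm Om T (dt k m i) ^+ 2) =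
  ga / (2 * al) * (a (m 0%N) (m 0%N) - a (m N) (m N)).
Proof.
rewrite mulr_sumr.
under eq_bigr => i _.
  have -> : k * hnorm Om T (dt k m i) ^+ 2 = - (ga / (2 * al)) * (a (m i.+1) (m i.+1) - a (m i) (m i)).
    by have := scheme_energy (ltn_ord i); lra.
  over.
rewrite -mulr_sumr -(big_mkord xpredT (fun i => a (m i.+1) (m i.+1) - a (m i) (m i))) /=.
by rewrite telescope_sumr // mulNr -mulrN opprB.
Qed.

End MidpointScheme.

(** * Morrey's inequality *)

Section AffineChainRule.
Context {R : realType} {d : nat}.
Implicit Types (f : 'rV[R]_d -> R) (p v x z : 'rV[R]_d).

Lemma elementary_comp_affine f p t : elementary f -> elementary (fun z => f (p + t *: z)).
Proof.
elim=> {f} [n i a b|i|c|f g _ ef _ eg|f g _ ef _ eg].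
- rewrite (_ : (fun z => _) = (fun z => flat n ((a * t) * z 0 i + (a * p 0 i + b)))).
    exact: elementary_flat.
  by apply/funext => z; rewrite !mxE; congr flat; ring.
- rewrite (_ : (fun z => _) = (fun=> p 0 i) + (fun z => z 0 i * t)).
    by apply: elementary_add; [exact: elementary_cst|apply: elementary_scale; exact: elementary_coord].
  by apply/funext => z; rewrite fctE !mxE mulrC.
- exact: elementary_cst.
- exact: (elementary_add ef eg).
- exact: (elementary_mul ef eg).
Qed.

Lemma derive_sum_coord f x v : differentiable f x -> 'D_v f x = \sum_j v 0 j * pderiv j f x.
Proof.
move=> df; rewrite deriveE // {1}(row_sum_delta v) linear_sum.
by apply: eq_bigr => j _; rewrite linearZ /pderiv deriveE.
Qed.

Lemma is_derive_affine_line f p v (t : R) : elementary f ->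
  is_derive t 1 (fun s => f (p + s *: v)) (\sum_j v 0 j * pderiv j f (p + t *: v)).
Proof.
move=> ef; have df := elementary_differentiable (p + t *: v) ef.
by rewrite -derive_sum_coord //; apply: is_derive_line; exact: diff_derivable.
Qed.

Lemma pderiv_comp_affine f p t j z : elementary f ->
  pderiv j (fun z => f (p + t *: z)) z = t * pderiv j f (p + t *: z).
Proof.
move=> ef; have eF := elementary_comp_affine p t ef.
have h1 := @is_derive_affine_line (fun z => f (p + t *: z)) z (delta_mx 0 j) 0 eF.
have h2 := @is_derive_affine_line f (p + t *: z) (t *: delta_mx 0 j) 0 ef.
have E : (fun s : R => f (p + t *: (z + s *: delta_mx 0 j))) =
         (fun s => f (p + t *: z + s *: (t *: delta_mx 0 j))).
  by apply/funext => s; congr f; apply/rowP => i; rewrite !mxE; ring.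
rewrite E in h1; have [_ e1] := h1; have [_ e2] := h2.
move: e1; rewrite e2 (bigD1 j) //= big1 => [|k kj]; last first.
  by rewrite !mxE (negbTE kj) andbF mulr0 mul0r.
rewrite [in X in _ = X -> _](bigD1 j) //= big1 => [|k kj]; last first.
  by rewrite !mxE (negbTE kj) andbF mul0r.
by rewrite !mxE !eqxx !mulr1 mul1r !scale0r !addr0 => <-.
Qed.

Lemma is_derive_pderiv f x j : elementary f -> is_derive x (delta_mx 0 j) f (pderiv j f x).
Proof.
by move=> ef; apply: DeriveDef => //; apply: diff_derivable; exact: elementary_differentiable.
Qed.

End AffineChainRule.

Section RealLemmas.
Context {R : realType}.

(** The mean value theorem for [c f - F] with [c = 1] and [c = -1], whose derivative is nonpositive.
    This stands in for integrating the bound on [f']. *)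
Lemma derive_bound_le (f f' F F' : R -> R) a b : a <= b ->
  (forall t : R, a <= t <= b -> is_derive t 1 f (f' t)) ->
  (forall t : R, a <= t <= b -> is_derive t 1 F (F' t)) ->
  (forall t, a <= t <= b -> `|f' t| <= F' t) -> `|f b - f a| <= F b - F a.
Proof.
rewrite le_eqVlt => /predU1P[<-|ab] df dF fF; first by rewrite !subrr normr0.
have H (c : R) : `|c| = 1 -> c * (f b - f a) <= F b - F a.
  move=> c1; pose h := cst c * f - F : R -> R.
  have dh (t : R) : a <= t <= b -> is_derive t 1 h (c * f' t - F' t).
    move=> tab; have d1 := df t tab; have d2 := dF t tab.
    by apply: is_derive_eq; rewrite /GRing.scale /= mulr0 addr0.
  have dh' (t : R) : t \in `]a, b[ -> is_derive t 1 h (c * f' t - F' t).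
    by rewrite in_itv /= => /andP[/ltW h1 /ltW h2]; apply: dh; rewrite h1 h2.
  have ch : {within `[a, b], continuous h}.
    by apply: derivable_within_continuous => t; rewrite in_itv /= => /dh[].
  have [t tab E] := MVT ab dh' ch.
  have tab' : a <= t <= b by move: tab; rewrite in_itv /= => /andP[/ltW -> /ltW ->].
  have : (c * f' t - F' t) * (b - a) <= 0.
    rewrite mulr_le0_ge0 ?subr_ge0 ?(ltW ab) // subr_le0.
    by rewrite (le_trans (ler_norm _)) // normrM c1 mul1r fF.
  by rewrite -E /h !fctE; lra.
rewrite ler_norml; have := H 1; have := H (-1); rewrite normrN normr1 => /(_ erefl) h1 /(_ erefl) h2.
by apply/andP; split; lra.
Qed.

(* With [l] growing like [t ^ (d / p)] this bounds the integral of [|grad v|] over a shrinking box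
   without Hölder's inequality. *)
Lemma young_powR (a l p : R) : 0 <= a -> 0 < l -> 1 <= p -> a <= l + l * (l^-1 `^ p * a `^ p).
Proof.
move=> a0 l0 p1; have li : 0 <= l^-1 by rewrite invr_ge0 ltW.
rewrite -powRM // mulrC -[X in X <= _](@divfK _ l) ?gt_eqF //.
have [h|h] := leP (a / l) 1.
  by rewrite -[X in _ <= X + _]mul1r -mulrDl ler_pM2r // ler_wpDr ?powR_ge0.
apply: ler_wpDl; first exact: ltW.
rewrite ler_pM2r // [l^-1 * a]mulrC -[leLHS]powRr1 ?mulr_ge0 //.
by apply: ler_powR => //; exact: ltW.
Qed.

End RealLemmas.

Section MollifiedAverages.
Context {R : realType} {d : nat} (Om : set 'rV[R]_d) (x c : 'rV[R]_d) (r : R).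
Hypothesis d_gt0 : (0 < d)%N.
Implicit Types (v g : 'rV[R]_d -> R) (z : 'rV[R]_d) (t : R).

Definition rho : 'rV[R]_d -> R := bump 1 (fun=> -1) (fun=> 1).

Lemma elementary_rho : elementary rho.
Proof. exact: elementary_bump. Qed.

(* [zoom t] maps the image of the box of radius [r] around [c] under the homothety of center [x]
   and ratio [1 / t] onto the unit box. *)
Definition zoom t z := r^-1 *: (x - c) + t *: (r^-1 *: (z - x)).

(** The factor [t ^ d] compensates the volume of the shrinking box, so that the total mass does not
    depend on [t] while the box stays in [Om]. *)
Definition kern t z := t ^+ d * rho (zoom t z).

(** Component [j] of [kern t z] times [(z - x) / t]. The mass contracts towards [x] with velocity
    [- (z - x) / t], so this is the mass flow with the opposite sign. *)
Definition flux j t z := t ^+ d.-1 * ((z 0 j - x 0 j) * rho (zoom t z)).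

Definition avg v t := vint Om (fun z => v z * kern t z).

Lemma zoom_affine t z : zoom t z = (r^-1 *: (x - c) - (t * r^-1) *: x) + (t * r^-1) *: z.
Proof. by apply/rowP => i; rewrite !mxE; ring. Qed.

Lemma elementary_rho_zoom t : elementary (rho \o zoom t).
Proof.
have := elementary_comp_affine (r^-1 *: (x - c) - (t * r^-1) *: x) (t * r^-1) elementary_rho.
by congr elementary; apply/funext => z; rewrite /= zoom_affine.
Qed.

Lemma elementary_kern t : elementary (kern t).
Proof.
by apply: (@elementary_mul _ _ (fun=> t ^+ d)); [exact: elementary_cst|exact: elementary_rho_zoom].
Qed.

Lemma elementary_flux j t : elementary (flux j t).
Proof.
apply: (@elementary_mul _ _ (fun=> t ^+ d.-1)); first exact: elementary_cst.
apply: (@elementary_mul _ _ (fun z => z 0 j - x 0 j)); last exact: elementary_rho_zoom.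
by apply: (@elementary_add _ _ _ (fun=> - x 0 j)); [exact: elementary_coord|exact: elementary_cst].
Qed.

Lemma pderiv_flux j t z : pderiv j (flux j t) z =
  t ^+ d.-1 * (rho (zoom t z) + (z 0 j - x 0 j) * (t * r^-1 * pderiv j rho (zoom t z))).
Proof.
have E : pderiv j (rho \o zoom t) z = t * r^-1 * pderiv j rho (zoom t z).
  rewrite zoom_affine -pderiv_comp_affine; last exact: elementary_rho.
  by congr (pderiv j _ z); apply/funext => y; rewrite /= zoom_affine.
have := is_derive_pderiv z j (elementary_rho_zoom t); rewrite E => d1.
have d2 := is_derive_coord j j z; rewrite eqxx in d2.
have d3 : is_derive z (delta_mx 0 j) (cst (t ^+ d.-1) * (((fun y : 'rV[R]_d => y 0 j) - cst (x 0 j)) *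
    (rho \o zoom t)) : 'rV[R]_d -> R) (t ^+ d.-1 * (rho (zoom t z) + (z 0 j - x 0 j) * (t * r^-1 * pderiv j rho (zoom t z)))).
  by apply: is_derive_eq; rewrite /GRing.scale /= !fctE; ring.
by have [_ <-] := d3.
Qed.

(* Continuity equation [d/dt kern = div flux]: the [t]-derivative of an average of [v] is minus
   the integral of the weak gradient of [v] against [flux]. *)
Lemma kern_derive t z : is_derive t 1 (kern ^~ z) (\sum_j pderiv j (flux j t) z).
Proof.
have d1 := is_derive_affine_line (r^-1 *: (x - c)) (r^-1 *: (z - x)) t elementary_rho.
have d2 : is_derive t 1 (fun s : R => s ^+ d) (d%:R * t ^+ d.-1).
  have := is_deriveX d (is_derive_id t (1 : R)).
  rewrite /GRing.scale /= mulr1 (_ : id ^+ d = fun s : R => s ^+ d) //.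
  by apply/funext => s; rewrite exprfctE.
have d3 : is_derive t 1 ((fun s : R => s ^+ d) * (fun s : R => rho (r^-1 *: (x - c) + s *: (r^-1 *: (z - x)))))
   (\sum_j pderiv j (flux j t) z).
  apply: is_derive_eq.
  (* The divergence of [z - x] contributes [d] copies of [t ^ d.-1 * rho], which match the
     derivative of [t ^ d]; the other terms are the chain rule for [rho]. *)
  under [RHS]eq_bigr do rewrite pderiv_flux mulrDr.
  rewrite big_split /= sumr_const card_ord addrC; congr (_ + _); last first.
    by rewrite -[LHS]/(_ * _) -[RHS]mulr_natl [LHS]mulrC -mulrA.
  rewrite -[LHS]/(_ * _) mulr_sumr; apply: eq_bigr => j _; rewrite !mxE -/(zoom t z).
  by rewrite -{1}(prednK d_gt0) exprS; ring.
by [].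
Qed.

End MollifiedAverages.

Section AverageDerivative.
Context {R : realType} {d : nat} (Om : set 'rV[R]_d) (x c : 'rV[R]_d) (r : R).
Hypothesis d_gt0 : (0 < d)%N.
Hypotheses (oOm : open Om) (bOm : bounded_set Om) (r_gt0 : 0 < r).
Implicit Types (v g : 'rV[R]_d -> R) (z : 'rV[R]_d) (t : R).
Local Notation rho := (@rho R d).
Local Notation zoom := (zoom x c r).
Local Notation kern := (kern x c r).
Local Notation flux := (flux x c r).
Local Notation avg := (avg Om x c r).

Let mOm : vmeas Om := vmeas_open d_gt0 oOm.
Let fOm : (leb d (rvec @^-1` Om) < +oo)%E := leb_bounded bOm mOm.

Lemma rho_ge0 z : 0 <= rho z. Proof. exact: bump_ge0. Qed.

Lemma rho_le1 z : rho z <= 1. Proof. exact: bump_le1. Qed.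

Lemma rho_supp z : rho z != 0 -> forall i, -1 <= z 0 i <= 1.
Proof. exact: bump_supp. Qed.

Lemma pderiv_rho_bounded : exists2 M, 0 <= M & forall j z, `|pderiv j rho z| <= M.
Proof.
have trho : test_function setT rho.
  exact: (@test_function_box _ _ setT rho (fun=> -1) (fun=> 1) (@elementary_rho R d) (@bump_supp _ _ _ _ _)).
have H j : exists M, 0 <= M /\ forall z, `|pderiv j rho z| <= M.
  by have [M M0 HM] := test_function_bounded [:: j] trho; exists M.
have [M HM] := choice H; exists (\sum_j M j).
  by apply: sumr_ge0 => j _; have [] := HM j.
move=> j z; apply: (le_trans ((HM j).2 z)).
by rewrite (bigD1 j) //= lerDl sumr_ge0 // => k _; have [] := HM k.
Qed.

(** Provides the dominating function for differentiation under the integral sign, so only uniformity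
    in [s] and [z] matters, not the size of the constant. *)
Lemma pderiv_flux_bounded (b : R) : exists2 C, 0 <= C &
  forall s z, 0 < s < b -> Om z -> `|\sum_j pderiv j (flux j s) z| <= C.
Proof.
have [B B0 HB] := pderiv_rho_bounded.
have [M [_ bM]] := bOm; pose D := `|M| + 1 + `|x|.
have D0 : 0 <= D by rewrite !addr_ge0.
pose b' := `|b|; have b0 : 0 <= b' by exact: normr_ge0.
have E0 : 0 <= b' ^+ d.-1 * (1 + D * (b' * r^-1 * B)).
  by rewrite mulr_ge0 ?exprn_ge0 // addr_ge0 // !mulr_ge0 // invr_ge0 ltW.
exists (\sum_(j < d) b' ^+ d.-1 * (1 + D * (b' * r^-1 * B))); first exact: sumr_ge0.
move=> s z /andP[s0 sb] Oz; apply: le_trans (ler_norm_sum _ _ _) _; apply: ler_sum => j _.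
have sb' : s <= b' by rewrite (le_trans (ltW sb)) // ler_norm.
rewrite pderiv_flux // normrM ger0_norm ?exprn_ge0 ?(ltW s0) //.
apply: ler_pM => //; first by rewrite exprn_ge0 // ltW.
  by apply: lerXn2r => //; rewrite nnegrE // ltW.
apply: le_trans (ler_normD _ _) _; rewrite ger0_norm ?rho_ge0 //.
apply: lerD; first exact: rho_le1.
rewrite normrM; apply: ler_pM => //.
  apply: le_trans (ler_normB _ _) _; apply: lerD; last exact: coord_le_norm.
  apply: le_trans (coord_le_norm _ _) _; apply: bM => //.
  by rewrite (le_lt_trans (ler_norm _)) // ltrDl.
rewrite normrM; apply: ler_pM => //.
by rewrite ger0_norm ?ler_wpM2r ?mulr_ge0 ?invr_ge0 // ltW.
Qed.

Lemma vmfun_elementary (f : 'rV[R]_d -> R) : elementary f -> vmfun Om f.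
Proof.
move=> ef; apply: vmfun_continuous => //; apply: continuous_subspaceT.
exact: elementary_continuous.
Qed.

Lemma kern_ge0 t z : 0 <= t -> 0 <= kern t z.
Proof. by move=> t0; rewrite mulr_ge0 ?exprn_ge0 // rho_ge0. Qed.

Lemma kern_le t z : 0 <= t -> kern t z <= t ^+ d.
Proof. by move=> t0; rewrite ler_piMr ?exprn_ge0 // rho_le1. Qed.

Lemma vintg_kern v t : 0 <= t -> vintg Om v -> vintg Om (fun z => v z * kern t z).
Proof.
move=> t0 iv; apply: (@vintg_mul_bounded _ _ _ _ _ (t ^+ d)) => //.
  exact: vmfun_elementary (elementary_kern _ _ _ _).
by move=> z _; rewrite ger0_norm ?kern_ge0 // kern_le.
Qed.

Lemma avg_derive v t : 0 < t -> vintg Om v ->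
  is_derive t 1 (avg v) (vint Om (fun z => v z * \sum_j pderiv j (flux j t) z)).
Proof.
move=> t0 iv; have [C C0 HC] := pderiv_flux_bounded (2 * t).
pose f (s : R) (y : d.-tuple (measurableTypeR R)) := v (rvec y) * kern s (rvec y).
have It : (`]0, 2 * t[%classic : set R) t by rewrite /= in_itv /= t0 /=; lra.
have df (s : R) y : is_derive s 1 (f ^~ y) (v (rvec y) * \sum_j pderiv j (flux j s) (rvec y)).
  have dk := kern_derive x c r d_gt0 s (rvec y).
  have := is_deriveZ (v (rvec y)) dk; exact.
have intf s : (`]0, 2 * t[%classic : set R) s -> (leb d).-integrable (rvec @^-1` Om) (EFin \o f s).
  by rewrite /= in_itv /= => /andP[/ltW s0 _]; exact: vintg_kern.
have derf s y : (`]0, 2 * t[%classic : set R) s -> (rvec @^-1` Om) y -> derivable (f ^~ y) s 1.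
  by move=> _ _; have [] := df s y.
pose G (y : d.-tuple (measurableTypeR R)) := `|v (rvec y)| * C.
have G0 y : 0 <= G y by rewrite mulr_ge0.
have iG : (leb d).-integrable (rvec @^-1` Om) (EFin \o G).
  have := vintgZ C mOm (vintg_norm iv); congr (integrable _ _ _).
  by apply/funext => y /=; rewrite mulrC.
have GP s y : (`]0, 2 * t[%classic : set R) s -> (rvec @^-1` Om) y -> `|partial1of2 f s y| <= G y.
  rewrite /= in_itv /= => s0 Oy; rewrite partial1of2E.
  by have [_ ->] := df s y; rewrite normrM ler_wpM2l // HC.
have dv := @derivable_under_integral _ _ _ (leb d) f _ mOm t 0 (2 * t) It intf derf G G0 iG GP.
have ev := @differentiation_under_integral _ _ _ (leb d) f _ mOm t 0 (2 * t) It intf derf G G0 iG GP.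
apply: DeriveDef; first exact: dv.
rewrite -derive1E; apply: etrans ev _.
rewrite /vint; apply: eq_Rintegral => y _; rewrite partial1of2E.
by have [_ ->] := df t y.
Qed.

End AverageDerivative.

Section Morrey.
Context {R : realType} {d : nat} (Om S : set 'rV[R]_d) (x c : 'rV[R]_d) (r L p : R).
Hypothesis d_gt0 : (0 < d)%N.
Hypotheses (oOm : open Om) (bOm : bounded_set Om) (r_gt0 : 0 < r) (L_ge0 : 0 <= L).
Hypotheses (mS : vmeas S) (SOm : S `<=` Om) (dp : d%:R < p).
Hypothesis HS : forall s y, 0 < s <= 1 -> cbox (fun i => c 0 i - r) (fun i => c 0 i + r) y ->
  S ((1 - s) *: x + s *: y).
Hypothesis cx : forall i, `|c 0 i - x 0 i| <= L * r.
Implicit Types (v : 'rV[R]_d -> R) (g : 'I_d -> 'rV[R]_d -> R) (z : 'rV[R]_d) (t : R).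
Local Notation rho := (@rho R d).
Local Notation zoom := (zoom x c r).
Local Notation kern := (kern x c r).
Local Notation flux := (flux x c r).
Local Notation avg := (avg Om x c r).

Let mOm : vmeas Om := vmeas_open d_gt0 oOm.
Let fOm : (leb d (rvec @^-1` Om) < +oo)%E := leb_bounded bOm mOm.

Definition zoom_box t := cbox (fun i => x 0 i + t^-1 * (c 0 i - r - x 0 i))
  (fun i => x 0 i + t^-1 * (c 0 i + r - x 0 i)).

Lemma zoom_boxP t z : 0 < t ->
  zoom_box t z <-> cbox (fun i => c 0 i - r) (fun i => c 0 i + r) (x + t *: (z - x)).
Proof.
move=> t0; split => H i; have := H i; rewrite !mxE => /andP[h1 h2].
  have : t^-1 * (c 0 i - r - x 0 i) <= z 0 i - x 0 i by lra.
  have : z 0 i - x 0 i <= t^-1 * (c 0 i + r - x 0 i) by lra.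
  by rewrite ler_pdivrMl // ler_pdivlMl // => h3 h4; apply/andP; split; lra.
have : t^-1 * (c 0 i - r - x 0 i) <= z 0 i - x 0 i by rewrite ler_pdivrMl //; lra.
have : z 0 i - x 0 i <= t^-1 * (c 0 i + r - x 0 i) by rewrite ler_pdivlMl //; lra.
by move=> h3 h4; apply/andP; split; lra.
Qed.

Lemma rho_zoom_supp t z : 0 < t -> rho (zoom t z) != 0 -> zoom_box t z.
Proof.
move=> t0 /rho_supp H; apply/zoom_boxP => // i; have := H i; rewrite !mxE.
have -> : r^-1 * (x 0 i - c 0 i) + t * (r^-1 * (z 0 i - x 0 i)) =
  (x 0 i + t * (z 0 i - x 0 i) - c 0 i) / r by ring.
by rewrite ler_pdivlMr // ler_pdivrMr // => /andP[h1 h2]; apply/andP; split; lra.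
Qed.

(** For [t >= 1] the box is the one around [c] contracted towards [x] by [1 / t], and [HS] keeps it
    in [S] although [x] need not belong to [S]. *)
Lemma zoom_box_sub t : 1 <= t -> zoom_box t `<=` S.
Proof.
move=> t1 z; have t0 : 0 < t by rewrite (lt_le_trans ltr01).
have ti : 0 < t^-1 <= 1 by rewrite invr_gt0 t0 invf_le1.
move=> /(zoom_boxP z t0)/(HS ti); congr S; apply/rowP => i; rewrite !mxE.
by field; rewrite gt_eqF.
Qed.

Lemma zoom_box_dist t z i : 0 < t -> zoom_box t z -> `|z 0 i - x 0 i| <= (L + 1) * r / t.
Proof.
move=> t0 /(zoom_boxP z t0)/(_ i); rewrite !mxE => /andP[h1 h2].
have := cx i; rewrite ler_pdivlMr // !ler_norml => /andP[h3 h4].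
rewrite -[X in `|_| * X](gtr0_norm t0) -normrM ler_norml; apply/andP; split; lra.
Qed.

Lemma vmeas_zoom_box t : vmeas (zoom_box t).
Proof. by apply: vmeas_closed => //; exact: cbox_closed. Qed.

(** The closed box of half-width [r / t] is enclosed in the open one of half-width [2 * r / t],
    whose volume is known; hence the 4. *)
Lemma zoom_box_vol t : 0 < t -> (leb d (rvec @^-1` zoom_box t) <= ((4 * r / t) ^+ d)%:E)%E.
Proof.
move=> t0; pose a i := x 0 i + t^-1 * (c 0 i - 2 * r - x 0 i).
pose b i := x 0 i + t^-1 * (c 0 i + 2 * r - x 0 i).
have ti : 0 < t^-1 by rewrite invr_gt0.
have tr : 0 < t^-1 * r by rewrite mulr_gt0.
have -> : (4 * r / t) ^+ d = \prod_(i < d) (b i - a i).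
  by rewrite -[in LHS](card_ord d) -prodr_const; apply: eq_bigr => i _; rewrite /b /a; ring.
rewrite -leb_box => [|i]; last by rewrite /a /b; nra.
apply: le_measure; rewrite ?inE.
- exact: vmeas_zoom_box.
- exact: measurable_box.
move=> y /= H i; have := H i; rewrite rvecE /a /b => /andP[h1 h2].
by apply/andP; split; nra.
Qed.

Lemma flux_out j t z : 0 < t -> ~ zoom_box t z -> flux j t z = 0.
Proof.
move=> t0 nz; rewrite /flux.
have [->|/(rho_zoom_supp t0)//] := eqVneq (rho (zoom t z)) 0.
by rewrite !mulr0.
Qed.

Lemma flux_test j t : 1 <= t -> test_function Om (flux j t).
Proof.
move=> t1; have t0 : 0 < t by rewrite (lt_le_trans ltr01).
apply: (@test_function_box _ _ _ _ (fun i => x 0 i + t^-1 * (c 0 i - r - x 0 i))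
  (fun i => x 0 i + t^-1 * (c 0 i + r - x 0 i))); first exact: elementary_flux.
- by move=> z; apply: contra_neqP => /(flux_out j t0).
- by move=> z /(zoom_box_sub t1); exact: SOm.
Qed.

Lemma flux_le j t z : 0 < t -> `|flux j t z| <= t ^+ d.-1 * ((L + 1) * r / t).
Proof.
move=> t0; have [zb|/(flux_out j t0) ->] := pselect (zoom_box t z); last first.
  by rewrite normr0 !mulr_ge0 ?exprn_ge0 ?invr_ge0 ?addr_ge0 // ltW.
rewrite normrM ger0_norm ?exprn_ge0 ?(ltW t0) // ler_wpM2l ?exprn_ge0 ?(ltW t0) //.
rewrite normrM (ger0_norm (rho_ge0 _)) -[leRHS]mulr1.
by apply: ler_pM => //; [exact: rho_ge0|exact: zoom_box_dist|exact: rho_le1].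
Qed.

Lemma avg_deriv_weak v g t : 1 <= t -> (forall j, is_weak_deriv Om [:: j] v (g j)) ->
  vint Om (fun z => v z * \sum_j pderiv j (flux j t) z) =
  - \sum_j vint Om (fun z => g j z * flux j t z).
Proof.
move=> t1 wg.
have -> : (fun z => v z * \sum_j pderiv j (flux j t) z) =
    (fun z => \sum_j v z * mderiv [:: j] (flux j t) z).
  by apply/funext => z; rewrite mulr_sumr.
rewrite vint_sum //; last first.
  by move=> j; have [iv _ _] := wg j; apply: vintg_test => //; exact: flux_test.
rewrite -sumrN; apply: eq_bigr => j _; have [_ _ ->] := wg j; last exact: flux_test.
by rewrite expr1 mulN1r.
Qed.

Section bound.
Variables (v : 'rV[R]_d -> R) (g : 'I_d -> 'rV[R]_d -> R).
Hypothesis wg : forall j, is_weak_deriv Om [:: j] v (g j).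
Hypothesis ig : forall j, vintg Om (fun z => `|g j z| `^ p).

Let p_gt0 : 0 < p. Proof. exact: le_lt_trans dp. Qed.
Let p_ge1 : 1 <= p.
Proof. by apply: le_trans (ltW dp); rewrite (ler_nat _ 1). Qed.

(** Up to a constant the mean of [|g| ^ p] over [S], when the volume of [S] is comparable to
    [r ^ d]. *)
Definition energy := r ^- d * \sum_j vint S (fun z => `|g j z| `^ p).

Let energy_ge0 : 0 <= energy.
Proof.
rewrite mulr_ge0 ?invr_ge0 ?exprn_ge0 ?(ltW r_gt0) //.
by apply: sumr_ge0 => j _; apply: vint_ge0 => z _; exact: powR_ge0.
Qed.

Lemma vint_zoom_box j t (l : R) : 1 <= t -> 0 < l ->
  vint (zoom_box t) (fun z => `|g j z|) <=
  l * (4 * r / t) ^+ d + l * (l^-1 `^ p * vint S (fun z => `|g j z| `^ p)).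
Proof.
move=> t1 l0; have t0 : 0 < t by rewrite (lt_le_trans ltr01).
have mB := vmeas_zoom_box t.
have BS := zoom_box_sub t1.
have fB : (leb d (rvec @^-1` zoom_box t) < +oo)%E.
  by apply: le_lt_trans (zoom_box_vol t0) _; rewrite ltry.
have iB : vintg (zoom_box t) (fun z => `|g j z|).
  apply: vintg_norm; have [_ ig' _] := wg j; apply: ig'; first exact: cbox_compact.
  by move=> z /BS; exact: SOm.
have iS : vintg S (fun z => `|g j z| `^ p) by apply: vintgS SOm (ig j).
have iSB : vintg (zoom_box t) (fun z => `|g j z| `^ p) by apply: vintgS BS iS.
apply: (@le_trans _ _ (vint (zoom_box t) (fun z => l + l * (l^-1 `^ p * `|g j z| `^ p)))).
  apply: vint_le => //.
    by apply: vintgD => //; [exact: vintg_cst|do 2 apply: vintgZ => //].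
  by move=> z _; exact: young_powR.
rewrite vintD //; [|exact: vintg_cst|by do 2 apply: vintgZ => //].
apply: lerD.
  rewrite vint_cst // ler_pM2l //.
  by rewrite -lee_fin fineK ?ge0_fin_numE //; exact: zoom_box_vol.
rewrite vintZ //; last exact: vintgZ.
rewrite vintZ // ler_pM2l // ler_wpM2l ?powR_ge0 //.
by apply: vint_le_sub => // z _; exact: powR_ge0.
Qed.

Lemma avg_deriv_bound t : 1 <= t ->
  `|vint Om (fun z => v z * \sum_j pderiv j (flux j t) z)| <=
  (L + 1) * (d%:R * 4 ^+ d + 1) * r ^+ d.+1 * (1 + energy) `^ p^-1 * t `^ (d%:R / p - 1 - 1).
Proof.
move=> t1; have t0 : 0 < t by rewrite (lt_le_trans ltr01).
have E1 : 0 < 1 + energy by rewrite ltr_pwDl.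
rewrite (avg_deriv_weak t1 wg) normrN.
set Lam := (1 + energy) `^ p^-1; have Lam0 : 0 < Lam by exact: powR_gt0.
(* This parameter balances Young's inequality: [l^-1 ^ p] is [t ^- d / (1 + energy)], so both terms
   are at most a constant times [l * r ^ d * t ^- d]. The bound [t ^ (d - 2)] on the flux then
   leaves the power [d / p - 2] of [t]. The 1 added to [energy] keeps [l] positive. *)
pose l := t `^ (d%:R / p) * Lam; have l0 : 0 < l by rewrite mulr_gt0 // powR_gt0.
have lp : l^-1 `^ p = t ^- d * (1 + energy)^-1.
  rewrite -powR_inv1 ?ltW // -powRrM mulN1r powRN powRM ?powR_ge0 //.
  rewrite -!powRrM divfK ?mulVf ?gt_eqF // powRr1 ?(ltW E1) // powR_mulrn ?(ltW t0) //.
  by rewrite invfM.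
have k0 : 0 <= t ^+ d.-1 * ((L + 1) * r / t).
  by rewrite !mulr_ge0 ?exprn_ge0 ?invr_ge0 ?addr_ge0 // ltW.
apply: (@le_trans _ _ (\sum_j t ^+ d.-1 * ((L + 1) * r / t) * (l * (4 * r / t) ^+ d +
    l * (l^-1 `^ p * vint S (fun z => `|g j z| `^ p))))).
  apply: le_trans (ler_norm_sum _ _ _) _; apply: ler_sum => j _.
  apply: (@le_trans _ _ (t ^+ d.-1 * ((L + 1) * r / t) * vint (zoom_box t) (fun z => `|g j z|))); last first.
    by apply: ler_wpM2l => //; exact: vint_zoom_box.
  have mB := vmeas_zoom_box t.
  have BOm : zoom_box t `<=` Om by move=> z /(zoom_box_sub t1); exact: SOm.
  have iB : vintg (zoom_box t) (g j).
    by have [_ ig' _] := wg j; apply: ig' => //; exact: cbox_compact.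
  have mf : vmfun (zoom_box t) (flux j t).
    by apply: vmfunS BOm (vmfun_elementary d_gt0 oOm (elementary_flux _ _ _ _ _)).
  rewrite (@vint_sub _ _ (zoom_box t)) => [|//|z _ /(flux_out j t0) ->]; last by rewrite mulr0.
  have ifl : vintg (zoom_box t) (fun z => g j z * flux j t z).
    by apply: vintg_mul_bounded mf _ => // z _; exact: flux_le.
  apply: le_trans (vint_norm_le mB ifl) _.
  rewrite -vintZ //; last exact: vintg_norm.
  apply: vint_le => //; first exact: vintg_norm.
    by apply: vintgZ => //; exact: vintg_norm.
  by move=> z _; rewrite normrM mulrC ler_wpM2r // flux_le.
rewrite -mulr_sumr big_split /= sumr_const card_ord -!mulr_sumr.
have -> : \sum_j vint S (fun z => `|g j z| `^ p) = r ^+ d * energy.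
  by rewrite /energy mulrA divff ?mul1r // gt_eqF // exprn_gt0.
rewrite lp !powRB ?(gt_eqF t0) ?implybT // powRr1 ?(ltW t0) //.
rewrite -[(l * _) *+ d]mulr_natl /l !exprMn exprVn.
set X := t `^ _; set e := (1 + energy)^-1 * energy.
have e1 : e <= 1 by rewrite /e mulrC ler_pdivrMr // mul1r lerDr.
have td : t ^+ d = t * t ^+ d.-1 by rewrite -exprS prednK.
have T0 : t ^+ d.-1 != 0 by rewrite expf_neq0 // gt_eqF.
have tn : t != 0 by rewrite gt_eqF.
have -> : t ^+ d.-1 * ((L + 1) * r / t) * (d%:R * (X * Lam * (4 ^+ d * r ^+ d / t ^+ d)) +
   X * Lam * (t ^- d * (1 + energy)^-1 * (r ^+ d * energy))) =
   (L + 1) * (d%:R * 4 ^+ d + e) * r ^+ d.+1 * Lam * (X / t / t).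
  by rewrite td exprS /e; field; rewrite T0 tn gt_eqF.
apply: ler_wpM2r; first by rewrite !mulr_ge0 ?invr_ge0 ?powR_ge0 // ltW.
apply: ler_wpM2r; first exact: ltW.
apply: ler_wpM2r; first by rewrite exprn_ge0 // ltW.
by apply: ler_wpM2l; [rewrite addr_ge0|rewrite lerD2l].
Qed.

Hypothesis iv : vintg Om v.

Let del_lt1 : d%:R / p < 1. Proof. by rewrite ltr_pdivrMr // mul1r. Qed.

(** The exponent [d / p - 2] is below -1, so the primitive [F] stays bounded and the variation is
    controlled uniformly in [T]. *)
Lemma avg_variation T : 1 <= T -> `|avg v T - avg v 1| <=
  (L + 1) * (d%:R * 4 ^+ d + 1) * r ^+ d.+1 * (1 + energy) `^ p^-1 / (1 - d%:R / p).
Proof.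
move=> T1; set K := (L + 1) * _ * _ * _.
have K0 : 0 <= K.
  by rewrite !mulr_ge0 ?powR_ge0 ?exprn_ge0 ?addr_ge0 ?mulr_ge0 // ltW.
have D0 : 0 < 1 - d%:R / p by rewrite subr_gt0.
pose F (t : R) := - (K / (1 - d%:R / p)) * t `^ (d%:R / p - 1).
apply: (@le_trans _ _ (F T - F 1)).
  apply: (derive_bound_le (F' := fun t => K * t `^ (d%:R / p - 1 - 1)) T1).
  - by move=> t /andP[t1 _]; apply: avg_derive => //; exact: lt_le_trans t1.
  - move=> t /andP[t1 _]; have t0 : 0 < t by exact: lt_le_trans t1.
    have := is_deriveZ (- (K / (1 - d%:R / p))) (is_derive1_powR (d%:R / p - 1) t0).
    rewrite /GRing.scale /= (_ : _ * (_ * _) = K * t `^ (d%:R / p - 1 - 1)) //.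
    by set W := t `^ _; move: D0; set q := d%:R / p => D0'; field; rewrite gt_eqF.
  - by move=> t /andP[t1 _]; exact: avg_deriv_bound.
rewrite /F powR1 mulr1 opprK mulNr gerDr.
by rewrite oppr_le0 mulr_ge0 ?divr_ge0 ?powR_ge0 // ltW.
Qed.

End bound.

Lemma weak_deriv_cst (k : R) j : is_weak_deriv Om [:: j] (fun=> k) (fun=> 0).
Proof.
apply: (@difference_quotient_weak_deriv _ _ d_gt0 Om (fun=> k) (fun=> 0) j `|k| 0 oOm bOm) => //.
- exact: vmfun_cst.
- by move=> y t _ _ _; rewrite subrr normr0 mul0r.
- by move=> y _; under eq_fun do rewrite subrr mulr0; exact: cvg_cst.
Qed.

(** Conservation of mass: a constant has weak gradient 0, so the derivative of its average
    vanishes. *)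
Lemma avg_cst T : 1 <= T -> avg (fun=> 1) T = avg (fun=> 1) 1.
Proof.
move=> T1; apply/eqP; rewrite -subr_eq0 -normr_le0.
have d1 (t : R) : 1 <= t <= T -> is_derive t 1 (avg (fun=> 1)) 0.
  move=> /andP[t1 _]; have t0 : 0 < t by exact: lt_le_trans t1.
  have := avg_derive x c d_gt0 oOm bOm r_gt0 t0 (vintg_cst 1 mOm fOm).
  rewrite (@avg_deriv_weak _ (fun=> fun=> 0) t t1 (weak_deriv_cst 1)) big1 ?oppr0 // => j _.
  by under eq_fun do rewrite mul0r; exact: vint0.
have d2 (t : R) : 1 <= t <= T -> is_derive t 1 (fun=> 0 : R) 0 by move=> _; exact: is_derive_cst.
have d3 (t : R) : 1 <= t <= T -> `|0 : R| <= 0 by rewrite normr0.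
by have := derive_bound_le T1 d1 d2 d3; rewrite subr0.
Qed.

(** On the half-size box around [c], which has volume [r ^ d], each of the two factors of [rho] in
    every coordinate has argument above [1 / 2], hence is at least [exp (-2)]. *)
Lemma avg1_ge : expR (- 4) ^+ d * r ^+ d <= avg (fun=> 1) 1.
Proof.
pose B := obox (fun i => c 0 i - r / 2) (fun i => c 0 i + r / 2).
have BOm : B `<=` Om.
  move=> y By; apply: SOm; have := HS (s := 1) (y := y).
  rewrite subrr scale0r add0r scale1r ltr01 lexx; apply=> // i.
  by have /andP[h1 h2] := By i; have := r_gt0; move=> r0; apply/andP; split; lra.
have mB : vmeas B by apply: vmeas_open => //; exact: obox_open.
have fB : leb d (rvec @^-1` B) = (r ^+ d)%:E.
  rewrite preimage_obox leb_box; last by move=> i; have := r_gt0; lra.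
  by congr EFin; rewrite -[in RHS](card_ord d) -prodr_const; apply: eq_bigr => i _; field.
have ik : vintg Om (fun z => 1 * kern 1 z) by apply: vintg_kern => //; exact: vintg_cst.
rewrite -[r ^+ d]/(fine (r ^+ d)%:E) -fB -vint_cst // ?fB ?ltry //.
apply: le_trans (vint_le_sub mB mOm BOm ik _); last first.
  by move=> z _; rewrite mul1r kern_ge0.
apply: vint_le => //; first by apply: vintg_cst; rewrite ?fB ?ltry.
  by apply: vintgS BOm ik.
move=> z Bz; rewrite mul1r /kern expr1n mul1r /rho /bump -[in leLHS](card_ord d) -prodr_const.
apply: ler_prod => i _; rewrite expR_ge0 /= !mul1r.
have := Bz i; set y := zoom 1 z 0 i => Bzi.
have yE : y = (z 0 i - c 0 i) / r by rewrite /y !mxE; ring.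
have /andP[y1 y2] : - (1 / 2) < y < 1 / 2.
  by rewrite yE ltr_pdivrMr // ltr_pdivlMr //; move: Bzi => /andP[h1 h2]; apply/andP; split; lra.
have fl (w : R) : 1 / 2 < w -> expR (- 2) <= flat 0 w.
  move=> w2; have w0 : 0 < w by lra.
  rewrite /flat w0 expr0 mul1r ler_expR lerN2 -[2]invrK lef_pV2 ?posrE //; lra.
rewrite (_ : - 4 = - 2 + - 2); last by ring.
rewrite expRD; apply: ler_pM; rewrite ?expR_ge0 //; apply: fl; lra.
Qed.

Lemma avg_limit v (e : R) : {within closure Om, continuous v} -> closure Om x -> vintg Om v -> 0 < e ->
  exists2 T, 1 <= T & `|avg v T - v x * avg (fun=> 1) T| <= e * avg (fun=> 1) T.
Proof.
move=> cv clx iv e0.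
have /cvgrPdist_le/(_ e e0) := (@subspace_continuousP _ _ _ v).1 cv x clx.
move=> /nbhs_ballP[q /= q0 Hq].
(* For this [T] the box carrying [kern T] lies within distance [q] of [x], where [v] differs from
   [v x] by at most [e]. *)
pose T := 1 + (L + 1) * r / q.
have T1 : 1 <= T by rewrite lerDl !mulr_ge0 ?invr_ge0 ?addr_ge0 // ltW.
have T0 : 0 < T by exact: lt_le_trans T1.
exists T => //.
have iT w : vintg Om w -> vintg Om (fun z => w z * kern T z).
  by move=> iw; apply: vintg_kern => //; exact: ltW.
have i1 : vintg Om (fun z => 1 * kern T z) by apply: iT; exact: vintg_cst.
rewrite /avg -!vintZ // -vintB //; [|exact: iT|exact: vintgZ].
apply: le_trans (vint_norm_le mOm _) _; first by apply: vintgB => //; [exact: iT|exact: vintgZ].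
apply: vint_le => //; [|exact: vintgZ|].
  by apply: vintg_norm; apply: vintgB => //; [exact: iT|exact: vintgZ].
move=> z Oz; have kT : 0 <= kern T z by rewrite kern_ge0 // ltW.
rewrite mul1r -mulrBl normrM (ger0_norm kT).
have [->|k0] := eqVneq (kern T z) 0; first by rewrite !mulr0.
apply: ler_wpM2r => //.
rewrite distrC; apply: Hq; last exact: subset_closure.
move: k0; rewrite mulf_eq0 negb_or => /andP[_ /(rho_zoom_supp T0) zb].
rewrite -ball_normE /ball_ /= distrC; apply: norm_lt_coord => // i; rewrite !mxE.
apply: le_lt_trans (zoom_box_dist i T0 zb) _.
by rewrite ltr_pdivrMr // /T mulrDr mulr1 mulrCA divff ?gt_eqF // mulr1 ltrDr.
Qed.

(** The average at a large [T] is close to [v x] times the mass, and its distance to the average at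
    1 is bounded independently of [T]. Dividing the variation, of order [r ^ (d + 1)], by a mass of
    at least [exp (-4) ^ d * r ^ d] leaves one power of [r]. *)
Lemma morrey v g : {within closure Om, continuous v} -> closure Om x -> vintg Om v ->
  (forall j, is_weak_deriv Om [:: j] v (g j)) ->
  (forall j, vintg Om (fun z => `|g j z| `^ p)) ->
  `|v x - avg v 1 / avg (fun=> 1) 1| <=
  (L + 1) * (d%:R * 4 ^+ d + 1) / (1 - d%:R / p) / expR (- 4) ^+ d * r * (1 + energy g) `^ p^-1.
Proof.
move=> cv clx iv wg ig.
have p0 : 0 < p by exact: le_lt_trans dp.
have D0 : 0 < 1 - d%:R / p by rewrite subr_gt0 ltr_pdivrMr // mul1r.
have m0 : 0 < expR (- 4) ^+ d * r ^+ d :> R by rewrite mulr_gt0 ?exprn_gt0 ?expR_gt0.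
have m1 := avg1_ge; have mgt : 0 < avg (fun=> 1) 1 by exact: lt_le_trans m1.
set m := avg (fun=> 1) 1 in m1 mgt *.
set V := (L + 1) * (d%:R * 4 ^+ d + 1) * r ^+ d.+1 * (1 + energy g) `^ p^-1 / (1 - d%:R / p).
have V0 : 0 <= V.
  apply: divr_ge0; last exact: ltW.
  by rewrite !mulr_ge0 ?powR_ge0 ?exprn_ge0 ?addr_ge0 ?mulr_ge0 // ltW.
apply: (@le_trans _ _ (V / m)); last first.
  apply: (@le_trans _ _ (V / (expR (- 4) ^+ d * r ^+ d))).
    by rewrite ler_wpM2l // lef_pV2.
  rewrite le_eqVlt /V exprS; apply/orP; left; apply/eqP; field.
  by rewrite !expf_neq0 ?subr_eq0 ?(gt_eqF p0) ?(gt_eqF dp) ?gt_eqF ?expR_gt0.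
rewrite ler_pdivlMr // -{2}(gtr0_norm mgt) -normrM mulrBl divfK ?gt_eqF //.
apply/ler_addgt0Pr => e e0.
have [T T1 HT] := avg_limit cv clx iv (divr_gt0 e0 mgt).
have {}HT : `|avg v T - v x * m| <= e / m * m.
  exact: (eq_ind _ (fun a => `|avg v T - v x * a| <= e / m * a) HT _ (avg_cst T1)).
rewrite divfK ?gt_eqF // in HT.
have := avg_variation wg ig iv T1; rewrite -/V => HV.
rewrite distrC in HT; apply: le_trans (ler_distD (avg v T) _ _) _.
by rewrite addrC; exact: lerD.
Qed.

End Morrey.

(** * Energy of the interpolant *)

Section VolumeAndLp.
Context {R : realType} {d : nat} (Om : set 'rV[R]_d).
Hypothesis d_gt0 : (0 < d)%N.
Hypotheses (oOm : open Om) (bOm : bounded_set Om).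
Implicit Types (A B : set 'rV[R]_d) (u f g : 'rV[R]_d -> R).

Let mOm : vmeas Om := vmeas_open d_gt0 oOm.
Let fOm : (leb d (rvec @^-1` Om) < +oo)%E := leb_bounded bOm mOm.

Definition vol A : R := fine (leb d (rvec @^-1` A)).

Lemma vol_le A B : vmeas A -> vmeas B -> A `<=` B -> (leb d (rvec @^-1` B) < +oo)%E ->
  vol A <= vol B.
Proof.
move=> mA mB AB fB.
have le : (leb d (rvec @^-1` A) <= leb d (rvec @^-1` B))%E.
  by apply: le_measure; rewrite ?inE // => t; exact: AB.
by rewrite fine_le ?ge0_fin_numE //; exact: le_lt_trans fB.
Qed.

Lemma vol_cube (c : 'rV[R]_d) (r : R) : 0 <= r ->
  leb d (rvec @^-1` obox (fun i => c 0 i - r) (fun i => c 0 i + r)) = ((2 * r) ^+ d)%:E.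
Proof.
move=> r0; rewrite preimage_obox leb_box; last by move=> i; lra.
by congr (_%:E); rewrite -[in RHS](card_ord d) -prodr_const; apply: eq_bigr => i _; ring.
Qed.

Lemma vint_indic A (k : R) : vmeas A -> A `<=` Om -> vint Om (fun x => k * \1_A x) = k * vol A.
Proof.
move=> mA AOm; rewrite (@vint_sub _ _ A) //.
  rewrite -vint_cst //; last by apply: le_lt_trans fOm; apply: le_measure; rewrite ?inE // => t; exact: AOm.
  by apply: vint_eq => x Ax; rewrite indicE mem_set // mulr1.
by move=> x _ nA; rewrite indicE memNset // mulr0.
Qed.

Lemma sum_vint_disjoint (I : finType) (P : pred I) (A : I -> set 'rV[R]_d) f :
  (forall i, P i -> vmeas (A i)) -> (forall i, P i -> A i `<=` Om) ->
  (forall i j x, P i -> P j -> A i x -> A j x -> i = j) ->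
  vintg Om f -> (forall x, Om x -> 0 <= f x) -> \sum_(i | P i) vint (A i) f <= vint Om f.
Proof.
move=> mA AOm dA i_f f0.
pose A' i := if P i then A i else set0.
have mA' i : vmeas (A' i) by rewrite /A'; case: ifP => [/mA //|_]; exact: measurable0.
have AOm' i : A' i `<=` Om by rewrite /A'; case: ifP => [/AOm //|_].
have ifA i : vintg Om (fun x => f x * \1_(A' i) x).
  apply: (@vintg_mul_bounded _ _ _ _ _ 1) => //; first exact: vmfun_indic.
  by move=> x _; rewrite indicE ger0_norm //; case: (_ \in _).
have -> : \sum_(i | P i) vint (A i) f = \sum_(i | P i) vint Om (fun x => f x * \1_(A' i) x).
  apply: eq_bigr => i Pi; have EA : A' i = A i by rewrite /A' Pi.
  rewrite [RHS](@vint_sub _ _ (A' i)) // => [|x _ nA]; last by rewrite indicE memNset // mulr0.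
  by rewrite EA; apply: vint_eq => x Ax; rewrite indicE mem_set // mulr1.
rewrite -vint_sum //; apply: vint_le => //; first exact: vintg_sum.
move=> x Ox; rewrite -mulr_sumr -[leRHS]mulr1; apply: ler_wpM2l; first exact: f0.
have [[i Pi Aix]|nA] := pselect (exists2 i, P i & A i x).
  rewrite (bigD1 i) //= big1 ?addr0; first by rewrite indicE; case: (_ \in _).
  move=> j /andP[Pj ji]; rewrite indicE memNset // /A' Pj => Ajx.
  by move: ji; rewrite (dA j i x) ?eqxx.
rewrite big1 // => i Pi; rewrite indicE memNset // /A' Pi => Aix.
by apply: nA; exists i.
Qed.

Lemma in_Lp_vintg (p : R) g : 0 < p -> in_Lp Om p%:E g -> vintg Om (fun z => `|g z| `^ p).
Proof.
move=> p0 [mg fg]; apply/integrableP; split.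
  apply/measurable_EFinP; apply: (measurableT_comp (measurable_powR p)).
  exact: measurableT_comp.
have : (Lpnorm Om p%:E g `^ p < +oo)%E by exact: poweR_lty.
rewrite /Lpnorm poweR_Lnorm ?gt_eqF // [in X in _ -> X]integral_mkcond.
congr (_ < _)%E; apply: eq_integral => t _; rewrite /patch /=.
case: ifP => _ /=; first by rewrite (ger0_norm (powR_ge0 _ _)).
by rewrite (_ : point = 0 :> R) // normr0 powR0 // gt_eqF.
Qed.

End VolumeAndLp.

(** * Gradient of the interpolant, element by element *)

Section Interpolant.
Context {R : realType} {d : nat} (Om : set 'rV[R]_d) (T : mesh R d) (L p : R).
Hypothesis d_gt0 : (0 < d)%N.
Hypothesis HT : triangulation Om T.
Hypotheses (oOm : open Om) (bOm : bounded_set Om) (pOm : polytopal Om) (neOm : Om !=set0).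
Hypotheses (L_gt0 : 0 < L) (dp : d%:R < p) (p_gt2 : 2 < p).
Hypothesis box_in : forall K, K \in elts T -> exists (c : 'rV[R]_d), exists2 r, 0 < r &
  obox (fun i => c 0 i - r) (fun i => c 0 i + r) `<=` simplex K /\
  forall x y, simplex K x -> simplex K y -> forall i, `|x 0 i - y 0 i| <= L * r.
Local Notation n := (nvert T).

Let mOm : vmeas Om := vmeas_open d_gt0 oOm.
Let fOm : (leb d (rvec @^-1` Om) < +oo)%E := leb_bounded bOm mOm.

(** The constant of [morrey] with [2 * L] in place of [L], because that lemma is applied to boxes of
    half-width [r / 2]. *)
Definition morrey_cst := (2 * L + 1) * (d%:R * 4 ^+ d + 1) / (1 - d%:R / p) / expR (- 4) ^+ d.

Lemma morrey_cst_ge0 : 0 <= morrey_cst.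
Proof.
have p0 : 0 < p by exact: le_lt_trans dp.
have h1 : 0 <= 1 - d%:R / p by rewrite subr_ge0 ler_pdivrMr // mul1r ltW.
apply: divr_ge0; last by rewrite exprn_ge0 // expR_ge0.
by rewrite divr_ge0 // !mulr_ge0 // !addr_ge0 ?mulr_ge0 ?exprn_ge0 // ltW.
Qed.

(** At [t = 1] the homothety is the identity, so its center is irrelevant. Hence all vertices of an
    element are compared with one and the same average. *)
Lemma avg_center (x c : 'rV[R]_d) r v : avg Om x c r v 1 = avg Om c c r v 1.
Proof.
apply: vint_eq => z _; congr (_ * (_ * rho _)).
by apply/rowP => i; rewrite !mxE; ring.
Qed.

Variables (v : 'rV[R]_d -> R) (u : 'rV[R]_d -> R^o) (g : 'I_d -> 'rV[R]_d -> R)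
  (G : {set 'I_n} -> 'I_d -> R).
Hypothesis cv : {within closure Om, continuous v}.
Hypothesis iv : vintg Om v.
Hypothesis wg : forall j, is_weak_deriv Om [:: j] v (g j).
Hypothesis ig : forall j, vintg Om (fun z => `|g j z| `^ p).
Hypotheses (Pu : P1 Om T u) (uv : forall z : 'I_n, u (vert z) = v (vert z)).
Hypothesis HG : forall K j x (t : R), K \in elts T -> simplex K x -> simplex K (x + t *: delta_mx 0 j) ->
    u (x + t *: delta_mx 0 j) - u x = t * G K j.

(** Intersecting with [Om] makes the inclusion in [Om] immediate and keeps these sets disjoint. *)
Let Kin (K : {set 'I_n}) := Kint K `&` Om.

Lemma vmeas_Kin K : K \in elts T -> vmeas (Kin K).
Proof. by move=> KT; apply: vmeasI => //; exact: (vmeas_Kint d_gt0 HT). Qed.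

Lemma P1_convex_dist K x (kappa M : R) : K \in elts T -> simplex K x ->
  (forall z : 'I_n, z \in K -> `|v (vert z) - kappa| <= M) -> `|u x - kappa| <= M.
Proof.
move=> KT Kx vM; have [w0 wK w1 _] := baryP Kx.
have E : u x = \sum_z bary K x z * u (vert z) := P1_barycentric Pu KT (baryP Kx).
rewrite E -[kappa]mul1r -w1 mulr_suml -sumrB.
apply: le_trans (ler_norm_sum _ _ _) _; rewrite -[M]mul1r -w1 mulr_suml.
apply: ler_sum => z _; rewrite -mulrBr normrM ger0_norm // uv.
have [/vM h|/wK ->] := boolP (z \in K); last by rewrite !mul0r.
by rewrite ler_wpM2l.
Qed.

(** [morrey] is applied at each vertex with the half-size box, whose closed version stays in the
    open box of half-width [r] and hence in the interior of [K]. The nodal deviations from [kappa]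
    are of order [r], and [slope_bound] divides this [r] out again. *)
Lemma slope_energy K j (c : 'rV[R]_d) (r : R) : K \in elts T -> 0 < r ->
  obox (fun i => c 0 i - r) (fun i => c 0 i + r) `<=` simplex K ->
  (forall x y, simplex K x -> simplex K y -> forall i, `|x 0 i - y 0 i| <= L * r) ->
  G K j ^+ 2 <= (2 * morrey_cst) ^+ 2 * (1 + energy (Kin K) (r / 2) p g).
Proof.
move=> KT r0 sub diam; have r2 : 0 < r / 2 by rewrite divr_gt0.
have L2 : 0 <= 2 * L by rewrite mulr_ge0 // ltW.
have Kc : simplex K c by apply: sub => i; rewrite ltrBlDr ltrDl r0.
have subO : obox (fun i => c 0 i - r) (fun i => c 0 i + r) `<=` Om.
  by apply: obox_closure_sub => // y /sub; exact: (simplex_sub_closure HT).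
have cb y : cbox (fun i => c 0 i - r / 2) (fun i => c 0 i + r / 2) y ->
    obox (fun i => c 0 i - r) (fun i => c 0 i + r) y.
  by move=> yb i; have /andP[h1 h2] := yb i; apply/andP; split; lra.
set kappa := avg Om c c (r / 2) v 1 / avg Om c c (r / 2) (fun=> 1) 1.
set Ee := energy _ _ _ _; have E0 : 0 <= Ee.
  rewrite mulr_ge0 ?invr_ge0 ?exprn_ge0 ?(ltW r2) //.
  by apply: sumr_ge0 => i _; apply: vint_ge0 => z _; exact: powR_ge0.
have vk z : z \in K -> `|v (vert z) - kappa| <= morrey_cst * (r / 2) * (1 + Ee) `^ p^-1.
  move=> zK; have Kz := simplex_vert zK; have clz := simplex_sub_closure HT KT Kz.
  have HS s y : 0 < s <= 1 -> cbox (fun i => c 0 i - r / 2) (fun i => c 0 i + r / 2) y ->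
      Kin K ((1 - s) *: vert z + s *: y).
    move=> s01 /cb yb; split; last by apply: half_segment => //; exact: subO.
    by apply: (Kint_segment HT) => //; exact: (obox_Kint HT KT sub).
  have cz i : `|c 0 i - vert z 0 i| <= 2 * L * (r / 2).
    by rewrite (_ : 2 * L * (r / 2) = L * r); [exact: diam|field].
  have := morrey d_gt0 oOm bOm r2 L2 (vmeas_Kin KT) (@subIsetr _ _ _) dp HS cz cv clz iv wg ig.
  by rewrite !(avg_center (vert z)).
have slope := slope_bound HG j KT r0 sub (fun x Kx => P1_convex_dist KT Kx vk).
have M0 := morrey_cst_ge0; have P0 : 0 <= (1 + Ee) `^ p^-1 := powR_ge0 _ _.
have p0 : 0 < p by exact: le_lt_trans dp.
have {}slope : `|G K j| <= 2 * morrey_cst * (1 + Ee) `^ p^-1.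
  apply: le_trans slope _; rewrite le_eqVlt; apply/orP; left; apply/eqP; field.
  by rewrite gt_eqF.
rewrite -[G K j ^+ 2]ger0_norm ?sqr_ge0 // normrX.
apply: (@le_trans _ _ ((2 * morrey_cst * (1 + Ee) `^ p^-1) ^+ 2)).
  by rewrite lerXn2r ?nnegrE //; apply: mulr_ge0 => //; exact: mulr_ge0.
rewrite exprMn ler_wpM2l ?sqr_ge0 // -powR_mulrn // -powRrM.
rewrite -[leRHS]powRr1 ?addr_ge0 //; apply: ler_powR; first by rewrite lerDl.
by rewrite mulrC ler_pdivrMr // mul1r ltW.
Qed.

(** The coefficients convert the element estimate into an integral over the interior of the element.
    The volume of [K] is at most [(4 * L * r) ^ d], which is [(2 * L) ^ d] times the volume
    [(2 * r) ^ d] of the inner box, and [(8 * L) ^ d] times the factor [(r / 2) ^ d] that [energy]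
    divides by. *)
Definition grad_density x := (2 * morrey_cst) ^+ 2 *
  ((2 * L) ^+ d + (8 * L) ^+ d * \sum_j `|g j x| `^ p).

Lemma grad_density_ge0 x : 0 <= grad_density x.
Proof.
rewrite mulr_ge0 ?sqr_ge0 // addr_ge0 ?exprn_ge0 ?mulr_ge0 ?exprn_ge0 ?mulr_ge0 ?(ltW L_gt0) //.
by apply: sumr_ge0 => j _; exact: powR_ge0.
Qed.

Lemma vintg_grad_density A : vmeas A -> A `<=` Om -> vintg A grad_density.
Proof.
move=> mA AOm; apply: vintgS AOm _ => //; apply: vintgZ => //; apply: vintgD => //.
  exact: vintg_cst.
by apply: vintgZ => //; exact: vintg_sum.
Qed.

Lemma element_energy K j : K \in elts T ->
  G K j ^+ 2 * vol (simplex K `&` Om) <= vint (Kin K) grad_density.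
Proof.
move=> KT; have [c [r r0 [sub diam]]] := box_in KT.
have r2 : 0 < r / 2 by rewrite divr_gt0.
have mK := vmeas_Kin KT; have KOm : Kin K `<=` Om by exact: subIsetr.
have mS : vmeas (simplex K `&` Om).
  by apply: vmeasI => //; apply: vmeas_closed => //; exact: (simplex_closed HT).
have Kc : simplex K c by apply: sub => i; rewrite ltrBlDr ltrDl r0.
have subO : obox (fun i => c 0 i - r) (fun i => c 0 i + r) `<=` Om.
  by apply: obox_closure_sub => // y /sub; exact: (simplex_sub_closure HT).
have fK : (leb d (rvec @^-1` (Kin K)) < +oo)%E.
  by apply: le_lt_trans fOm; apply: le_measure; rewrite ?inE // => t; exact: KOm.
have Lr : 0 < L * r by rewrite mulr_gt0.
(* The element lies in the closed cube of half-width [L * r] around [c]; doubling the half-width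
   gives an open cube of explicit volume. *)
have vK : vol (simplex K `&` Om) <= (4 * L * r) ^+ d.
  have E := @vol_cube _ _ c (2 * (L * r)); rewrite mulr_ge0 ?(ltW Lr) // in E.
  have -> : (4 * L * r) ^+ d = vol (obox (fun i => c 0 i - 2 * (L * r)) (fun i => c 0 i + 2 * (L * r))).
    by rewrite /vol E //=; congr (_ ^+ _); ring.
  apply: vol_le => //; first by apply: vmeas_open => //; exact: obox_open.
    move=> x [Kx _] i; have := diam x c Kx Kc i; rewrite ler_norml => /andP[h1 h2].
    by apply/andP; split; lra.
  by rewrite E ?ltry.
have vB : (2 * r) ^+ d <= vol (Kin K).
  have E := @vol_cube _ _ c r (ltW r0).
  have -> : (2 * r) ^+ d = vol (obox (fun i => c 0 i - r) (fun i => c 0 i + r)) by rewrite /vol E.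
  apply: vol_le => //; first by apply: vmeas_open => //; exact: obox_open.
  by move=> x xB; split; [exact: (obox_Kint HT KT sub)|exact: subO].
have iK j' : vintg (Kin K) (fun z => `|g j' z| `^ p) by apply: vintgS KOm (ig j').
have -> : vint (Kin K) grad_density = (2 * morrey_cst) ^+ 2 *
    ((2 * L) ^+ d * vol (Kin K) + (8 * L) ^+ d * \sum_j vint (Kin K) (fun z => `|g j z| `^ p)).
  rewrite /grad_density vintZ //; last first.
    by apply: vintgD => //; [exact: vintg_cst|apply: vintgZ => //; exact: vintg_sum].
  rewrite vintD //; [|exact: vintg_cst|by apply: vintgZ => //; exact: vintg_sum].
  by rewrite vint_cst // vintZ ?vint_sum //; exact: vintg_sum.
apply: (@le_trans _ _ ((2 * morrey_cst) ^+ 2 * (1 + energy (Kin K) (r / 2) p g) * (4 * L * r) ^+ d)).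
  by apply: ler_pM => //; [exact: sqr_ge0|rewrite fine_ge0|exact: (slope_energy j KT r0 sub diam)].
rewrite -mulrA ler_wpM2l ?sqr_ge0 // mulrDl mul1r.
apply: lerD.
  rewrite (_ : 4 * L * r = 2 * L * (2 * r)); last by ring.
  by rewrite exprMn ler_wpM2l // exprn_ge0 // mulr_ge0 // ltW.
rewrite /energy mulrAC le_eqVlt; apply/orP; left; apply/eqP; congr (_ * _).
rewrite -exprVn -exprMn; congr (_ ^+ _); field; by rewrite gt_eqF.
Qed.

(** [F] counts a point on a common face once for each element containing it. This is harmless: the
    square of the weak derivative is still at most [F], and [element_energy] charges the volume of
    each closed element to an integral over its interior, interiors being disjoint. *)
Lemma interpolant_grad j : vint Om (fun x => wpd Om j u x ^+ 2) <= vint Om grad_density.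
Proof.
have [h [wh mh hG]] := P1_weak_deriv d_gt0 HT oOm bOm pOm Pu HG j.
have mK K : K \in elts T -> vmeas (simplex K `&` Om).
  by move=> KT; apply: vmeasI => //; apply: vmeas_closed => //; exact: (simplex_closed HT).
pose A K := if K \in elts T then simplex K `&` Om else set0.
have mA K : vmeas (A K) by rewrite /A; case: ifP => [/mK //|_]; exact: measurable0.
pose F x := \sum_(K in elts T) G K j ^+ 2 * \1_(A K) x.
have iF K : vintg Om (fun x => G K j ^+ 2 * \1_(A K) x).
  apply: vintgZ => //; apply: (@vintg_bounded _ _ _ _ 1) => //; first exact: vmfun_indic.
  by move=> x _; rewrite indicE ger0_norm //; case: (_ \in _).
have mh2 : vmfun Om (fun x => h x ^+ 2).
  by under eq_fun do rewrite expr2; exact: vmfunM.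
have mw := wpd_vmfun d_gt0 oOm wh.
rewrite (@vint_aeq _ _ Om _ (fun x => h x ^+ 2)) //; first last.
- by apply: vaeS (wpd_ae d_gt0 oOm wh) => x _ ->.
- by under eq_fun do rewrite expr2; exact: vmfunM.
have hF x : Om x -> h x ^+ 2 <= F x.
  move=> Ox; have [K KT [Kx ->]] := hG x Ox.
  rewrite /F (bigD1 K) //= indicE mem_set; last by rewrite /A KT.
  by rewrite mulr1 lerDl sumr_ge0 // => K' _; rewrite mulr_ge0 ?sqr_ge0 // indicE.
apply: (@le_trans _ _ (vint Om F)).
  apply: vint_le => //; last exact: vintg_sum.
  apply: (vintg_dom mOm mh2 (vintg_sum _ _ mOm iF)) => x Ox.
  by rewrite ger0_norm ?sqr_ge0 //; exact: hF.
rewrite vint_sum //.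
apply: (@le_trans _ _ (\sum_(K in elts T) vint (Kin K) grad_density)); last first.
  apply: (@sum_vint_disjoint _ _ _ d_gt0 oOm _ (mem (elts T)) Kin).
  - by move=> K KT; exact: vmeas_Kin.
  - by move=> K _ x [].
  - by move=> K K' x KT K'T [Kx _] [K'x _]; exact: (Kint_disjoint HT KT K'T Kx K'x).
  - exact: vintg_grad_density.
  - by move=> x _; exact: grad_density_ge0.
apply: ler_sum => K KT; rewrite vint_indic //; last by rewrite /A KT; exact: subIsetr.
by rewrite /A KT; exact: element_energy.
Qed.

End Interpolant.

(** * Bounds on the initial energy *)

Section InitialEnergy.
Context {R : realType} {d : nat} (Om : set 'rV[R]_d) (T : mesh R d) (L p : R).
Hypothesis d_gt0 : (0 < d)%N.
Hypothesis HT : triangulation Om T.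
Hypotheses (oOm : open Om) (bOm : bounded_set Om) (pOm : polytopal Om) (neOm : Om !=set0).
Hypotheses (L_gt0 : 0 < L) (dp : d%:R < p) (p_gt2 : 2 < p).
Hypothesis box_in : forall K, K \in elts T -> exists (c : 'rV[R]_d), exists2 r, 0 < r &
  obox (fun i => c 0 i - r) (fun i => c 0 i + r) `<=` simplex K /\
  forall x y, simplex K x -> simplex K y -> forall i, `|x 0 i - y 0 i| <= L * r.
Local Notation n := (nvert T).
Implicit Types (v w : 'rV[R]_d -> 'rV[R]_3).

Let mOm : vmeas Om := vmeas_open d_gt0 oOm.
Let fOm : (leb d (rvec @^-1` Om) < +oo)%E := leb_bounded bOm mOm.

Lemma dot_sqr_ge0 k (a : 'rV[R]_k) : 0 <= dot a a.
Proof. by apply: sumr_ge0 => i _; rewrite -expr2 sqr_ge0. Qed.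

Lemma enorm_sqr k (a : 'rV[R]_k) : enorm a ^+ 2 = dot a a.
Proof. by rewrite sqr_sqrtr // dot_sqr_ge0. Qed.

Lemma dot_le_avg k (a b : 'rV[R]_k) : 2 * dot a b <= dot a a + dot b b.
Proof.
rewrite /dot mulr_sumr -big_split; apply: ler_sum => i _ /=.
by have := sqr_ge0 (a 0 i - b 0 i); lra.
Qed.

(** A convex combination of unit vectors is tested against itself: [2 a.b <= |a|^2 + |b|^2] at each
    node gives [2 |w|^2 <= 1 + |w|^2] for the value [w]. *)
Lemma Vh_enorm_le1 v x : Vh Om T v -> (forall z : 'I_n, enorm (v (vert z)) = 1) -> enorm (v x) <= 1.
Proof.
move=> Vv v1; have [Ox|nOx] := pselect (closure Om x); last first.
  have [_ _ ->//] := Vv; rewrite /enorm /dot big1 ?sqrtr0 // => i _; by rewrite mxE mul0r.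
set w := v x.
have E : dot w w = \sum_(z < n) hat Om z x * dot (v (vert z)) w.
  rewrite {1}/w (P1_expand HT x Vv) /dot.
  under [RHS]eq_bigr do rewrite mulr_sumr.
  rewrite exchange_big /=; apply: eq_bigr => i _.
  rewrite summxE mulr_suml; apply: eq_bigr => z _; rewrite !mxE; ring.
have : 2 * dot w w <= 1 + dot w w.
  have -> : 1 + dot w w = \sum_(z < n) hat Om z x * (1 + dot w w).
    by rewrite -mulr_suml (sum_hat HT Ox) mul1r.
  rewrite {1}E mulr_sumr; apply: ler_sum => z _.
  rewrite mulrCA ler_wpM2l ?(hat_ge0 HT) //.
  by apply: le_trans (dot_le_avg _ _) _; rewrite -enorm_sqr v1 expr1n.
move=> h; rewrite -(@ler_pXn2r _ 2) ?nnegrE ?sqrtr_ge0 // expr1n enorm_sqr; lra.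
Qed.

Lemma Linfnorm_le1 v : (forall x, enorm (v x) <= 1) -> 0 <= Linfnorm Om v <= 1.
Proof.
move=> v1; rewrite /Linfnorm.
have h0 : (0 <= Lpnorm Om +oo%E (fun x => enorm (v x)))%E by exact: Lnorm_ge0.
rewrite fine_ge0 //=.
suff h1 : (Lpnorm Om +oo%E (fun x => enorm (v x)) <= 1%:E)%E.
  by rewrite -lee_fin fineK // ge0_fin_numE // (le_lt_trans h1) // ltry.
rewrite /Lpnorm unlock /Lnorm; case: ifPn => _; last by rewrite lee_fin.
apply/ess_supP; apply: aeW => t /=; rewrite lee_fin /patch; case: ifP => _.
  by rewrite ger0_norm ?sqrtr_ge0 //=; exact: v1.
by rewrite (_ : point = 0 :> R) // normr0.
Qed.

Lemma ess_bounded_wpd j i v : Vh Om T v -> ess_bounded Om (wpd Om j (Defs.comp i v)).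
Proof. exact: (nodal_linear_wpd d_gt0 HT oOm bOm pOm j i).1. Qed.

Definition grad_sqr v x := \sum_(c < 3) \sum_(j < d) wpd Om j (Defs.comp c v) x ^+ 2.

Lemma wpd_le_grad_sqr v c j x : wpd Om j (Defs.comp c v) x ^+ 2 <= grad_sqr v x.
Proof.
rewrite /grad_sqr (bigD1 c) //= (bigD1 j) //= -addrA lerDl.
rewrite addr_ge0 ?sumr_ge0 // => [k _|k _]; first exact: sqr_ge0.
by apply: sumr_ge0 => l _; exact: sqr_ge0.
Qed.

Lemma grad_sqr_ge0 v x : 0 <= grad_sqr v x.
Proof. by do 2 (apply: sumr_ge0 => ? _); exact: sqr_ge0. Qed.

(** Each curl component is a difference of two derivatives, and [|s| <= 1 + s ^ 2] for each of them.
    This trades the Cauchy-Schwarz inequality for the finite volume of [Om]. *)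
Lemma curl_le v x i : `|curl Om v x 0 i| <= 2 + 2 * grad_sqr v x.
Proof.
have h k c : `|wpdn Om k (Defs.comp c v) x| <= 1 + grad_sqr v x.
  have : wpdn Om k (Defs.comp c v) x ^+ 2 <= grad_sqr v x.
    rewrite /wpdn; case: insubP => [j _ _|_]; first exact: wpd_le_grad_sqr.
    by rewrite expr0n grad_sqr_ge0.
  have := sqr_ge0 (`|wpdn Om k (Defs.comp c v) x| - 1); rewrite -[_ ^+ 2 <= _]/(_ <= _).
  rewrite sqrrB1 real_normK ?num_real //.
  have := sqr_ge0 (wpdn Om k (Defs.comp c v) x).
  have := normr_ge0 (wpdn Om k (Defs.comp c v) x).
  have := grad_sqr_ge0 v x; rewrite -mulr_natl; nra.
have hB k c l e : `|wpdn Om k (Defs.comp c v) x - wpdn Om l (Defs.comp e v) x| <= 2 + 2 * grad_sqr v x.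
  by apply: le_trans (ler_normB _ _) _; have := h k c; have := h l e; lra.
by rewrite /curl /row3 mxE; case: i => [[|[|[|//]]] Hi] /=; exact: hB.
Qed.

Lemma vintg_grad_sqr v : Vh Om T v -> vintg Om (grad_sqr v).
Proof.
move=> Vv; apply: vintg_sum => // c; apply: vintg_sum => // j.
apply: ess_bounded_vintg => //; under eq_fun do rewrite expr2.
by apply: ess_boundedM; exact: ess_bounded_wpd.
Qed.

Lemma L2gradE v : L2grad Om v v = vint Om (grad_sqr v).
Proof.
by rewrite /L2grad; apply: vint_eq => x _; apply: eq_bigr => c _; apply: eq_bigr => j _; rewrite expr2.
Qed.

(** The coordinates of [v] are at most 1 in absolute value, and three curl components of size at
    most [2 + 2 * grad_sqr] give the 6. *)
Lemma L2_curl_le v : Vh Om T v -> (forall x, enorm (v x) <= 1) ->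
  `|L2 Om v (curl Om v)| <= 6 * (vol Om + L2grad Om v v).
Proof.
move=> Vv v1.
have id : vintg Om (fun x => dot (v x) (curl Om v x)).
  apply: vintg_sum => // i; apply: ess_bounded_vintg => //; apply: ess_boundedM.
    exact: (nodal_linear_comp d_gt0 HT i).1.
  exact: (nodal_linear_curl d_gt0 HT oOm bOm pOm i).1.
have ig := vintg_grad_sqr Vv.
apply: le_trans (vint_norm_le mOm id) _.
rewrite L2gradE mulrDr -vint_cst // -vintZ // -vintD //; [|exact: vintg_cst|exact: vintgZ].
apply: vint_le => //; first exact: vintg_norm.
  by apply: vintgD => //; [exact: vintg_cst|exact: vintgZ].
move=> x _; apply: le_trans (ler_norm_sum _ _ _) _.
apply: (@le_trans _ _ (\sum_(i < 3) (2 + 2 * grad_sqr v x))); last first.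
  by rewrite sumr_const card_ord -mulr_natl; lra.
apply: ler_sum => i _; rewrite normrM -[leRHS]mul1r; apply: ler_pM => //; last exact: curl_le.
exact: le_trans (coord_le_enorm _ _) (v1 x).
Qed.

Lemma sum_beta : \sum_(z < n) beta Om z = vol Om.
Proof.
rewrite /beta -vint_sum // => [|z].
  rewrite -[RHS]mul1r -vint_cst //; apply: vint_eq => x Ox.
  by rewrite (sum_hat HT) //; exact: subset_closure.
apply: (@vintg_bounded _ _ _ _ 1) => //; first exact: (P1_vmfun d_gt0 (hatP HT z).1).
by move=> x _; rewrite ger0_norm ?(hat_ge0 HT) // (hat_le1 HT).
Qed.

Variables (m0 : 'rV[R]_d -> 'rV[R]_3) (g : 'I_3 -> 'I_d -> 'rV[R]_d -> R).
Hypothesis m0_cont : {within closure Om, continuous m0}.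
Hypothesis m0_unit : forall x, closure Om x -> enorm (m0 x) = 1.
Hypothesis wg : forall c j, is_weak_deriv Om [:: j] (Defs.comp c m0) (g c j).
Hypothesis gp : forall c j, in_Lp Om p%:E (g c j).

Lemma interp_unit (z : 'I_n) : enorm (interp Om T m0 (vert z)) = 1.
Proof. by rewrite (interp_vert HT); apply: m0_unit; exact: (closure_vert HT). Qed.

Definition grad_bound := \sum_(c < 3) \sum_(j < d) vint Om (grad_density L p (g c)).

Lemma interp_L2grad : L2grad Om (interp Om T m0) (interp Om T m0) <= grad_bound.
Proof.
have Vi := P1_interp HT m0.
have p0 : 0 < p by exact: lt_trans p_gt2.
have iw c j : vintg Om (fun x => wpd Om j (Defs.comp c (interp Om T m0)) x ^+ 2).
  apply: ess_bounded_vintg => //; under eq_fun do rewrite expr2.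
  by apply: ess_boundedM; exact: ess_bounded_wpd.
rewrite L2gradE vint_sum // => [|c]; last exact: vintg_sum.
apply: ler_sum => c _; rewrite vint_sum //; apply: ler_sum => j _.
have Pu := P1_comp c Vi; have [G HG] := P1_slopes HT Pu.
have cm : {within closure Om, continuous (Defs.comp c m0 : 'rV[R]_d -> R^o)}.
  move=> x; apply: (@continuous_comp (subspace (closure Om)) _ R m0 (fun M : 'rV[R]_3 => M 0 c) x).
    exact: m0_cont.
  exact: coord_continuous.
have im : vintg Om (Defs.comp c m0).
  apply: (@vintg_bounded _ _ _ _ 1) => //.
    apply: (@vmfunS _ _ _ (closure Om)); [|exact: subset_closure|].
      by apply: vmeas_closed => //; exact: closed_closure.
    by apply: vmfun_continuous => //; apply: vmeas_closed => //; exact: closed_closure.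
  move=> x Ox; apply: le_trans (coord_le_enorm _ _) _.
  by rewrite m0_unit //; exact: subset_closure.
apply: (interpolant_grad d_gt0 HT oOm bOm pOm neOm L_gt0 dp p_gt2 box_in cm im (wg c) _ Pu _ HG).
  by move=> k; exact: in_Lp_vintg p0 (gp c k).
by move=> z; rewrite /Defs.comp (interp_vert HT).
Qed.

(** The two curl terms coincide, which turns the 6 of [L2_curl_le] into 12. The nodal values are
    unit vectors, so the lumped norm squared is the sum of the weights [beta], that is the volume of
    [Om]. *)
Lemma initial_energy_le (ke kd la : R) : 0 < ke ->
  ahform Om T ke kd la (interp Om T m0) (interp Om T m0) <=
  ke * grad_bound + `|kd| * (12 * (vol Om + grad_bound)) + la * vol Om.
Proof.
move=> ke0; have Vi := P1_interp HT m0.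
have h1 := interp_L2grad.
have h2 := L2_curl_le Vi (fun x => Vh_enorm_le1 x Vi interp_unit).
set u := interp Om T m0 in Vi h1 h2 *.
have -> : ahform Om T ke kd la u u =
    ke * L2grad Om u u + kd * (2 * L2 Om u (curl Om u)) + la * lumped Om T u u.
  by rewrite /ahform /aform (L2C Om (curl Om u)); ring.
have -> : lumped Om T u u = vol Om.
  rewrite -sum_beta; apply: eq_bigr => z _.
  by rewrite -enorm_sqr interp_unit expr1n mulr1.
rewrite lerD2r; apply: lerD; first by rewrite ler_wpM2l // ltW.
apply: le_trans (ler_norm _) _; rewrite normrM ler_wpM2l // normrM ger0_norm //; lra.
Qed.

End InitialEnergy.

Unset Implicit Arguments.

Theorem lemma3p4 (R : realType) (d : nat) (Om : set 'rV[R]_d)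
    (Tfin al ga ke kd la p : R) (m0 : 'rV[R]_d -> 'rV[R]_3)
    (H : set R) (Th : R -> mesh R d)
  (hd : (1 <= d <= 3)%N)
  (Om_nonempty : Om !=set0) (Om_open : open Om) (Om_bounded : bounded_set Om)
  (Om_convex : convex_set Om) (Om_polytopal : polytopal Om)
  (Tfin_gt0 : 0 < Tfin) (al_gt0 : 0 < al) (ga_gt0 : 0 < ga) (ke_gt0 : 0 < ke)
  (p_gt : Num.max d%:R 2 < p) (p_le : d%:R * (1 / 2 - 1 / p) <= 1)
  (m0_cont : {within closure Om, continuous m0})
  (m0_unit : forall x, closure Om x -> enorm (m0 x) = 1)
  (m0_H4 : in_W Om 4%N 2%:E m0) (m0_W3p : in_W Om 3%N p%:E m0)
  (H_gt0 : forall h, H h -> 0 < h)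
  (Th_triangulation : forall h, H h -> triangulation Om (Th h))
  (Th_size : forall h, H h -> mesh_size (Th h) = h)
  (Th_shape_regular : shape_regular H Th)
  (Th_quasi_uniform : quasi_uniform H Th)
  (la_gt0 : 0 < la)
  (la_coercive : exists2 c : R, 0 < c & forall h, H h ->
     forall v, Vh Om (Th h) v ->
       c * H1norm Om v ^+ 2 <= ahform Om (Th h) ke kd la v v) :
  exists C : R, forall h, H h -> forall N : nat, (0 < N)%N ->
    let T := Th h in
    let k := Tfin / N%:R in
    let a := ahform Om T ke kd la in
    forall m : nat -> 'rV[R]_d -> 'rV[R]_3,
    midpoint_scheme Om T ke kd la al ga k N m0 m ->
    [/\ forall i, (i < N)%N -> forall z : 'I_(nvert T),
          enorm (m i.+1 (vert z)) = enorm (m i (vert z)),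
        Mh Om T (m 0%N) -> forall i, (i <= N)%N -> Mh Om T (m i),
        forall i, (i < N)%N ->
          ga / (2 * al) * (a (m i.+1) (m i.+1) - a (m i) (m i))
          + k * hnorm Om T (dt k m i) ^+ 2 = 0
      & \big[Num.max/0]_(j < N.+1)
            (Linfnorm Om (m j) ^+ 2 + H1norm Om (m j) ^+ 2)
        + k * (\sum_(i < N) hnorm Om T (dt k m i) ^+ 2) <= C].
Proof.
have d_gt0 : (0 < d)%N by case/andP: hd.
move: p_gt; rewrite gt_max => /andP[dp p2].
have [sigma Hsigma] := Th_shape_regular.
have [c c0 Hc] := la_coercive.
pose L := 16 * `|sigma| + 1.
have L0 : 0 < L by rewrite ltr_wpDl ?mulr_ge0.
(* The weak derivatives of [m0] are chosen before [h] and [N] are introduced, so the constant built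
   from them cannot depend on the mesh or the time step. *)
have [g Hg] : exists g : 'I_3 -> 'I_d -> 'rV[R]_d -> R, forall i j,
    is_weak_deriv Om [:: j] (Defs.comp i m0) (g i j) /\ in_Lp Om p%:E (g i j).
  have H' i : exists g : 'I_d -> 'rV[R]_d -> R, forall j,
      is_weak_deriv Om [:: j] (Defs.comp i m0) (g j) /\ in_Lp Om p%:E (g j).
    have H'' j : exists g, is_weak_deriv Om [:: j] (Defs.comp i m0) g /\ in_Lp Om p%:E g.
      exact: (m0_W3p i [:: j] isT).
    by have [f Hf] := choice H''; exists f.
  by have [f Hf] := choice H'; exists f.
pose C0 := ke * grad_bound Om L p g + `|kd| * (12 * (vol Om + grad_bound Om L p g)) + la * vol Om.
(* The 1 bounds the squared sup norm, [C0 / c] the squared H1 norm through coercivity, and the last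
   term the dissipation; [C0] bounds the initial energy. *)
exists (1 + C0 / c + ga / (2 * al) * C0) => h Hh N N0 /= m Hm.
have HT := Th_triangulation h Hh.
have box_diam K : K \in elts (Th h) -> exists (c : 'rV[R]_d), exists2 r, 0 < r &
    obox (fun i => c 0 i - r) (fun i => c 0 i + r) `<=` simplex K /\
    forall x y, simplex K x -> simplex K y -> forall i, `|x 0 i - y 0 i| <= L * r.
  by move=> KT; exact: (shape_regular_box hd Om_bounded HT KT (Hsigma h Hh K KT)).
have box_in K : K \in elts (Th h) -> exists (c : 'rV[R]_d), exists2 r, 0 < r &
    obox (fun i => c 0 i - r) (fun i => c 0 i + r) `<=` simplex K.
  by move=> /box_diam[x [r r0 [sub _]]]; exists x, r.
have k0 : 0 < Tfin / N%:R by rewrite divr_gt0 ?ltr0n.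
have en := scheme_enorm d_gt0 HT Om_open Om_bounded Om_polytopal Om_nonempty box_in k0 Hm.
have energy := scheme_energy d_gt0 HT Om_open Om_bounded Om_polytopal Om_nonempty box_in al_gt0 ga_gt0 k0 Hm.
have le0 := scheme_energy_le d_gt0 HT Om_open Om_bounded Om_polytopal Om_nonempty box_in al_gt0 ga_gt0 k0 Hm.
have diss := scheme_dissipation d_gt0 HT Om_open Om_bounded Om_polytopal Om_nonempty box_in al_gt0 ga_gt0 k0 Hm.
have Vm i : (i <= N)%N -> Vh Om (Th h) (m i) by exact: (scheme_Vh HT Hm).
have enorm0 i (z : 'I_(nvert (Th h))) : (i <= N)%N -> enorm (m i (vert z)) = enorm (m 0%N (vert z)).
  by elim: i => // i IH iN; rewrite en // IH // ltnW.
have unit i (z : 'I_(nvert (Th h))) : (i <= N)%N -> enorm (m i (vert z)) = 1.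
  by move=> iN; rewrite enorm0 //; have [-> _ _] := Hm; exact: (interp_unit HT m0_unit).
have a0 : ahform Om (Th h) ke kd la (m 0%N) (m 0%N) <= C0.
  have [-> _ _] := Hm.
  exact: (initial_energy_le d_gt0 HT Om_open Om_bounded Om_polytopal Om_nonempty L0 dp p2 box_diam
    m0_cont m0_unit (fun i j => (Hg i j).1) (fun i j => (Hg i j).2) kd la ke_gt0).
have H1 i : (i <= N)%N -> H1norm Om (m i) ^+ 2 <= C0 / c.
  move=> iN; rewrite ler_pdivlMr // mulrC.
  by apply: le_trans (Hc h Hh _ (Vm i iN)) _; exact: le_trans (le0 i iN) a0.
have Li i : (i <= N)%N -> Linfnorm Om (m i) ^+ 2 <= 1.
  move=> iN; have /andP[l0 l1] := Linfnorm_le1 Om (fun x => Vh_enorm_le1 HT x (Vm i iN) (fun z => unit i z iN)).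
  by rewrite expr_le1.
split=> //.
- by move=> i iN z; exact: en.
- by move=> [_ m1] i iN; split; [exact: Vm|move=> z; exact: unit].
- apply: lerD.
    apply: bigmax_le => [|i _].
      by rewrite addr_ge0 // (le_trans _ (H1 0%N isT)) // sqr_ge0.
    by apply: lerD; [apply: Li|apply: H1]; rewrite -ltnS ltn_ord.
  rewrite diss ler_pM2l ?divr_gt0 ?mulr_gt0 //.
  (* Coercivity makes the final energy nonnegative, so the energy drop is at most the initial
     energy. *)
  have aN : 0 <= ahform Om (Th h) ke kd la (m N) (m N).
    by apply: le_trans (Hc h Hh _ (Vm N (leqnn N))); rewrite mulr_ge0 ?sqr_ge0 // ltW.
  by apply: le_trans a0; rewrite gerBl.
Qed.
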